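(* Let $(V,\xi)$ be a closed contact manifold, and $(K,\theta)$ a supporting open book with defining map $h \colon V \to \mathbb{C}$. Then the equations $\alpha$ of $\xi$ such that $d(\alpha/|h|)$ induces an ideal Liouville structure on each page form a non-empty convex cone.
   Context: All objects are smooth; contact structures are cooriented, and an equation of $\xi$ is a $1$-form $\alpha$ with cooriented kernel $\xi$. A domain is a compact manifold with boundary. An ideal Liouville structure on a domain $F$ is an exact symplectic form $\omega$ on $\operatorname{Int} F$ admitting a primitive $\lambda$ such that for some (and then any) function $u \colon F \to \mathbb{R}_{\ge 0}$ with regular level set $\partial F = \{u=0\}$, the product $u\lambda$ extends to a smooth $1$-form on $F$ which induces a contact form on $\partial F$. An open book in a closed manifold $V$ is a pair $(K,\theta)$ where $K \subset V$ is a codimension $2$ submanifold with trivial normal bundle and $\theta \colon V-K \to \mathbb{S}^1 = \mathbb{R}/2\pi\mathbb{Z}$ is a smooth locally trivial fibration which, in some neighborhood $\mathbb{D}^2\times K$ of $K=\{0\}\times K$, is the angular coordinate in $\mathbb{D}^2-\{0\}$. The pages are the closures of the fibers of $\theta$, namely $F_t = K\cup\{\theta=2\pi t\}$, and $K$ is the binding. The binding and the pages are cooriented by the canonical orientation of $\mathbb{S}^1$, hence oriented when $V$ is oriented, $K$ being oriented as the boundary of every page. A defining map $h$ for $(K,\theta)$ is a smooth map $h \colon V \to \mathbb{C}$ vanishing transversely, with $K = \{h=0\}$ and $\theta = h/|h|$ on $V-K$ (with $\mathbb{S}^1$ identified with the unit circle). The contact structure $\xi$ is supported by $(K,\theta)$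 (and $(K,\theta)$ is a supporting open book) if $\xi$ admits an equation $\alpha$ such that $\alpha$ induces a positive contact form on $K$ and $d\alpha$ induces a positive symplectic form on the fibers of $\theta$, orientations coming from the orientation of $V$ defined by $\xi$. *)

(* Defs.v *)
(* Manifolds are topological spaces with an explicit smooth
   atlas; tangent vectors and differential forms are handled through their
   expressions in the charts of the atlas, and submanifolds (binding, pages,
   fibres) are subsets of the ambient manifold. *)
From mathcomp Require Import all_boot all_order all_algebra perm.
From mathcomp Require Import all_classical all_reals all_analysis.

Set Implicit Arguments.
Unset Strict Implicit.
Unset Printing Implicit Defensive.

Import Order.TTheory GRing.Theory Num.Theory.
Import numFieldNormedType.Exports.

Local Open Scope classical_set_scope.
Local Open Scope ring_scope.

Section Smooth.
Context {R : realType}.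

(* Only meaningful for U open and E finite-dimensional. *)
Fixpoint Ck {E F : normedModType R} (k : nat) (U : set E) (f : E -> F) : Prop :=
  if k is k'.+1 then
    (forall x, U x -> differentiable f x) /\
    (forall v : E, Ck k' U (fun x => 'D_v f x))
  else forall x, U x -> {for x, continuous f}.

Definition Cinf {E F : normedModType R} (U : set E) (f : E -> F) : Prop :=
  forall k, Ck k U f.

(* A chart is a homeomorphism from cdom onto cimg with inverse cinv; the values
   of cmap and cinv outside these sets are irrelevant. *)
Record chart (E : normedModType R) (M : Type) := Chart {
  cdom : set M;
  cimg : set E;
  cmap : M -> E;
  cinv : E -> M }.

Record atlased (E : normedModType R) := Atlased {
  points :> topologicalType;
  atlas : set (chart E points) }.

Arguments atlas {E} a _.

Definition is_chart (E : normedModType R) (M : topologicalType)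
    (c : chart E M) : Prop :=
  [/\ open (cdom c), open (cimg c),
      (forall p, cdom c p -> cimg c (cmap c p) /\ cinv c (cmap c p) = p),
      (forall x, cimg c x -> cdom c (cinv c x) /\ cmap c (cinv c x) = x) &
      (forall p, cdom c p -> {for p, continuous (cmap c)}) /\
      (forall x, cimg c x -> {for x, continuous (cinv c)})].

Definition manifold (E : normedModType R) (M : atlased E) : Prop :=
  [/\ hausdorff_space M,
      @second_countable M,
      (forall c, atlas M c -> is_chart c),
      (forall p : M, exists2 c, atlas M c & cdom c p) &
      (forall c d, atlas M c -> atlas M d ->
         Cinf [set x | cimg c x /\ cdom d (cinv c x)] (cmap d \o cinv c))].

Definition closed_manifold (E : normedModType R) (M : atlased E) : Prop :=
  manifold M /\ compact [set: M].

Definition flat (E : normedModType R) : atlased E :=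
  @Atlased E E [set Chart setT setT id id].

Definition prod_chart (E F : normedModType R) (M N : Type)
    (c : chart E M) (d : chart F N) : chart (E * F)%type (M * N)%type :=
  Chart (cdom c `*` cdom d) (cimg c `*` cimg d)
        (fun p => (cmap c p.1, cmap d p.2)) (fun x => (cinv c x.1, cinv d x.2)).

Definition prodm (E F : normedModType R) (M : atlased E) (N : atlased F) :
    atlased (E * F)%type :=
  @Atlased _ (points M * points N)%type
    [set e | exists c d, [/\ atlas M c, atlas N d & e = prod_chart c d]].

Definition smooth_open (E F : normedModType R) (M : atlased E) (N : atlased F)
    (U : set M) (f : M -> N) : Prop :=
  (forall p, U p -> {for p, continuous f}) /\
  (forall c d, atlas M c -> atlas N d ->
     Cinf [set x | [/\ cimg c x, U (cinv c x) & cdom d (f (cinv c x))]]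
          (cmap d \o f \o cinv c)).

(* A map on an arbitrary subset is smooth if it extends locally to a smooth map
   on an open set. *)
Definition smooth_on (E F : normedModType R) (M : atlased E) (N : atlased F)
    (A : set M) (f : M -> N) : Prop :=
  forall p, A p -> exists (U : set M) (g : M -> N),
    [/\ open U, U p, smooth_open U g & forall q, A q -> U q -> g q = f q].

Definition diffeo_on (E F : normedModType R) (M : atlased E) (N : atlased F)
    (A : set M) (B : set N) (f : M -> N) (g : N -> M) : Prop :=
  [/\ smooth_on A f, smooth_on B g,
      (forall p, A p -> B (f p) /\ g (f p) = p) &
      (forall q, B q -> A (g q) /\ f (g q) = q)].

(* The plane of complex numbers x + iy, as the real vector space of pairs
   (x, y).  The library norm of a pair is the sup norm, hence cmod. *)
Definition cplane : normedModType R := (R^o * R^o)%type.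

Definition cmod (z : cplane) : R := Num.sqrt (z.1 ^+ 2 + z.2 ^+ 2).

(* Im (conj(z) * w), positive iff (z, w) is a direct basis. *)
Definition cdet (z w : cplane) : R := z.1 * w.2 - z.2 * w.1.

Definition circle : set cplane := [set z | cmod z = 1].

Definition disc : set cplane := [set z | cmod z <= 1].

End Smooth.

Arguments atlas {R E} a _.
Arguments cplane R : clear implicits.

Section Forms.
Context {R : realType} {d : nat}.
Local Notation E := 'rV[R]_d.
Local Notation C := (cplane R).
Variable V : @atlased R E.

Definition smooth_fun (F : normedModType R) (U : set V) (f : V -> F) : Prop :=
  @smooth_on R E F V (flat F) U f.

(* Differential of f at cinv c x on the vector with coordinates v in c. *)
Definition dfun (F : normedModType R) (f : V -> F) (c : chart E V) (x v : E) :
    F :=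
  'd (f \o cinv c) x v.

Definition submersive (F : normedModType R) (f : V -> F) (p : V) : Prop :=
  forall c, atlas V c -> cdom c p ->
  forall y : F, exists v, dfun f c (cmap c p) v = y.

(* v represents in the chart c a vector of the tangent space at cinv c x of
   the submanifold (possibly with boundary) S of V: it is killed by the
   differentials of the local functions vanishing on S.  On the boundary of S
   this is the full tangent space of S. *)
Definition tangent (S : set V) (c : chart E V) (x v : E) : Prop :=
  forall (U : set V) (f : V -> R^o), open U -> U (cinv c x) ->
    smooth_fun U f -> (forall q, U q -> S q -> f q = 0) -> dfun f c x v = 0.

(* a c x v is the value of the form at the point cinv c x, on the vector with
   coordinates v in c; only c in the atlas and x in cimg c matter. *)
Definition form1 := chart E V -> E -> E -> R.
Definition form2 := chart E V -> E -> E -> E -> R.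

Definition smooth_form (U : set V) (a : form1) : Prop :=
  [/\ (forall c x, atlas V c -> cimg c x -> U (cinv c x) ->
         forall (t : R) v w, a c x (t *: v + w) = t * a c x v + a c x w),
      (forall c v, atlas V c ->
         Cinf [set x | cimg c x /\ U (cinv c x)]
              ((fun x => a c x v) : E -> R^o)) &
      (forall c e x v, atlas V c -> atlas V e -> cimg c x -> U (cinv c x) ->
         cdom e (cinv c x) ->
         a c x v = a e (cmap e (cinv c x)) (dfun (cmap e) c x v))].

Definition extd (a : form1) : form2 := fun c x v w =>
  'D_v ((fun y => a c y w) : E -> R^o) x - 'D_w ((fun y => a c y v) : E -> R^o) x.

Definition scalef (f : V -> R) (a : form1) : form1 :=
  fun c x v => f (cinv c x) * a c x v.

(* Alternating k-forms on E, as functions of the list of their k arguments. *)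
Definition wedge (k l : nat) (a b : seq E -> R) (e : seq E) : R :=
  (k`! * l`!)%:R^-1 *
  \sum_(s : 'S_(k + l)) (-1) ^+ s *
     a [seq e`_(s (lshift l i)) | i : 'I_k] *
     b [seq e`_(s (rshift k i)) | i : 'I_l].

Fixpoint wpow (w : seq E -> R) (m : nat) : seq E -> R :=
  if m is m'.+1 then wedge 2 m'.*2 w (wpow w m') else fun=> 1.

Definition pow2 (m : nat) (w : form2) (c : chart E V) (x : E) : seq E -> R :=
  wpow (fun e => w c x e`_0 e`_1) m.

(* a /\ (da)^m *)
Definition cvol (m : nat) (a : form1) (c : chart E V) (x : E) : seq E -> R :=
  wedge 1 m.*2 (fun e => a c x e`_0) (pow2 m (extd a) c x).

(* For S of dimension 2m+1, the form induced by a on S is a contact form. *)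
Definition contact_on (S : set V) (m : nat) (a : form1) : Prop :=
  forall c x (e : seq E), atlas V c -> cimg c x -> S (cinv c x) ->
    size e = m.*2.+1 -> free e -> {in e, forall v, tangent S c x v} ->
    cvol m a c x e != 0.

(* The form induced by w on S is nondegenerate; all forms w used below induce
   exact, hence closed, forms on S. *)
Definition nondegenerate_on (S : set V) (w : form2) : Prop :=
  forall c x v, atlas V c -> cimg c x -> S (cinv c x) ->
    tangent S c x v -> v != 0 -> exists2 v', tangent S c x v' & w c x v v' != 0.

Record cohyp := Cohyp {
  hyper : chart E V -> E -> set E;
  posside : chart E V -> E -> set E }.

Definition equation (xi : cohyp) (a : form1) : Prop :=
  smooth_form setT a /\
  forall c x, atlas V c -> cimg c x ->
    hyper xi c x = [set v | a c x v = 0] /\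
    posside xi c x = [set v | 0 < a c x v].

Definition submanifold2 (K : set V) : Prop :=
  closed K /\
  forall p, K p -> exists (U : set V) (f : V -> C),
    [/\ open U, U p, smooth_fun U f, submersive f p &
        forall q, U q -> (K q <-> f q = 0)].

(* The normal bundle TV/TK is trivialized by a pair of 1-forms along K. *)
Definition trivial_normal (K : set V) : Prop :=
  exists b1 b2 : form1, [/\ smooth_form setT b1, smooth_form setT b2 &
    forall c x v, atlas V c -> cimg c x -> K (cinv c x) ->
      (tangent K c x v <-> b1 c x v = 0 /\ b2 c x v = 0)].

(* F is a compact hypersurface of V with boundary dF. *)
Definition domain (F dF : set V) : Prop :=
  [/\ compact F, dF `<=` F,
      (forall p, F p -> ~ dF p -> exists (U : set V) (f : V -> R^o),
         [/\ open U, U p, smooth_fun U f, submersive f p &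
             forall q, U q -> ~ dF q /\ (F q <-> f q = 0)]) &
      (forall p, dF p -> exists (U : set V) (f : V -> C),
         [/\ open U, U p, smooth_fun U f, submersive f p &
             forall q, U q -> (F q <-> (f q).1 = 0 /\ 0 <= (f q).2) /\
                              (dF q <-> f q = 0)])].

(* w induces an ideal Liouville structure on the domain F, of dimension 2n.
   Functions and forms on F (resp. on its interior) are given by smooth
   extensions to neighborhoods in V; only their restrictions to F and to its
   tangent spaces are involved. *)
Definition ideal_liouville (n : nat) (F dF : set V) (w : form2) : Prop :=
  let intF := F `\` dF in
  [/\ domain F dF, nondegenerate_on intF w &
  exists (lam : form1) (O : set V),
    [/\ open O, intF `<=` O, smooth_form O lam,
        (forall c x v v', atlas V c -> cimg c x -> intF (cinv c x) ->
           tangent intF c x v -> tangent intF c x v' ->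
           w c x v v' = extd lam c x v v') &
    exists (u : V -> R^o) (b : form1) (W : set V),
      [/\ open W /\ F `<=` W,
          [/\ smooth_fun W u,
              (forall p, F p -> 0 <= u p),
              (forall p, F p -> (dF p <-> u p = 0)) &
              (forall c x, atlas V c -> cimg c x -> dF (cinv c x) ->
                 exists2 v, tangent F c x v & dfun u c x v != 0)],
          smooth_form W b,
          (forall c x v, atlas V c -> cimg c x -> intF (cinv c x) ->
             tangent intF c x v -> b c x v = scalef u lam c x v) &
          contact_on dF n.-1 b]]].

Definition fibre (K : set V) (theta : V -> C) (z : C) : set V :=
  [set p | ~ K p /\ theta p = z].

Definition page (K : set V) (theta : V -> C) (z : C) : set V :=
  K `|` fibre K theta z.

(* S^1 is the unit circle; the values of theta on K are irrelevant. *)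
Definition open_book (K : set V) (theta : V -> C) : Prop :=
  [/\ submanifold2 K, trivial_normal K,
      smooth_fun (~` K) theta /\ (forall p, ~ K p -> circle (theta p)),
      (forall z, circle z -> exists (J : set C)
           (f : C * V -> V) (g : V -> C * V),
         [/\ open J, J z,
             @diffeo_on R _ _ (prodm (flat C) V) V
               ((J `&` circle) `*` fibre K theta z)
               [set p | ~ K p /\ J (theta p)] f g &
             forall y q, J y -> circle y -> fibre K theta z q ->
               theta (f (y, q)) = y]) &
      exists (N : set V) (f : C * V -> V) (g : V -> C * V),
        [/\ K `<=` interior N,
            @diffeo_on R _ _ (prodm (flat C) V) V (disc `*` K) N f g,
            (forall q, K q -> f (0, q) = q) &
            (forall y q, disc y -> y != 0 -> K q ->
               theta (f (y, q)) = (cmod y)^-1 *: y)]].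

Definition defining_map (K : set V) (theta h : V -> C) : Prop :=
  [/\ smooth_fun setT h,
      K = [set p | h p = 0],
      (forall p, K p -> submersive h p) &
      (forall p, ~ K p -> theta p = (cmod (h p))^-1 *: h p)].

(* For V of dimension 2n+1. *)
Definition contact_structure (n : nat) (xi : cohyp) : Prop :=
  exists a, equation xi a /\ contact_on setT n a.

(* The orientation of V defined by xi is that of a /\ (da)^n for any equation a
   of xi.  A basis e of a fibre is positive if (nu, e) is, for nu increasing
   the angle theta.  Near K the pages are the inverse images by h of the rays
   issued from 0; so the page through a radial vector r is oriented by the
   bases f with (nu, f) positive, where (dh r, dh nu) is a direct basis of the
   plane, and the outward normal along K being -r, a basis e of TK is positive
   iff (nu, -r, e), or equivalently (r, nu, e), is positive in V. *)
Definition supports (n : nat) (xi : cohyp) (K : set V) (theta : V -> C) :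
    Prop :=
  exists a, [/\ equation xi a,
    contact_on K n.-1 a,
    (forall h, defining_map K theta h ->
     forall c x r nu (e : seq E), atlas V c -> cimg c x -> K (cinv c x) ->
       size e = (n.-1).*2.+1 -> {in e, forall v, tangent K c x v} ->
       0 < cdet (dfun h c x r) (dfun h c x nu) ->
       0 < cvol n a c x [:: r, nu & e] -> 0 < cvol n.-1 a c x e) &
    forall z, circle z ->
      nondegenerate_on (fibre K theta z) (extd a) /\
      (forall c x nu (e : seq E), atlas V c -> cimg c x ->
         fibre K theta z (cinv c x) ->
         size e = n.*2 -> {in e, forall v, tangent (fibre K theta z) c x v} ->
         0 < cdet z (dfun theta c x nu) ->
         0 < cvol n a c x (nu :: e) -> 0 < pow2 n (extd a) c x e)].

Definition convex_cone (A : set form1) : Prop :=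
  (forall (t : R) a, 0 < t -> A a -> A (fun c x v => t * a c x v)) /\
  (forall (t : R) a b, 0 <= t <= 1 -> A a -> A b ->
     A (fun c x v => t * a c x v + (1 - t) * b c x v)).

End Forms.

(* Main.v *)
From HB Require Import structures.
Require Import Defs.
From mathcomp Require Import all_boot all_order all_algebra perm.
From mathcomp Require Import all_classical all_reals all_analysis.
From mathcomp Require Import ring lra.

(** Let a0 be the equation given by the supporting property.  Off the binding,
    the tangent space of the page is the kernel of v |-> Im (conj h . dh(v)), and
    d a0 is nondegenerate on it; hence there is a unique field Y tangent to the
    pages with d a0 (Y, v) = a0 (v) for v tangent to the page ([liouville],
    [liouvilleP]).  Write Y F for the derivative of F along Y ([dliouville]).

    Every equation of xi is f a0 with f > 0 smooth ([equation_ratio]).  Put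
    F = f / |h|.  On the pages, contracting d(F a0) = F d a0 + dF /\ a0 with Y
    gives (F + Y F) a0, and an elementary computation shows that d(F a0) is
    nondegenerate there if and only if F + Y F has no zero
    ([nondeg_rescale], [nondegenerate_rescale]).

    If it has no zero, it is positive ([stretch_gt0]).  Indeed 1/F = |h|/f is
    continuous on the compact page and vanishes on the binding, so that if
    F + Y F were negative somewhere on a page, 1/F would have a maximum among
    the points where it is negative; there F has a local minimum along the page,
    so that Y F >= 0 and F + Y F > 0, a contradiction.

    Conversely, nondegeneracy is all that has to be checked: lambda = f a0 / |h|
    is a primitive, and for u = Re (conj z . h), which is |h| on the page of
    angle z, the product u lambda is f a0, which is a contact form on the binding
    ([ideal_liouville_of]).  So the forms to be studied are the f a0 with f > 0
    and F + Y F > 0 off the binding ([good_equationP]); since Y is fixed, these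
    conditions are preserved by positive linear combinations of the f
    ([good_factor_lin]).

    For existence take f = sqrt (1 + A |h|^2).  Then F + Y F > 0 amounts to
    Y |h|^2 < 2 |h|^2 + 2 A |h|^4 ([stretch_identity]).  Near the binding
    Y |h|^2 < 0: the contraction of (d a0)^n by Y is a positive multiple of
    a0 /\ (d a0)^(n-1) on the page, so the orientation conditions on the binding
    and on the page force Y to point towards the binding
    ([dliouville_rho_lt0]).  Away from the binding, |h| is bounded below and
    Y |h|^2 is bounded, and a large A is enough; compactness of V combines the
    two ([dliouville_rho_bound]).

    Tangent spaces are defined by the functions vanishing on a subset, so
    showing that a vector is tangent requires curves.  They are obtained by
    pushing straight lines through the local trivializations of the open book
    ([fibre_curve], [binding_tangent], [page_radial]). *)

Import Order.TTheory GRing.Theory Num.Theory.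
Import numFieldNormedType.Exports.
Local Open Scope classical_set_scope.
Local Open Scope ring_scope.

Set Implicit Arguments.
Unset Strict Implicit.
Unset Printing Implicit Defensive.

(** * Differential calculus on open sets *)

Lemma near_open {T : topologicalType} (W : set T) (P : T -> Prop) x :
  open W -> W x -> (forall y, W y -> P y) -> \forall y \near x, P y.
Proof. by move=> oW Wx WP; apply: filterS WP _; exact: open_nbhs_nbhs. Qed.

Section DiffLocal.
Context {R : realType} {E F G : normedModType R}.

(** Lets a differential be computed on any local model of the function; used
    whenever an identity between functions holds only in the domain of a chart. *)
Lemma is_diff_near_eq (f g : E -> F) (x : E) :
  (\near x, f x = g x) -> differentiable f x ->
  differentiable g x /\ 'd g x = 'd f x :> (E -> F).
Proof.
move=> fg df.
have fgx : f x = g x by exact: nbhs_singleton fg.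
have key : g \o shift x = cst (g x) + 'd f x +o_ 0 id.
  apply/eqaddoP => e e0.
  have /eqaddoP/(_ e e0) H := diff_locally df.
  have fg0 : \forall y \near (0 : E), f (y + x) = g (y + x).
    by have := fg; rewrite (near_shift 0 x) subr0.
  near=> y.
  have -> : (g \o shift x - (cst (g x) + 'd f x)) y =
            (f \o shift x - (cst (f x) + 'd f x)) y.
    by rewrite !fctE /= -fgx -(near fg0 y).
  by near: y; exact: H.
  Unshelve. all: end_near.
have dg : 'd g x = 'd f x :> (E -> F) by apply: diff_unique => //; exact: diff_continuous.
by split=> //; apply/diff_locallyP; rewrite dg; split=> //; exact: diff_continuous.
Qed.

Lemma differentiable_near (f g : E -> F) (x : E) :
  (\near x, f x = g x) -> differentiable f x -> differentiable g x.
Proof. by move=> fg df; have [] := is_diff_near_eq fg df. Qed.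

Lemma diff_near (f g : E -> F) (x v : E) :
  (\near x, f x = g x) -> differentiable f x -> 'd g x v = 'd f x v.
Proof. by move=> fg df; have [_ ->] := is_diff_near_eq fg df. Qed.

End DiffLocal.

Section CkCalculus.
Context {R : realType} {E F : normedModType R}.
Implicit Types (U W : set E) (f g : E -> F) (a b : E -> R^o).

Lemma Ck_continuous k U f x : Ck k U f -> U x -> {for x, continuous f}.
Proof.
case: k => [|k]; first by move=> fc /fc.
by move=> [fd _] /fd /differentiable_continuous.
Qed.

Lemma Ck_weak k U f : Ck k.+1 U f -> Ck k U f.
Proof.
elim: k f => [|k IH] f Cf; first by move=> x; exact: Ck_continuous Cf.
by case: Cf => fd fD; split=> // v; exact: IH.
Qed.

Lemma Ck_sub k U W f : W `<=` U -> Ck k U f -> Ck k W f.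
Proof.
move=> WU; elim: k f => [|k IH] f; first by move=> fc x /WU /fc.
by move=> [fd fD]; split=> [x /WU /fd//|v]; exact: IH (fD v).
Qed.

(** Since [Ck] speaks of iterated derivatives on the whole open set, smoothness
    has to be shown to be local before it can be transported between charts. *)
Lemma Ck_local k U f :
  (forall x, U x -> exists W g,
     [/\ open W, W x, Ck k W g & forall y, W y -> f y = g y]) -> Ck k U f.
Proof.
elim: k f => [|k IH] f fl.
  move=> x /fl [W] [g] [oW Wx /(_ _ Wx) gc fg].
  rewrite /prop_for /continuous_at (fg _ Wx).
  apply: cvg_trans gc; apply: near_eq_cvg.
  by apply: near_open oW Wx _ => y /fg.
split=> [x /fl [W] [g] [oW Wx [gd _] fg]|v].
  apply: differentiable_near (gd _ Wx).
  by apply: near_open oW Wx _ => y /fg.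
apply: IH => x /fl [W] [g] [oW Wx [_ gD] fg]; exists W, (fun y => 'D_v g y).
split=> //; first exact: gD.
move=> y Wy; apply: near_eq_derive.
exact: near_open oW Wy _.
Qed.

Lemma Ck_eq k U f g :
  open U -> (forall x, U x -> f x = g x) -> Ck k U g -> Ck k U f.
Proof. by move=> oU fg Cg; apply: Ck_local => x Ux; exists U, g. Qed.

Lemma Ck_cst k U (c : F) : Ck k U (fun=> c).
Proof.
have C0 j : Ck j U (fun=> 0 : F).
  elim: j => [|j IH]; first by move=> x _; exact: cst_continuous.
  split=> [x _|v]; first exact: differentiable_cst.
  by rewrite (_ : (fun x => 'D_v _ x) = fun=> 0) //; apply/funext => x; exact: derive_cst.
case: k => [|k]; first by move=> x _; exact: cst_continuous.
split=> [x _|v]; first exact: differentiable_cst.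
by rewrite (_ : (fun x => 'D_v _ x) = fun=> 0) //; apply/funext => x; exact: derive_cst.
Qed.

Lemma CkD k U f g : open U -> Ck k U f -> Ck k U g ->
  Ck k U (fun x => f x + g x).
Proof.
move=> oU; elim: k f g => [|k IH] f g.
  by move=> fc gc x Ux; apply: cvgD; [exact: fc|exact: gc].
move=> [fd fD] [gd gD]; split=> [x Ux|v].
  by apply: differentiableD; [exact: fd|exact: gd].
apply: Ck_eq (IH _ _ (fD v) (gD v)) => // x Ux.
by apply: deriveD; apply: diff_derivable; [exact: fd|exact: gd].
Qed.

End CkCalculus.

Section CkReal.
Context {R : realType} {E : normedModType R}.
Implicit Types (U W : set E) (a b : E -> R^o).

(** By induction on [k], the Leibniz formula only involves products of functions
    of class [k]. *)
Lemma CkM k U a b : open U -> Ck k U a -> Ck k U b ->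
  Ck k U (fun x => a x * b x : R^o).
Proof.
move=> oU; elim: k a b => [|k IH] a b.
  by move=> fc gc x Ux; apply: cvgM; [exact: fc|exact: gc].
move=> Ca Cb; case: (Ca) (Cb) => [ad aD] [bd bD]; split=> [x Ux|v].
  by apply: (@differentiableM _ _ a b); [exact: ad|exact: bd].
apply: (@Ck_eq _ _ _ _ _ _ (fun x => (a x * 'D_v b x : R^o) + (b x * 'D_v a x : R^o))) => //.
  move=> x Ux.
  by apply: (@deriveM _ _ a b); apply: diff_derivable; [exact: ad|exact: bd].
by apply: CkD => //; apply: IH; [exact: Ck_weak Ca|exact: bD|exact: Ck_weak Cb|exact: aD].
Qed.

Lemma CkV k U a : open U -> (forall x, U x -> a x != 0) -> Ck k U a ->
  Ck k U (fun x => (a x)^-1 : R^o).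
Proof.
move=> oU a0; elim: k => [|k IH].
  by move=> fc x Ux; apply: cvgV; [exact: a0|exact: fc].
move=> Ca; case: (Ca) => ad aD; split=> [x Ux|v].
  by apply: (@differentiableV _ _ a); [exact: ad|exact: a0].
have CV := IH (Ck_weak Ca).
apply: (@Ck_eq _ _ _ _ _ _ (fun x => (-1 : R^o) * ((a x)^-1 * (a x)^-1 * 'D_v a x) : R^o)) => //.
  move=> x Ux; rewrite (@deriveV _ _ a) ?a0//; last exact/diff_derivable/ad.
  by rewrite expr2 invfM mulN1r scaleNr.
by apply: (CkM oU (Ck_cst _ _ _)); apply: (CkM oU (CkM oU CV CV)); exact: aD.
Qed.

Lemma Ck_sqrt k U a : open U -> (forall x, U x -> 0 < a x) -> Ck k U a ->
  Ck k U (fun x => Num.sqrt (a x) : R^o).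
Proof.
move=> oU a0; elim: k => [|k IH].
  move=> fc x Ux; apply: (@continuous_comp _ _ _ a (Num.sqrt : R -> R)); first exact: fc.
  exact: sqrt_continuous.
have sd x : U x -> is_derive (a x) 1 (Num.sqrt : R -> R) (2 * Num.sqrt (a x))^-1.
  by move=> Ux; apply: is_derive1_sqrt; exact: a0.
have sdd x : U x -> differentiable (Num.sqrt : R^o -> R^o) (a x).
  by move=> /sd ?; apply/derivable1_diffP.
move=> Ca; case: (Ca) => ad aD; split=> [x Ux|v].
  by apply: (@differentiable_comp _ _ _ _ a (Num.sqrt : R^o -> R^o)); [exact: ad|exact: sdd].
have CV := IH (Ck_weak Ca).
apply: (@Ck_eq _ _ _ _ _ _ (fun x => ((2 : R^o) * Num.sqrt (a x))^-1 * 'D_v a x : R^o)) => //.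
  move=> x Ux; have := ad _ Ux; have := sdd _ Ux => s1 s2.
  rewrite deriveE; last exact: (@differentiable_comp _ _ _ _ a (Num.sqrt : R^o -> R^o)).
  rewrite (@diff_comp _ _ _ _ a (Num.sqrt : R^o -> R^o))//= -(deriveE v s2).
  rewrite (diff1E s1)/= derive1E (@derive_val _ _ _ _ _ _ _ (sd _ Ux)).
  by rewrite /GRing.scale/= mulrC.
apply: (CkM oU _ (aD v)); apply: CkV => // [x Ux|].
  by rewrite mulf_neq0// gt_eqF// sqrtr_gt0 a0.
by apply: CkM => //; exact: Ck_cst.
Qed.
End CkReal.

Section CkComp.
Context {R : realType} {E F G : normedModType R}.

Lemma Ck_lin k (U : set E) (f : E -> F) (L : {linear F -> G}) :
  open U -> continuous L -> Ck k U f -> Ck k U (L \o f).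
Proof.
move=> oU Lc; elim: k f => [|k IH] f.
  by move=> fc x Ux; apply: continuous_comp; [exact: fc|exact: Lc].
move=> [fd fD]; split=> [x Ux|v].
  by apply: differentiable_comp; [exact: fd|exact: linear_differentiable].
apply: Ck_eq (IH _ (fD v)) => // x Ux.
have Ld := @linear_differentiable _ _ _ L (f x) Lc.
have fdx := fd _ Ux.
rewrite /= deriveE; last exact: differentiable_comp.
by rewrite diff_comp//= diff_lin// -deriveE.
Qed.

Lemma Ck_pair k (U : set E) (f : E -> F) (g : E -> G) :
  open U -> Ck k U f -> Ck k U g -> Ck k U (fun x => (f x, g x)).
Proof.
move=> oU; elim: k f g => [|k IH] f g.
  by move=> fc gc x Ux; apply: cvg_pair; [exact: fc|exact: gc].
move=> [fd fD] [gd gD]; split=> [x Ux|v].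
  by apply: differentiable_pair; [exact: fd|exact: gd].
apply: Ck_eq (IH _ _ (fD v) (gD v)) => // x Ux.
have fdx := fd _ Ux; have gdx := gd _ Ux.
rewrite deriveE; last exact: differentiable_pair.
by rewrite diff_pair// !deriveE.
Qed.

End CkComp.

(** * Symmetry of second derivatives *)

Section Schwarz.
Context {R : realType} {E : normedModType R}.
Implicit Types (f : E -> R^o).

Lemma dist_le_common (e a a' b b' : R) :
  `|a - a'| < e / 2 -> `|b - b'| < e / 2 -> a' = b' -> `|a - b| <= e.
Proof. by rewrite !ltr_norml ler_norml => /andP[? ?] /andP[? ?] ?; lra. Qed.

Lemma subr_exchange (W : zmodType) (a b c d : W) : a - b - (c - d) = a - c - (b - d).
Proof. by rewrite !opprB !addrA addrAC [a - b - c]addrAC addrAC. Qed.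

Lemma is_derive_line (F : normedModType R) (f : E -> F) (p v : E) (s : R) :
  differentiable f (p + s *: v) ->
  is_derive s 1 (fun t : R => f (p + t *: v)) ('D_v f (p + s *: v)).
Proof.
move=> df.
have dl : is_diff (s : R^o) (fun t : R^o => p + t *: v) (0 + ( *:%R^~ v)).
  exact: is_diffD.
have dfl : differentiable f ((fun t : R^o => p + t *: v) s) by [].
have [dlx dlE] := dl.
have dfc : differentiable (f \o (fun t : R^o => p + t *: v)) (s : R^o).
  exact: differentiable_comp.
apply: DeriveDef; first exact: (@diff_derivable _ _ _ (f \o (fun t : R^o => p + t *: v)) (s : R^o)).
rewrite (@deriveE _ _ _ (f \o (fun t : R^o => p + t *: v)) (s : R^o))//.
by rewrite diff_comp//= dlE/= fctE add0r scale1r deriveE.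
Qed.

Lemma mean_value0 (h : R) (g dg : R -> R) : 0 < h ->
  (forall s, 0 <= s <= h -> is_derive s 1 g (dg s)) ->
  exists2 s, 0 <= s <= h & g h - g 0 = h * dg s.
Proof.
move=> h0 gD; have [||s] := @MVT _ g dg 0 h h0.
- by move=> s; rewrite in_itv/= => /andP[/ltW s0 /ltW sh]; apply: gD; rewrite s0.
- apply: derivable_within_continuous => s; rewrite in_itv/= => /gD gDs.
  exact: ex_derive.
- rewrite in_itv/= subr0 => /andP[/ltW s0 /ltW sh] ->; exists s; first by rewrite s0.
  by rewrite mulrC.
Qed.

(** The second difference of [f] over a small parallelogram is a mixed second
    derivative at one of its points, by the mean value theorem in each direction. *)
Lemma second_difference f (U : set E) (x v w : E) (h : R) :
  0 < h -> Ck 2 U f ->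
  (forall s t, 0 <= s <= h -> 0 <= t <= h -> U (x + s *: v + t *: w)) ->
  exists s t, [/\ 0 <= s <= h, 0 <= t <= h &
    f (x + h *: v + h *: w) - f (x + h *: v) - (f (x + h *: w) - f x) =
    h * (h * 'D_w ('D_v f) (x + s *: v + t *: w))].
Proof.
move=> h0 [fd fD] Ux.
have hh : 0 <= h <= h by rewrite (ltW h0) lexx.
have h00 : 0 <= (0 : R) <= h by rewrite (ltW h0) lexx.
pose g (s : R) := f (x + h *: w + s *: v) - f (x + s *: v).
have [|s sh gE] := @mean_value0 h g
    (fun s => 'D_v f (x + h *: w + s *: v) - 'D_v f (x + s *: v)) h0.
  move=> s sh; apply: is_deriveB.
    by apply: is_derive_line; apply: fd; rewrite addrAC; exact: Ux.
  apply: is_derive_line; apply: fd.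
  by have := Ux s 0 sh h00; rewrite scale0r addr0.
have [|t th kE] := @mean_value0 h (fun t => 'D_v f (x + s *: v + t *: w))
    (fun t => 'D_w ('D_v f) (x + s *: v + t *: w)) h0.
  move=> t th; apply: (@is_derive_line _ ('D_v f)).
  by apply: (fD v).1; exact: Ux.
exists s, t; split => //.
move: gE; rewrite /g scale0r !addr0 [x + h *: w + h *: v]addrAC => ->.
by congr (_ * _); rewrite -kE scale0r addr0 [x + h *: w + s *: v]addrAC.
Qed.

(** Schwarz's theorem: the second difference is symmetric in [v] and [w], so the
    two mixed derivatives take a common value near [x]; conclude by continuity. *)
Theorem derive_comm f (U : set E) (x v w : E) : open U -> U x -> Ck 2 U f ->
  'D_w ('D_v f) x = 'D_v ('D_w f) x.
Proof.
move=> oU Ux Cf.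
have cA : {for x, continuous ('D_w ('D_v f))} by case: Cf => _ /(_ v) [_ /(_ w x Ux)].
have cB : {for x, continuous ('D_v ('D_w f))} by case: Cf => _ /(_ w) [_ /(_ v x Ux)].
apply/eqP; rewrite -subr_eq0 -normr_le0; apply/ler_addgt0Pl => e e0.
rewrite addr0.
have e20 : 0 < e / 2 by rewrite divr_gt0.
have nA : \forall y \near x, `|'D_w ('D_v f) x - 'D_w ('D_v f) y| < e / 2.
  by move/cvgrPdist_lt : cA => /(_ _ e20).
have nB : \forall y \near x, `|'D_v ('D_w f) x - 'D_v ('D_w f) y| < e / 2.
  by move/cvgrPdist_lt : cB => /(_ _ e20).
have nU : \forall y \near x, U y by exact: open_nbhs_nbhs.
have [r /= r0 rP] : exists2 r : R, 0 < r & forall y, `|x - y| < r ->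
    [/\ `|'D_w ('D_v f) x - 'D_w ('D_v f) y| < e / 2,
        `|'D_v ('D_w f) x - 'D_v ('D_w f) y| < e / 2 & U y].
  have nABU : \forall y \near x, [/\ `|'D_w ('D_v f) x - 'D_w ('D_v f) y| < e / 2,
      `|'D_v ('D_w f) x - 'D_v ('D_w f) y| < e / 2 & U y].
    by apply: filterS3 nA nB nU.
  have /nbhs_ballP[r /= r0 rP] := nABU.
  by exists r => // y xy; apply: rP; rewrite -ball_normE.
(* the summand 1 keeps k positive when v and w vanish *)
pose k := `|v| + `|w| + 1.
have k0 : 0 < k by rewrite ltr_wpDl// addr_ge0.
(* the parallelogram of side h in the directions v and w stays in the ball of radius r *)
pose h := r / (2 * k).
have h0 : 0 < h by rewrite divr_gt0// mulr_gt0.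
have close s t : 0 <= s <= h -> 0 <= t <= h -> `|x - (x + s *: v + t *: w)| < r.
  move=> /andP[s0 sh] /andP[t0 th].
  rewrite -addrA opprD addNKr normrN.
  apply: (@le_lt_trans _ _ (h * k)).
    rewrite (le_trans (ler_normD _ _))// !normrZ !ger0_norm//.
    have := ler_wpM2r (normr_ge0 v) sh; have := ler_wpM2r (normr_ge0 w) th.
    by rewrite /k !mulrDr mulr1; lra.
  rewrite /h invfM mulrA divfK ?gt_eqF//; lra.
have cU s t : 0 <= s <= h -> 0 <= t <= h -> U (x + s *: v + t *: w).
  by move=> sh th; have [] := rP _ (close _ _ sh th).
have cU' s t : 0 <= s <= h -> 0 <= t <= h -> U (x + s *: w + t *: v).
  by move=> sh th; rewrite addrAC; exact: cU.
have [s [t [sh th E1]]] := second_difference h0 Cf cU.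
have [s' [t' [sh' th' E2]]] := second_difference h0 Cf cU'.
rewrite [x + h *: w + h *: v]addrAC in E2.
have E12 := etrans (esym E1) (etrans (subr_exchange _ _ _ _) E2).
have {E1 E2} E12 := mulfI (lt0r_neq0 h0) (mulfI (lt0r_neq0 h0) E12).
have [Ha _ _] := rP _ (close _ _ sh th).
have [_ Hb _] := rP _ (close _ _ th' sh').
rewrite [x + t' *: v + _]addrAC in Hb.
exact: dist_le_common Ha Hb E12.
Qed.

End Schwarz.

(** * Charts and tangent vectors *)

Section Charts.
Context {R : realType} {E : normedModType R} {M : topologicalType}.
Variables (c : chart E M).
Hypothesis cc : is_chart c.

Lemma chart_img p : cdom c p -> cimg c (cmap c p).
Proof. by case: cc => _ _ + _ _ => /[apply] -[]. Qed.

Lemma chartK p : cdom c p -> cinv c (cmap c p) = p.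
Proof. by case: cc => _ _ + _ _ => /[apply] -[]. Qed.

Lemma chart_dom x : cimg c x -> cdom c (cinv c x).
Proof. by case: cc => _ _ _ + _ => /[apply] -[]. Qed.

Lemma chartVK x : cimg c x -> cmap c (cinv c x) = x.
Proof. by case: cc => _ _ _ + _ => /[apply] -[]. Qed.

Lemma open_cimg : open (cimg c). Proof. by case: cc. Qed.
Lemma open_cdom : open (cdom c). Proof. by case: cc. Qed.

Lemma cinv_continuous x : cimg c x -> {for x, continuous (cinv c)}.
Proof. by case: cc => _ _ _ _ [_ +]; exact. Qed.

Lemma cmap_continuous p : cdom c p -> {for p, continuous (cmap c)}.
Proof. by case: cc => _ _ _ _ [+ _]; exact. Qed.

Lemma open_chart_pre (U : set M) : open U -> open [set x | cimg c x /\ U (cinv c x)].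
Proof.
rewrite !openE => oU x [cx Ux]; apply: filterI.
  by apply: open_nbhs_nbhs; split => //; exact: open_cimg.
by apply: cinv_continuous cx _ _; exact: oU.
Qed.

Lemma near_cimg x : cimg c x -> \forall y \near x, cimg c y.
Proof. by move=> cx; apply: open_nbhs_nbhs; split => //; exact: open_cimg. Qed.

Lemma near_cdom p : cdom c p -> \forall q \near p, cdom c q.
Proof. by move=> cx; apply: open_nbhs_nbhs; split => //; exact: open_cdom. Qed.

Lemma near_cinv x (P : M -> Prop) : cimg c x ->
  (\forall q \near cinv c x, P q) -> \forall y \near x, P (cinv c y).
Proof. by move=> cx; apply: cinv_continuous. Qed.

Lemma near_cmap p (P : E -> Prop) : cdom c p ->
  (\forall y \near cmap c p, P y) -> \forall q \near p, P (cmap c q).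
Proof. by move=> cx; apply: cmap_continuous. Qed.

End Charts.

Section ProdCharts.
Context {R : realType} {E F : normedModType R} {M N : topologicalType}.

Lemma is_chart_prod (c : chart E M) (d : chart F N) : is_chart c -> is_chart d ->
  @is_chart _ _ (M * N)%type (prod_chart c d).
Proof.
move=> cc cd; split => /=.
- rewrite openE => -[p q] [/= cp dq]; exists (cdom c, cdom d) => //=.
  by split; [exact: near_cdom cp|exact: near_cdom dq].
- rewrite openE => -[p q] [/= cp dq]; exists (cimg c, cimg d) => //=.
  by split; [exact: near_cimg cp|exact: near_cimg dq].
- move=> [p q] [/= cp dq]; split; first by split; exact: chart_img.
  by rewrite (chartK cc)// (chartK cd).
- move=> [p q] [/= cp dq]; split; first by split; exact: chart_dom.
  by rewrite (chartVK cc)// (chartVK cd).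
- split=> -[p q] [/= cp dq]; apply: cvg_pair => /=.
  + apply: (@cvg_comp _ _ _ fst (cmap c) _ (nbhs p)); first exact: cvg_fst.
    exact: cmap_continuous.
  + apply: (@cvg_comp _ _ _ snd (cmap d) _ (nbhs q)); first exact: cvg_snd.
    exact: cmap_continuous.
  + apply: (@cvg_comp _ _ _ fst (cinv c) _ (nbhs p)); first exact: cvg_fst.
    exact: cinv_continuous.
  + apply: (@cvg_comp _ _ _ snd (cinv d) _ (nbhs q)); first exact: cvg_snd.
    exact: cinv_continuous.
Qed.

Lemma is_chart_flat : is_chart (Chart setT setT id id : chart E E).
Proof. by split => //=; [exact: openT|exact: openT|split=> x _; exact: cvg_id]. Qed.

End ProdCharts.

Section SmoothOn.
Context {R : realType} {E F : normedModType R}.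

(** A map smooth on an arbitrary subset is read in charts as the restriction of
    a differentiable map of vector spaces, defined near the point. *)
Lemma smooth_on_chart (M : @atlased R E) (N : @atlased R F) (A : set M) (f : M -> N)
    (c : chart E M) (d : chart F N) p :
  is_chart c -> is_chart d -> atlas M c -> atlas N d ->
  smooth_on A f -> A p -> cdom c p -> cdom d (f p) ->
  exists G : E -> F, [/\ differentiable G (cmap c p), G (cmap c p) = cmap d (f p) &
    \forall y \near cmap c p, A (cinv c y) ->
       cdom d (f (cinv c y)) /\ G y = cmap d (f (cinv c y))].
Proof.
move=> cc cd ac ad fs Ap cp dfp.
have [U [g [oU Up [gc gs] gf]]] := fs _ Ap.
have gp : g p = f p by exact: gf.
have cx := chart_img cc cp.
pose W := [set x | [/\ cimg c x, U (cinv c x) & cdom d (g (cinv c x))]].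
have Wx : W (cmap c p) by rewrite /W/= (chartK cc)// gp.
have nU : \forall y \near cmap c p, U (cinv c y).
  by apply: (near_cinv cc) => //; rewrite (chartK cc)//; exact: open_nbhs_nbhs.
have nd : \forall y \near cmap c p, cdom d (g (cinv c y)).
  have dgp : cdom d (g p) by rewrite gp.
  apply: (@near_cinv _ _ _ _ cc _ (fun q => cdom d (g q)) cx).
  rewrite (chartK cc)//; exact: (gc _ Up _ (near_cdom cd dgp)).
exists (cmap d \o g \o cinv c); split.
- have [gd _] := gs _ _ ac ad 1; exact: gd.
- by rewrite /= (chartK cc)// gp.
- by apply: filterS2 nU nd => y Uy; rewrite /= => + Ay; rewrite gf.
Qed.

End SmoothOn.

Section OneSided.
Context {R : realType}.

(** The right derivative is a limit of nonpositive quotients. *)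
Lemma one_sided_max (g : R^o -> R^o) : differentiable g 0 ->
  (\forall t \near (0 : R)^'+, g t <= g 0) -> 'd g 0 1 <= 0.
Proof.
move=> dg gle; have <- : 'D_1 g 0 = 'd g 0 1 by rewrite deriveE.
have /derivable1_diffP := dg; rewrite /derivable => dv.
rewrite /derive cvg_at_rightE//.
have cvr : cvg ((fun h : R => h^-1 *: ((g \o shift 0) (h *: 1) - g 0)) @ 0^'+).
  apply/cvg_ex; case/cvg_ex: dv => l dv; exists l.
  exact: cvg_dnbhs_at_right dv.
apply: limr_le cvr _.
near=> h.
have h0 : 0 < h by near: h; exact: nbhs_right_gt.
have gh : g h <= g 0 by near: h.
rewrite /= addr0 [h *: 1]mulr1 /GRing.scale/=.
by apply: mulr_ge0_le0; [rewrite invr_ge0 ltW|rewrite subr_le0].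
Unshelve. all: by end_near. Qed.

End OneSided.

Section LinearFunctionals.
Context {R : realType} {d : nat}.
Local Notation E := 'rV[R]_d.

(** Forms are given as plain functions, so that linearity is a property and not
    a bundled structure. *)
Definition linfun1 (f : E -> R) := forall (t : R) v w, f (t *: v + w) = t * f v + f w.

Lemma linfun1_0 f : linfun1 f -> f 0 = 0.
Proof. by move=> fl; have := fl 1 0 0; rewrite scaler0 add0r mul1r => /eqP; rewrite -subr_eq0 opprD addNKr oppr_eq0 => /eqP. Qed.

Lemma linfun1_D f v w : linfun1 f -> f (v + w) = f v + f w.
Proof. by move=> fl; have := fl 1 v w; rewrite scale1r mul1r. Qed.

Lemma linfun1_Z f t v : linfun1 f -> f (t *: v) = t * f v.
Proof. by move=> fl; have := fl t v 0; rewrite addr0 linfun1_0// addr0. Qed.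

Lemma linfun1_N f v : linfun1 f -> f (- v) = - f v.
Proof. by move=> fl; rewrite -scaleN1r linfun1_Z// mulN1r. Qed.

Lemma linfun1_sum f (I : Type) (r : seq I) (t : I -> R) (v : I -> E) : linfun1 f ->
  f (\sum_(i <- r) t i *: v i) = \sum_(i <- r) t i * f (v i).
Proof.
move=> fl; elim: r => [|i r IH]; first by rewrite !big_nil linfun1_0.
by rewrite !big_cons fl IH.
Qed.

Lemma linfun1_delta f v : linfun1 f ->
  f v = \sum_(k < d) v ord0 k * f (delta_mx ord0 k).
Proof. by move=> fl; rewrite {1}[v]row_sum_delta linfun1_sum. Qed.

Definition entry (k : 'I_d) (v : E) : R^o := v ord0 k.

Lemma entry_is_linear k : linear (entry k).
Proof. by move=> t v w; rewrite /entry !mxE. Qed.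

HB.instance Definition _ k := GRing.isLinear.Build R E R^o *:%R (entry k) (entry_is_linear k).

Lemma entry_continuous k : continuous (entry k).
Proof. exact: coord_continuous. Qed.

End LinearFunctionals.

Section Manifold.
Context {R : realType} {d : nat}.
Local Notation E := 'rV[R]_d.
Variable V : @atlased R E.
Hypothesis Vm : manifold V.
Implicit Types (c e : chart E V) (p q : V).

Lemma atlas_chart c : atlas V c -> is_chart c.
Proof. by case: Vm => _ _ + _ _; exact. Qed.

Lemma atlas_flat (F : normedModType R) : atlas (flat F) (Chart setT setT id id : chart F (flat F)).
Proof. by []. Qed.

Lemma smooth_fun_chart (F : normedModType R) (U : set V) (f : V -> F) c :
  open U -> smooth_fun U f -> atlas V c ->
  Cinf [set x | cimg c x /\ U (cinv c x)] (f \o cinv c).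
Proof.
move=> oU fs ac k; have cc := atlas_chart ac.
apply: Ck_local => x [cx Ux].
have [W [g [oW Wx [gc gs] gf]]] := fs _ Ux.
exists [set y | cimg c y /\ (W `&` U) (cinv c y)], (g \o cinv c); split => //=.
- exact: (open_chart_pre cc (openI oW oU)).
- apply: Ck_sub (gs _ _ ac (atlas_flat F) k).
  by move=> y [cy [Wy Uy]].
- by move=> y [cy [Wy Uy]]; rewrite /= gf.
Qed.

Lemma chart_smooth_fun (F : normedModType R) (U : set V) (f : V -> F) :
  open U ->
  (forall c, atlas V c -> Cinf [set x | cimg c x /\ U (cinv c x)] (f \o cinv c)) ->
  smooth_fun U f.
Proof.
move=> oU fs p Up; exists U, f; split => //; split.
  move=> {p Up} p Up; have [_ _ _ /(_ p)[c ac cp] _] := Vm.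
  have cc := atlas_chart ac.
  have fc : {for cmap c p, continuous (f \o cinv c)}.
    by apply: (fs c ac 0); rewrite /= (chartK cc)//; split => //; exact: chart_img.
  have fE : {near p, (f \o cinv c) \o cmap c =1 f}.
    by apply: filterS (near_cdom cc cp) => q cq; rewrite /= (chartK cc).
  rewrite /prop_for /continuous_at; apply: cvg_trans (near_eq_cvg fE) _.
  have := continuous_comp (cmap_continuous cc cp) fc.
  by rewrite /prop_for /continuous_at /= (chartK cc).
move=> c e ac -> k.
by apply: Ck_sub (fs c ac k) => x [].
Qed.

Lemma smooth_fun_diff (F : normedModType R) (U : set V) (f : V -> F) c x :
  open U -> smooth_fun U f -> atlas V c -> cimg c x -> U (cinv c x) ->
  differentiable (f \o cinv c) x.
Proof. by move=> oU fs ac cx Ux; have [fd _] := smooth_fun_chart oU fs ac 1; exact: fd. Qed.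

Lemma trans_Cinf c e : atlas V c -> atlas V e ->
  Cinf [set x | cimg c x /\ cdom e (cinv c x)] (cmap e \o cinv c).
Proof. by move=> ac ae; case: Vm => _ _ _ _; apply. Qed.

Lemma trans_diff c e x : atlas V c -> atlas V e -> cimg c x -> cdom e (cinv c x) ->
  differentiable (cmap e \o cinv c) x.
Proof. by move=> ac ae cx ex; have [fd _] := trans_Cinf ac ae 1; exact: fd. Qed.

Lemma dfun_linear (F : normedModType R) (f : V -> F) c x (t : R) v w :
  dfun f c x (t *: v + w) = t *: dfun f c x v + dfun f c x w.
Proof. exact: linearP. Qed.

Lemma dfun_trans (F : normedModType R) (f : V -> F) c e x v :
  atlas V c -> atlas V e -> cimg c x -> cdom e (cinv c x) ->
  differentiable (f \o cinv e) (cmap e (cinv c x)) ->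
  dfun f c x v = dfun f e (cmap e (cinv c x)) (dfun (cmap e) c x v).
Proof.
move=> ac ae cx ex df; have cc := atlas_chart ac; have ce := atlas_chart ae.
have dt := trans_diff ac ae cx ex.
have df' : differentiable (f \o cinv e) ((cmap e \o cinv c) x) by [].
have -> : dfun f c x v = 'd ((f \o cinv e) \o (cmap e \o cinv c)) x v.
  apply: diff_near; last exact: differentiable_comp.
  have := near_cinv cc cx (near_cdom ce ex); apply: filterS => y ey.
  by rewrite /= (chartK ce).
by rewrite diff_comp.
Qed.

Lemma dfun_cmap_id c x v : atlas V c -> cimg c x -> dfun (cmap c) c x v = v.
Proof.
move=> ac cx; have cc := atlas_chart ac.
have idd : differentiable (id : E -> E) x by [].
have -> : dfun (cmap c) c x v = 'd (id : E -> E) x v.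
  apply: diff_near => //; apply: filterS (near_cimg cc cx) => y cy.
  by rewrite /= (chartVK cc).
by have [_ ->] := is_diff_id x.
Qed.

Lemma dfun_cmapK c e x v :
  atlas V c -> atlas V e -> cimg c x -> cdom e (cinv c x) ->
  dfun (cmap c) e (cmap e (cinv c x)) (dfun (cmap e) c x v) = v.
Proof.
move=> ac ae cx ex; have cc := atlas_chart ac; have ce := atlas_chart ae.
rewrite -dfun_trans// ?dfun_cmap_id//.
by apply: trans_diff => //; rewrite ?(chartK ce)//; [exact: chart_img|exact: chart_dom].
Qed.

(** A function vanishing on [S] vanishes along the curve for small [t >= 0], so by
    [one_sided_max], applied to it and to its opposite, its derivative is zero.
    One-sided curves are needed on the boundary of the pages. *)
Lemma tangent_curve (S : set V) c x (gam : R^o -> E) : atlas V c -> cimg c x ->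
  S (cinv c x) -> gam 0 = x -> differentiable gam 0 ->
  (\forall t \near (0 : R)^'+, S (cinv c (gam t))) -> tangent S c x ('d gam 0 1).
Proof.
move=> ac cx Sx gx dgam Sg U f oU Ux fs f0.
have cc := atlas_chart ac.
have dfx := smooth_fun_diff oU fs ac cx Ux.
have dfg : differentiable (f \o cinv c) (gam 0) by rewrite gx.
have -> : dfun f c x ('d gam 0 1) = 'd ((f \o cinv c) \o gam) 0 1.
  have /(congr1 (fun F : R^o -> R^o => F 1)) /= -> := diff_comp dgam dfg.
  by rewrite gx.
have dfc := differentiable_comp dgam dfg.
have nU : \forall t \near (0 : R)^'+, U (cinv c (gam t)).
  have n1 : \forall y \near x, U (cinv c y).
    by apply: (@near_cinv _ _ _ _ cc _ U cx); exact: open_nbhs_nbhs.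
  have gc : gam t @[t --> (0 : R)^'+] --> x.
    apply: cvg_at_right_filter; rewrite -gx; exact: differentiable_continuous.
  exact: gc _ n1.
have f00 : f (cinv c (gam 0)) = 0 by rewrite gx; exact: f0.
have gz : \forall t \near (0 : R)^'+, (f \o cinv c \o gam) t = 0.
  by apply: filterS2 Sg nU => t St Ut; exact: f0.
apply/eqP; rewrite eq_le; apply/andP; split.
  apply: one_sided_max => //.
  by apply: filterS gz => t /= ->; rewrite f00.
rewrite -oppr_le0 -[leLHS](_ : 'd (- ((f \o cinv c) \o gam)) 0 1 = _); last first.
  by rewrite diffN.
apply: one_sided_max; first exact: differentiableN.
by apply: filterS gz => t; rewrite !fctE/= => ->; rewrite f00.
Qed.

End Manifold.

(** * Alternating sums and powers of 2-forms *)

Section Alternation.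
Context {R : numFieldType} {E : lmodType R} {N : nat}.
Implicit Types (Phi : ('I_N -> E) -> R) (e : 'I_N -> E).

Definition alt Phi e := \sum_(s : 'S_N) (-1) ^+ s * Phi (e \o s).

Lemma alt_perm Phi e (t : 'S_N) : alt Phi (e \o t) = (-1) ^+ t * alt Phi e.
Proof.
rewrite /alt big_distrr [RHS](reindex_inj (mulIg t))/=.
apply: eq_bigr => s _; rewrite [RHS]mulrA; congr (_ * Phi _).
  by rewrite -signr_addb odd_permM addbC -addbA addbb addbF.
by apply/funext => i; rewrite /= permM.
Qed.

Lemma alt_reindex Phi e (t : 'S_N) :
  alt (fun g => Phi (g \o t)) e = (-1) ^+ t * alt Phi e.
Proof.
rewrite /alt big_distrr [RHS](reindex_inj (mulgI t))/=.
apply: eq_bigr => s _; rewrite [RHS]mulrA; congr (_ * Phi _).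
  by rewrite -signr_addb odd_permM addbA addbb.
by apply/funext => i; rewrite /= permM.
Qed.

(** The transposition of [i] and [j] fixes [e] and changes the sign of [alt]. *)
Lemma alt_eq0 Phi e (i j : 'I_N) : i != j -> e i = e j -> alt Phi e = 0.
Proof.
move=> ij eij; have := alt_perm Phi e (tperm i j).
have -> : e \o tperm i j = e by apply/funext => k /=; case: tpermP => // ->.
rewrite odd_tperm ij expr1 mulN1r => /eqP.
by rewrite -addr_eq0 -mulr2n mulrn_eq0 => /eqP.
Qed.

Definition upd e (k : 'I_N) v : 'I_N -> E := fun i => if i == k then v else e i.

Lemma upd_perm e k v (s : 'S_N) : upd e (s k) v \o s = upd (e \o s) k v.
Proof. by apply/funext => i; rewrite /upd /= (inj_eq perm_inj). Qed.

Definition multilinear Phi := forall e k (t : R) v w,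
  Phi (upd e k (t *: v + w)) = t * Phi (upd e k v) + Phi (upd e k w).

Lemma alt_multilinear Phi : multilinear Phi -> multilinear (alt Phi).
Proof.
move=> ml e k t v w; rewrite /alt big_distrr -big_split/=.
apply: eq_bigr => s _; rewrite -[k](permKV s) !upd_perm ml.
by rewrite mulrDr mulrCA.
Qed.

End Alternation.

Section PairForms.
Context {R : numFieldType} {E : lmodType R}.
Implicit Types (a b : E -> R) (w : E -> E -> R).

(** The positions [2 i] and [2 i + 1] of the [i]-th pair of arguments. *)
Definition lo m (i : 'I_m) : 'I_m.*2 := Ordinal (etrans (ltn_double i m) (ltn_ord i)).
Definition hi m (i : 'I_m) : 'I_m.*2 := Ordinal (etrans (ltn_Sdouble i m) (ltn_ord i)).

Lemma lo_inj m : injective (@lo m).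
Proof. by move=> i j [] /double_inj /val_inj. Qed.
Lemma hi_inj m : injective (@hi m).
Proof. by move=> i j [] /double_inj /val_inj. Qed.
Lemma lo_hi m (i j : 'I_m) : (lo i == hi j) = false.
Proof. by apply/eqP => -[] /(congr1 odd) /=; rewrite !odd_double. Qed.

Lemma lo_or_hi m (k : 'I_m.*2) : exists i : 'I_m, k = lo i \/ k = hi i.
Proof.
have km : (k./2 < m)%N by rewrite -ltn_double -{2}(odd_double_half m.*2) odd_double doubleK add0n (leq_ltn_trans _ (ltn_ord k))// -{2}(odd_double_half k) leq_addl.
exists (Ordinal km); have := odd_double_half k; case: (odd k) => kE; [right|left]; apply/val_inj => /=; by rewrite -{1}kE.
Qed.

(** The product whose alternation is, up to a factor, the [m]-th exterior power
    of [w]; [vpairs] is the analogue for [a /\ w^m]. *)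
Definition pairs m w (e : 'I_m.*2 -> E) : R := \prod_(i < m) w (e (lo i)) (e (hi i)).

Definition vpairs m a w (e : 'I_m.*2.+1 -> E) : R :=
  a (e ord0) * pairs w (e \o lift ord0).

Definition bilin w := (forall (t : R) u v z, w (t *: u + v) z = t * w u z + w v z) /\
  (forall (t : R) u v z, w z (t *: u + v) = t * w z u + w z v).

Lemma pairsD1 m w (i : 'I_m) e : @pairs m w e =
  w (e (lo i)) (e (hi i)) * \prod_(j < m | j != i) w (e (lo j)) (e (hi j)).
Proof. by rewrite /pairs (bigD1 i). Qed.

Lemma pairs_multilinear m w : bilin w -> multilinear (@pairs m w).
Proof.
move=> [wl wr] e k t u v.
have [i [->|->]] := lo_or_hi k.
- have updE x : pairs w (upd e (lo i) x) =
      w x (e (hi i)) * \prod_(j < m | j != i) w (e (lo j)) (e (hi j)).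
    rewrite (pairsD1 _ i) /upd eqxx eq_sym lo_hi; congr (_ * _).
    by apply: eq_bigr => j ji; rewrite (inj_eq (@lo_inj m)) (negbTE ji) eq_sym lo_hi.
  by rewrite !updE wl mulrDl mulrA.
- have updE x : pairs w (upd e (hi i) x) =
      w (e (lo i)) x * \prod_(j < m | j != i) w (e (lo j)) (e (hi j)).
    rewrite (pairsD1 _ i) /upd eqxx lo_hi; congr (_ * _).
    by apply: eq_bigr => j ji; rewrite (inj_eq (@hi_inj m)) (negbTE ji) lo_hi.
  by rewrite !updE wr mulrDl mulrA.
Qed.

Lemma vpairs_multilinear m a w :
  (forall (t : R) u v, a (t *: u + v) = t * a u + a v) -> bilin w ->
  multilinear (@vpairs m a w).
Proof.
move=> al wb e k t u v; rewrite /vpairs.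
have h0 (i : 'I_m.*2) : (lift ord0 i == ord0) = false.
  by rewrite eq_sym; apply/negbTE/neq_lift.
have [->|[k' ->]] : k = ord0 \/ exists k', k = lift ord0 k'.
  by case: (unliftP ord0 k) => [k'|] ->; [right; exists k'|left].
- have eqv x : upd e ord0 x \o lift ord0 = e \o lift ord0.
    by apply/funext => i; rewrite /upd /comp h0.
  by rewrite !eqv /upd eqxx al mulrDl mulrA.
- have eqv x : upd e (lift ord0 k') x \o lift ord0 = upd (e \o lift ord0) k' x.
    by apply/funext => i; rewrite /upd /comp (inj_eq lift_inj).
  by rewrite !eqv pairs_multilinear// /upd eq_sym h0 mulrDr mulrCA.
Qed.

End PairForms.

Section Contraction.
Context {R : numFieldType} {E : lmodType R}.
Implicit Types (w : E -> E -> R).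

(** Permutations of [n + 1] letters fixing the first one are permutations of [n]
    letters; the inverse bijection is built as in the Laplace expansion. *)
Lemma sum_lift_perm n (F : 'S_n.+1 -> R) :
  \sum_(s : 'S_n.+1 | s ord0 == ord0) F s = \sum_(s : 'S_n) F (lift_perm ord0 ord0 s).
Proof.
rewrite (reindex (lift_perm ord0 ord0)); last first.
  pose ulsf (s : 'S_n.+1) k := odflt k (unlift (s ord0) (s (lift ord0 k))).
  have ulsfK (s : 'S_n.+1) k : lift (s ord0) (ulsf s k) = s (lift ord0 k).
    rewrite /ulsf; have := neq_lift ord0 k.
    by rewrite -(can_eq (permK s)) => /unlift_some[] ? ? ->.
  have inj_ulsf s : injective (ulsf s).
    move=> k l /(congr1 (lift (s ord0))); rewrite !ulsfK => /perm_inj.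
    exact: lift_inj.
  exists (fun s => perm (inj_ulsf s)) => [s _ | s].
    by apply/permP => k; rewrite permE /ulsf lift_perm_lift lift_perm_id liftK.
  move=> /eqP s0; apply/permP => k.
  case: (unliftP ord0 k) => [k'|] ->; rewrite ?lift_perm_id //.
  by rewrite lift_perm_lift -{1}s0 permE ulsfK.
by apply: eq_bigl => s; rewrite lift_perm_id eqxx.
Qed.

Definition block_perm m (i j : 'I_m) : 'S_m.*2 :=
  (tperm (lo i) (lo j) * tperm (hi i) (hi j))%g.

Lemma block_perm_lo m (i j k : 'I_m) : block_perm i j (lo k) = lo (tperm i j k).
Proof.
rewrite permM; case: (tpermP i j k) => [->|->|ki kj].
- by rewrite tpermL tpermD// eq_sym lo_hi.
- by rewrite tpermR tpermD// eq_sym lo_hi.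
- rewrite [tperm (lo i) _ _]tpermD ?tpermD//; try by rewrite eq_sym lo_hi.
  + by rewrite (inj_eq (@lo_inj m)) eq_sym; apply/eqP.
  + by rewrite (inj_eq (@lo_inj m)) eq_sym; apply/eqP.
Qed.

Lemma block_perm_hi m (i j k : 'I_m) : block_perm i j (hi k) = hi (tperm i j k).
Proof.
rewrite permM [tperm (lo i) (lo j) _]tpermD ?lo_hi//.
case: (tpermP i j k) => [->|->|ki kj]; rewrite ?tpermL ?tpermR//.
by rewrite tpermD// (inj_eq (@hi_inj m)) eq_sym; apply/eqP.
Qed.

Lemma odd_block_perm m (i j : 'I_m) : odd_perm (block_perm i j) = false.
Proof. by rewrite odd_permM !odd_tperm (inj_eq (@lo_inj m)) (inj_eq (@hi_inj m)) addbb. Qed.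

Lemma pairs_block m w (e : 'I_m.*2 -> E) (i j : 'I_m) :
  pairs w (e \o block_perm i j) = pairs w e.
Proof.
rewrite /pairs [RHS](reindex_inj (@perm_inj _ (tperm i j))).
by apply: eq_bigr => k _; rewrite /= block_perm_lo block_perm_hi.
Qed.

Lemma pairs_flip m w (e : 'I_m.*2 -> E) (i : 'I_m) :
  (forall u v, w u v = - w v u) ->
  pairs w (e \o tperm (lo i) (hi i)) = - pairs w e.
Proof.
move=> wN; rewrite [LHS](pairsD1 _ i) [in RHS](pairsD1 _ i) /= tpermL tpermR wN mulNr.
congr (- (_ * _)); apply: eq_bigr => j ji.
have h1 : lo i != lo j by rewrite (inj_eq (@lo_inj m)) eq_sym.
have h2 : hi i != hi j by rewrite (inj_eq (@hi_inj m)) eq_sym.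
by rewrite !tpermD// ?lo_hi// eq_sym lo_hi.
Qed.

(** Contraction of the power [w^(m+1)] by a vector.  In the alternating sum over
    the permutations [s], the first vector may occupy any of the [2 (m + 1)]
    places; all the places contribute equally, since the pairs may be permuted
    ([pairs_block]) and the two elements of a pair exchanged ([pairs_flip]). *)
Lemma alt_pairs_cons m w (e : 'I_m.+1.*2 -> E) :
  (forall u v, w u v = - w v u) ->
  alt (pairs w) e = m.+1.*2%:R *
    @alt _ _ m.*2.+1 (vpairs (w (e ord0)) w) (e \o lift ord0).
Proof.
move=> wN.
pose G (s : 'S_m.+1.*2) := (-1) ^+ s * pairs w (e \o s).
have Glo : forall k : 'I_m.+1.*2,
    \sum_(s : 'S_m.+1.*2 | s k == ord0) G s = \sum_(s : 'S_m.+1.*2 | s ord0 == ord0) G s.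
  have aux i : \sum_(s : 'S_m.+1.*2 | s (lo i) == ord0) G s =
      \sum_(s : 'S_m.+1.*2 | s ord0 == ord0) G s.
    rewrite [LHS](reindex_inj (mulgI (block_perm ord0 i)))/=.
    apply: eq_big => s; first by rewrite permM block_perm_lo tpermR (_ : lo ord0 = ord0)//; exact: val_inj.
    move=> _; rewrite /G odd_permM odd_block_perm/=; congr (_ * _).
    rewrite -[RHS](pairs_block _ _ ord0 i); congr pairs.
    by apply/funext => k; rewrite /= permM.
  move=> k; have [i [->|->]] := lo_or_hi k; first exact: aux.
  rewrite -(aux i) [LHS](reindex_inj (mulgI (tperm (lo i) (hi i))))/=.
  apply: eq_big => s; first by rewrite permM tpermR.
  move=> _; rewrite /G odd_permM odd_tperm lo_hi/= signrN mulNr -mulrN; congr (_ * _).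
  rewrite -(pairs_flip _ i wN); congr pairs.
  by apply/funext => j; rewrite /= permM tpermK.
rewrite [LHS](_ : _ = \sum_s G s)// (partition_big (fun s : 'S_m.+1.*2 => s^-1%g ord0) predT)//=.
transitivity (\sum_(k < m.+1.*2) \sum_(s : 'S_m.+1.*2 | s ord0 == ord0) G s).
  apply: eq_bigr => k _; rewrite -(Glo k); apply: eq_bigl => s.
  by rewrite -(inj_eq (@perm_inj _ s)) permKV eq_sym.
rewrite sumr_const card_ord -[LHS]mulr_natl; congr (_ * _).
rewrite (@sum_lift_perm m.*2.+1); apply: eq_bigr => s _.
rewrite /G odd_lift_perm/=; congr (_ * _).
rewrite /pairs big_ord_recl /vpairs/=; congr (w _ _ * _).
- by congr e; rewrite (_ : lo ord0 = ord0) ?lift_perm_id//; exact: val_inj.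
- congr e; rewrite (_ : hi ord0 = lift ord0 (ord0 : 'I_m.*2.+1)); last exact: val_inj.
  by rewrite lift_perm_lift.
- apply: eq_bigr => i _; congr (w (e _) (e _)).
  + rewrite (_ : lo (lift ord0 i) = lift ord0 (lift ord0 (lo i))); last exact: val_inj.
    by rewrite lift_perm_lift.
  + rewrite (_ : hi (lift ord0 i) = lift ord0 (lift ord0 (hi i))); last exact: val_inj.
    by rewrite lift_perm_lift.
Qed.

End Contraction.

Section WedgePowers.
Context {R : realType} {d : nat}.
Local Notation E := 'rV[R]_d.
Implicit Types (w : E -> E -> R) (a : E -> R).

Lemma nth_image_ord k (F : 'I_k -> E) (j : 'I_k) : [seq F i | i : 'I_k]`_j = F j.
Proof. by rewrite (nth_map j) ?size_enum_ord// nth_ord_enum. Qed.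

Definition seqfun k (e : seq E) : 'I_k -> E := fun i => e`_i.
Arguments seqfun : clear implicits.

Lemma nat_fact_neq0 n : (n`!)%:R != 0 :> R.
Proof. by rewrite pnatr_eq0 -lt0n fact_gt0. Qed.

(** The iterated wedge products antisymmetrize again at each step what is already
    antisymmetric.  Averaging over the subgroup that fixes the first two letters
    absorbs these repetitions and leaves a single sum over all permutations. *)
Lemma wpow_alt w m (e : seq E) :
  wpow (fun e => w e`_0 e`_1) m e = 2^-1 ^+ m * alt (pairs w) (seqfun m.*2 e).
Proof.
elim: m e => [|m IH] e.
  rewrite /= expr0 mul1r /alt (eq_bigr (fun=> 1)).
    by rewrite sumr_const card_Sn.
  move=> s _; rewrite /pairs big_ord0 mulr1 (_ : s = 1%g) ?odd_perm1//.
  by apply/permP => -[].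
rewrite [LHS]/= /wedge.
pose F (s : 'S_m.+1.*2) := (-1) ^+ s * pairs w (seqfun m.+1.*2 e \o s) : R.
transitivity ((2`! * m.*2`!)%:R^-1 * \sum_(s : 'S_(2 + m.*2)) \sum_(t : 'S_m.*2)
    (2^-1 ^+ m * F (lift_perm ord0 ord0 (lift_perm ord0 ord0 t) * s)%g)).
  congr (_ * _); apply: eq_bigr => s _.
  have e0 : [seq e`_(s (lshift m.*2 i)) | i : 'I_2]`_0 = e`_(s (lshift m.*2 ord0)).
    exact: (nth_image_ord (fun i => e`_(s (lshift m.*2 i))) ord0).
  have e1 : [seq e`_(s (lshift m.*2 i)) | i : 'I_2]`_1 = e`_(s (lshift m.*2 (lift ord0 ord0))).
    exact: (nth_image_ord (fun i => e`_(s (lshift m.*2 i))) (lift ord0 ord0)).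
  rewrite e0 e1 IH /alt mulrCA big_distrr big_distrr; apply: eq_bigr => t _.
  rewrite /F; congr (_ * _).
  have -> : ((-1) ^+ (lift_perm ord0 ord0 (lift_perm ord0 ord0 t) * s)%g : R) =
            (-1) ^+ s * (-1) ^+ t.
    by rewrite odd_permM !odd_lift_perm/= addbC signr_addb.
  rewrite /= mulrACA; congr (_ * _).
  rewrite [in RHS]/pairs big_ord_recl; congr (w _ _ * _).
  - rewrite /seqfun/= permM (_ : lo ord0 = ord0); last exact: val_inj.
    by rewrite lift_perm_id; congr (e`_(s _)); exact: val_inj.
  - rewrite /seqfun/= permM (_ : hi ord0 = lift ord0 (ord0 : 'I_m.*2.+1)); last exact: val_inj.
    by rewrite lift_perm_lift lift_perm_id; congr (e`_(s _)); exact: val_inj.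
  - apply: eq_bigr => i _; rewrite /seqfun/=; congr (w _ _).
    + rewrite (nth_image_ord (fun i => e`_(s (rshift 2 i)))) permM.
      rewrite (_ : lo (lift ord0 i) = lift ord0 (lift ord0 (lo i))); last exact: val_inj.
      by rewrite !lift_perm_lift; congr (e`_(s _)); exact: val_inj.
    + rewrite (nth_image_ord (fun i => e`_(s (rshift 2 i)))) permM.
      rewrite (_ : hi (lift ord0 i) = lift ord0 (lift ord0 (hi i))); last exact: val_inj.
      by rewrite !lift_perm_lift; congr (e`_(s _)); exact: val_inj.
rewrite exchange_big/=.
rewrite (eq_bigr (fun=> 2^-1 ^+ m * alt (pairs w) (seqfun m.+1.*2 e))); last first.
  move=> t _; rewrite -big_distrr /=; congr (_ * _).
  by rewrite [RHS](reindex_inj (mulgI (lift_perm ord0 ord0 (lift_perm ord0 ord0 t)))).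
rewrite sumr_const card_Sn -[X in _ * X]mulr_natl natrM invfM -mulrA mulKf ?nat_fact_neq0//.
by rewrite exprS mulrA.
Qed.

(** Same argument as for [wpow_alt], with the subgroup fixing the first letter. *)
Lemma wedge1_alt a w m (e : seq E) :
  wedge 1 m.*2 (fun e => a e`_0) (wpow (fun e => w e`_0 e`_1) m) e =
  2^-1 ^+ m * @alt _ _ m.*2.+1 (vpairs a w) (seqfun m.*2.+1 e).
Proof.
rewrite /wedge.
pose F (s : 'S_m.*2.+1) := (-1) ^+ s * @vpairs _ _ m a w (seqfun m.*2.+1 e \o s) : R.
transitivity ((1`! * m.*2`!)%:R^-1 * \sum_(s : 'S_(1 + m.*2)) \sum_(t : 'S_m.*2)
    (2^-1 ^+ m * F (lift_perm ord0 ord0 t * s)%g)).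
  congr (_ * _); apply: eq_bigr => s _.
  have e0 : [seq e`_(s (lshift m.*2 i)) | i : 'I_1]`_0 = e`_(s (lshift m.*2 ord0)).
    exact: (nth_image_ord (fun i => e`_(s (lshift m.*2 i))) ord0).
  rewrite e0 wpow_alt /alt mulrCA big_distrr big_distrr; apply: eq_bigr => t _.
  rewrite /F; congr (_ * _).
  have -> : ((-1) ^+ (lift_perm ord0 ord0 t * s)%g : R) = (-1) ^+ s * (-1) ^+ t.
    by rewrite odd_permM !odd_lift_perm/= addbC signr_addb.
  rewrite /= mulrACA; congr (_ * _).
  rewrite /vpairs; congr (a _ * _).
    rewrite /seqfun/= permM lift_perm_id.
    by congr (e`_(s _)); exact: val_inj.
  apply: eq_bigr => i _; rewrite /seqfun/=; congr (w _ _).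
    rewrite (nth_image_ord (fun i => e`_(s (rshift 1 i)))) permM.
    by rewrite !lift_perm_lift; congr (e`_(s _)); exact: val_inj.
  rewrite (nth_image_ord (fun i => e`_(s (rshift 1 i)))) permM.
  by rewrite !lift_perm_lift; congr (e`_(s _)); exact: val_inj.
rewrite exchange_big/=.
rewrite (eq_bigr (fun=> 2^-1 ^+ m * alt (vpairs a w) (seqfun m.*2.+1 e))); last first.
  move=> t _; rewrite -big_distrr /=; congr (_ * _).
  by rewrite [RHS](reindex_inj (mulgI (lift_perm ord0 ord0 t))).
rewrite sumr_const card_Sn -[X in _ * X]mulr_natl natrM invfM invr1 mul1r.
by rewrite mulKf// nat_fact_neq0.
Qed.

End WedgePowers.
Arguments seqfun {R d} k e i.

Section Rescaling.
Context {R : numFieldType} {E : lmodType R}.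
Implicit Types (a b : E -> R) (w : E -> E -> R).

(** A product in which the 2-form may change from pair to pair, as in the
    expansion of a power of a sum of two 2-forms. *)
Definition fpairs m a (W : 'I_m -> E -> E -> R) (e : 'I_m.*2.+1 -> E) : R :=
  a (e ord0) * \prod_(i < m) W i (e (lift ord0 (lo i))) (e (lift ord0 (hi i))).

(** Reindexing by the transposition shows that the sum is its own opposite. *)
Lemma alt_antisym N (Phi : ('I_N -> E) -> R) (i j : 'I_N) e : i != j ->
  (forall g, Phi (g \o tperm i j) = Phi g) -> alt Phi e = 0.
Proof.
move=> ij PhiE; have := alt_reindex Phi e (tperm i j).
have -> : (fun g : 'I_N -> E => Phi (g \o tperm i j)) = Phi by apply/funext.
rewrite odd_tperm ij expr1 mulN1r => /eqP.
by rewrite -addr_eq0 -mulr2n mulrn_eq0 => /eqP.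
Qed.

Lemma altD N (P Q : ('I_N -> E) -> R) e :
  alt (fun g => P g + Q g) e = alt P e + alt Q e.
Proof. by rewrite /alt -big_split; apply: eq_bigr => s _; rewrite mulrDr. Qed.

Lemma alt_sum N (I : finType) (P : I -> ('I_N -> E) -> R) e :
  alt (fun g => \sum_i P i g) e = \sum_i alt (P i) e.
Proof.
rewrite /alt exchange_big; apply: eq_bigr => s _.
by rewrite big_distrr.
Qed.

(** A factor [b /\ a] next to [a] gives zero, because each of the two products
    in its definition contains [a] twice, and is thus symmetric under a
    transposition. *)
Lemma alt_fpairs_eq0 m a b (W : 'I_m -> E -> E -> R) (j : 'I_m) e :
  (forall u v, W j u v = b u * a v - b v * a u) -> alt (fpairs a W) e = 0.
Proof.
move=> Wj.
pose rest (g : 'I_m.*2.+1 -> E) :=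
  \prod_(i < m | i != j) W i (g (lift ord0 (lo i))) (g (lift ord0 (hi i))).
pose P (k l : 'I_m.*2.+1) (g : 'I_m.*2.+1 -> E) := a (g ord0) * a (g l) * (b (g k) * rest g).
have rest_tp (l : 'I_m.*2) g : l = lo j \/ l = hi j ->
    rest (g \o tperm ord0 (lift ord0 l)) = rest g.
  move=> lE; apply: eq_bigr => i ij; rewrite /= !tpermD//.
  - by rewrite (inj_eq lift_inj); case: lE => ->; rewrite ?(inj_eq (@hi_inj m)) 1?eq_sym// eq_sym lo_hi.
  - by rewrite (inj_eq lift_inj); case: lE => ->; rewrite ?(inj_eq (@lo_inj m)) 1?eq_sym ?lo_hi// eq_sym.
have P0 k l : (k = lo j /\ l = hi j) \/ (k = hi j /\ l = lo j) ->
    alt (P (lift ord0 k) (lift ord0 l)) e = 0.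
  move=> kl; apply: (@alt_antisym _ _ ord0 (lift ord0 l)) => // g.
  rewrite /P rest_tp; last by case: kl => -[_ ->]; [right|left].
  rewrite /= tpermL tpermR [a (g ord0) * _]mulrC tpermD//.
  by rewrite (inj_eq lift_inj); case: kl => -[-> ->]; rewrite ?lo_hi// eq_sym lo_hi.
rewrite (_ : fpairs a W = fun g => P (lift ord0 (lo j)) (lift ord0 (hi j)) g +
   (-1) * P (lift ord0 (hi j)) (lift ord0 (lo j)) g); last first.
  by apply/funext => g; rewrite /fpairs (bigD1 j)//= Wj /P -/(rest g); ring.
rewrite altD P0; last by left.
rewrite add0r (_ : alt _ e = (-1) * alt (P (lift ord0 (hi j)) (lift ord0 (lo j))) e).
  by rewrite P0 ?mulr0//; right.
by rewrite /alt big_distrr; apply: eq_bigr => s _; rewrite mulrCA.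
Qed.

(** The identity [f a /\ (d (f a))^m = f^(m+1) a /\ (d a)^m], with [w = d a] and
    [b = df]: when the power of [f w + b /\ a] is expanded over the sets [J] of
    factors where [f w] is chosen, all the terms but one contain [b /\ a]. *)
Lemma alt_vpairs_rescale m a b w w' (f : R) e :
  (forall u v, w' u v = f * w u v + (b u * a v - b v * a u)) ->
  @alt _ _ m.*2.+1 (vpairs (fun v => f * a v) w') e =
  f ^+ m.+1 * @alt _ _ m.*2.+1 (vpairs a w) e.
Proof.
move=> w'E.
(* J is the set of the factors where the summand f w is chosen *)
pose W (J : {set 'I_m}) (i : 'I_m) u v :=
  if i \in J then f * w u v else b u * a v - b v * a u.
have -> : @vpairs _ _ m (fun v => f * a v) w' =
    fun g => \sum_(J : {set 'I_m}) f * fpairs a (W J) g.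
  apply/funext => g; rewrite /vpairs /pairs.
  under eq_bigr do rewrite w'E.
  rewrite bigA_distr big_distrr; apply: eq_bigr => J _.
  rewrite /fpairs [RHS]mulrA; congr (_ * _); apply: eq_bigr => i _; rewrite /W; case: ifP.
have altZ (c : R) P : alt (fun g : 'I_m.*2.+1 -> E => c * P g) e = c * alt P e.
  by rewrite /alt big_distrr; apply: eq_bigr => s _; rewrite mulrCA.
rewrite alt_sum (bigD1 [set: 'I_m]%SET)//= big1 ?addr0; last first.
  move=> J JT; rewrite altZ.
  have [i iJ] : exists i, i \notin J.
    by apply/existsP; rewrite -negb_forall; apply: contra JT => /forallP JT;
      apply/eqP/setP => i; rewrite inE; exact: JT.
  by rewrite (@alt_fpairs_eq0 _ _ b _ i) ?mulr0// => u v; rewrite /W (negbTE iJ).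
rewrite altZ exprS -mulrA; congr (_ * _); rewrite -altZ; congr alt.
apply/funext => g; rewrite /fpairs /vpairs mulrCA; congr (_ * _).
rewrite /W; under eq_bigr do rewrite inE.
by rewrite big_split/= prodr_const card_ord.
Qed.

End Rescaling.

(** * The complex plane *)

Section Plane.
Context {R : realType}.
Local Notation C := (cplane R).
Implicit Types z w : C.

Definition cdot z w : R := z.1 * w.1 + z.2 * w.2.

(** Multiplication by the complex number [i]. *)
Definition crot z : C := (- z.2, z.1).

Lemma cdotC z w : cdot z w = cdot w z.
Proof. by rewrite /cdot mulrC [z.2 * _]mulrC. Qed.

Lemma cdetzz z : cdet z z = 0.
Proof. by rewrite /cdet mulrC subrr. Qed.

Lemma cdet_crot z : cdet z (crot z) = cdot z z.
Proof. by rewrite /cdet /cdot /=; ring. Qed.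

Lemma cdotZl (t : R) z w : cdot (t *: z) w = t * cdot z w.
Proof. by rewrite /cdot /= /GRing.scale/=; ring. Qed.

Lemma cdotZr (t : R) z w : cdot z (t *: w) = t * cdot z w.
Proof. by rewrite cdotC cdotZl cdotC. Qed.

Lemma cdetZl (t : R) z w : cdet (t *: z) w = t * cdet z w.
Proof. by rewrite /cdet /= /GRing.scale/=; ring. Qed.

Lemma cdetZr (t : R) z w : cdet z (t *: w) = t * cdet z w.
Proof. by rewrite /cdet /= /GRing.scale/=; ring. Qed.

Lemma cdotDr z w w' : cdot z (w + w') = cdot z w + cdot z w'.
Proof. by rewrite /cdot /=; ring. Qed.

Lemma cdetDr z w w' : cdet z (w + w') = cdet z w + cdet z w'.
Proof. by rewrite /cdet /=; ring. Qed.

Lemma cmod_ge0 z : 0 <= cmod z.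
Proof. exact: sqrtr_ge0. Qed.

Lemma cdotzz_ge0 z : 0 <= cdot z z.
Proof. by rewrite /cdot -!expr2 addr_ge0// sqr_ge0. Qed.

Lemma cmodE z : cmod z = Num.sqrt (cdot z z).
Proof. by rewrite /cmod /cdot !expr2. Qed.

Lemma sqr_cmod z : cmod z ^+ 2 = cdot z z.
Proof. by rewrite cmodE sqr_sqrtr// cdotzz_ge0. Qed.

Lemma cdotzz_eq0 z : (cdot z z == 0) = (z == 0).
Proof.
case: z => a b; rewrite /cdot/= -!expr2 paddr_eq0 ?sqr_ge0// !sqrf_eq0.
by rewrite -[RHS]xpair_eqE.
Qed.

Lemma cdotzz_gt0 z : z != 0 -> 0 < cdot z z.
Proof. by rewrite lt0r cdotzz_eq0 cdotzz_ge0 andbT. Qed.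

Lemma cmod_eq0 z : (cmod z == 0) = (z == 0).
Proof. by rewrite -cdotzz_eq0 -sqr_cmod sqrf_eq0. Qed.

Lemma cmod_gt0 z : z != 0 -> 0 < cmod z.
Proof. by rewrite lt0r cmod_eq0 cmod_ge0 andbT. Qed.

Lemma circle_cdot z : circle z -> cdot z z = 1.
Proof. by rewrite /circle/= => zz; rewrite -sqr_cmod zz expr1n. Qed.

Lemma cdot_circle z : cdot z z = 1 -> circle z.
Proof. by move=> zz; rewrite /circle/= cmodE zz sqrtr1. Qed.

(** The coordinates of [w] in the orthogonal basis [(z, i z)]. *)
Lemma plane_decomp z w : cdot z z *: w = cdot z w *: z + cdet z w *: crot z.
Proof.
case: z w => a b [x y]; rewrite /cdot /cdet /crot /=.
by apply/pair_equal_spec; split; rewrite /= /GRing.scale/=; ring.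
Qed.

Lemma cdot_cdet0 z w : z != 0 -> cdot z w = 0 -> cdet z w = 0 -> w = 0.
Proof.
move=> z0 zw zw'; have := plane_decomp z w.
rewrite zw zw' !scale0r addr0 => /eqP; rewrite scaler_eq0 cdotzz_eq0 (negbTE z0).
by move=> /eqP.
Qed.

Lemma ray_eq z w : circle z -> cdet z w = 0 -> 0 <= cdot z w -> w = cmod w *: z.
Proof.
move=> /circle_cdot zz zw dzw.
have [s s0 ->] : exists2 s : R, 0 <= s & w = s *: z.
  by exists (cdot z w) => //; rewrite -[LHS]scale1r -zz plane_decomp zw scale0r addr0.
by congr (_ *: _); rewrite cmodE cdotZl cdotZr zz mulr1 -expr2 sqrtr_sqr ger0_norm.
Qed.

Lemma cdot0l z : cdot 0 z = 0.
Proof. by rewrite /cdot !mul0r addr0. Qed.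

Lemma cdet0l z : cdet 0 z = 0.
Proof. by rewrite /cdet !mul0r subr0. Qed.

Lemma cdot_expand (z w z' w' : C) :
  z.1 * w'.1 + w.1 * z'.1 + (z.2 * w'.2 + w.2 * z'.2) = cdot z w' + cdot z' w.
Proof. by rewrite /cdot; ring. Qed.

Lemma cdet_expand (z w z' w' : C) :
  z.1 * w'.2 + w.2 * z'.1 - (z.2 * w'.1 + w.1 * z'.2) = cdet z w' + cdet z' w.
Proof. by rewrite /cdet; ring. Qed.

End Plane.

Section PlaneCalculus.
Context {R : realType} {E : normedModType R}.
Local Notation C := (cplane R).
Implicit Types (f g : E -> C) (a b : E -> R^o).

Lemma diff_mul a b x v : differentiable a x -> differentiable b x ->
  'd (fun y => a y * b y : R^o) x v = a x * 'd b x v + b x * 'd a x v.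
Proof. by move=> da db; rewrite (@diffM _ _ a b). Qed.

Lemma differentiable_mul a b x : differentiable a x -> differentiable b x ->
  differentiable (fun y => a y * b y : R^o) x.
Proof. by move=> da db; exact: (@differentiableM _ _ a b). Qed.

Lemma differentiable_fst f x : differentiable f x ->
  differentiable (fun y => (f y).1 : R^o) x.
Proof.
move=> df; apply: (@differentiable_comp _ _ _ _ f (fst : C -> R^o)) => //.
by apply: linear_differentiable => ?; exact: cvg_fst.
Qed.

Lemma differentiable_snd f x : differentiable f x ->
  differentiable (fun y => (f y).2 : R^o) x.
Proof.
move=> df; apply: (@differentiable_comp _ _ _ _ f (snd : C -> R^o)) => //.
by apply: linear_differentiable => ?; exact: cvg_snd.
Qed.

Lemma diff_fst f x v : differentiable f x ->
  'd (fun y => (f y).1 : R^o) x v = ('d f x v).1.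
Proof.
move=> df.
have -> : 'd (fun y => (f y).1 : R^o) x v = 'd ((fst : C -> R^o) \o f) x v by [].
have fc : continuous (fst : C -> R^o) by move=> ?; exact: cvg_fst.
have fd : differentiable (fst : C -> R^o) (f x) by exact: linear_differentiable.
by rewrite diff_comp//= diff_lin.
Qed.

Lemma diff_snd f x v : differentiable f x ->
  'd (fun y => (f y).2 : R^o) x v = ('d f x v).2.
Proof.
move=> df.
have -> : 'd (fun y => (f y).2 : R^o) x v = 'd ((snd : C -> R^o) \o f) x v by [].
have fc : continuous (snd : C -> R^o) by move=> ?; exact: cvg_snd.
have fd : differentiable (snd : C -> R^o) (f x) by exact: linear_differentiable.
by rewrite diff_comp//= diff_lin.
Qed.

Lemma differentiable_cdot f g x : differentiable f x -> differentiable g x ->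
  differentiable (fun y => cdot (f y) (g y) : R^o) x.
Proof.
move=> df dg; apply: (@differentiableD _ _ _ (fun y => (f y).1 * (g y).1 : R^o)
   (fun y => (f y).2 * (g y).2 : R^o)); apply: differentiable_mul;
by [exact: differentiable_fst|exact: differentiable_snd].
Qed.

Lemma diff_cdot f g x v : differentiable f x -> differentiable g x ->
  'd (fun y => cdot (f y) (g y) : R^o) x v = cdot (f x) ('d g x v) + cdot ('d f x v) (g x).
Proof.
move=> df dg.
have [f1 f2] := (differentiable_fst df, differentiable_snd df).
have [g1 g2] := (differentiable_fst dg, differentiable_snd dg).
have m1 := differentiable_mul f1 g1; have m2 := differentiable_mul f2 g2.
have E1 := diff_mul v f1 g1; have E2 := diff_mul v f2 g2.
have /(congr1 (fun F : E -> R^o => F v)) E0 := diffD m1 m2.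
apply: (etrans E0).
apply: (etrans (congr2 (fun a b : R => a + b) E1 E2)).
rewrite (diff_fst v df) (diff_snd v df) (diff_fst v dg) (diff_snd v dg).
exact: cdot_expand.
Qed.

Lemma differentiable_cdet f g x : differentiable f x -> differentiable g x ->
  differentiable (fun y => cdet (f y) (g y) : R^o) x.
Proof.
move=> df dg; apply: (@differentiableB _ _ _ (fun y => (f y).1 * (g y).2 : R^o)
   (fun y => (f y).2 * (g y).1 : R^o)); apply: differentiable_mul;
by [exact: differentiable_fst|exact: differentiable_snd].
Qed.

Lemma diff_cdet f g x v : differentiable f x -> differentiable g x ->
  'd (fun y => cdet (f y) (g y) : R^o) x v = cdet (f x) ('d g x v) + cdet ('d f x v) (g x).
Proof.
move=> df dg.
have [f1 f2] := (differentiable_fst df, differentiable_snd df).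
have [g1 g2] := (differentiable_fst dg, differentiable_snd dg).
have m1 := differentiable_mul f1 g2; have m2 := differentiable_mul f2 g1.
have E1 := diff_mul v f1 g2; have E2 := diff_mul v f2 g1.
have /(congr1 (fun F : E -> R^o => F v)) E0 := diffB m1 m2.
apply: (etrans E0).
apply: (etrans (congr2 (fun a b : R => a - b) E1 E2)).
rewrite (diff_fst v df) (diff_snd v df) (diff_fst v dg) (diff_snd v dg).
exact: cdet_expand.
Qed.

Lemma diff_cdotl z f x v : differentiable f x ->
  'd (fun y => cdot z (f y) : R^o) x v = cdot z ('d f x v).
Proof.
move=> df; have dz : differentiable (cst z : E -> C) x by exact: differentiable_cst.
apply: (etrans (diff_cdot v dz df)).
have E1 : 'd (cst z : E -> C) x v = 0.
  exact: (congr1 (fun F : E -> C => F v) (diff_cst z x)).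
apply: (etrans (congr1 (fun w => cdot z ('d f x v) + cdot w (f x)) E1)).
by rewrite cdot0l addr0.
Qed.

Lemma diff_cdetl z f x v : differentiable f x ->
  'd (fun y => cdet z (f y) : R^o) x v = cdet z ('d f x v).
Proof.
move=> df; have dz : differentiable (cst z : E -> C) x by exact: differentiable_cst.
apply: (etrans (diff_cdet v dz df)).
have E1 : 'd (cst z : E -> C) x v = 0.
  exact: (congr1 (fun F : E -> C => F v) (diff_cst z x)).
apply: (etrans (congr1 (fun w => cdet z ('d f x v) + cdet w (f x)) E1)).
by rewrite cdet0l addr0.
Qed.

Lemma differentiable_cdotl z f x : differentiable f x ->
  differentiable (fun y => cdot z (f y) : R^o) x.
Proof. by move=> df; apply: differentiable_cdot => //; exact: differentiable_cst. Qed.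

Lemma differentiable_cdetl z f x : differentiable f x ->
  differentiable (fun y => cdet z (f y) : R^o) x.
Proof. by move=> df; apply: differentiable_cdet => //; exact: differentiable_cst. Qed.

Lemma Ck_cdot k (U : set E) f g : open U -> Ck k U f -> Ck k U g ->
  Ck k U (fun y => cdot (f y) (g y) : R^o).
Proof.
move=> oU Cf Cg.
have c1 : continuous (fst : C -> R^o) by move=> ?; exact: cvg_fst.
have c2 : continuous (snd : C -> R^o) by move=> ?; exact: cvg_snd.
apply: CkD => //; apply: CkM => //.
- exact: (Ck_lin oU c1 Cf).
- exact: (Ck_lin oU c1 Cg).
- exact: (Ck_lin oU c2 Cf).
- exact: (Ck_lin oU c2 Cg).
Qed.

Lemma Ck_cdet k (U : set E) f g : open U -> Ck k U f -> Ck k U g ->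
  Ck k U (fun y => cdet (f y) (g y) : R^o).
Proof.
move=> oU Cf Cg.
have -> : (fun y => cdet (f y) (g y) : R^o) = (fun y => cdot (crot (f y)) (g y) : R^o).
  by apply/funext => y; rewrite /cdet /cdot /= addrC mulNr.
have c1 : continuous (fst : C -> R^o) by move=> ?; exact: cvg_fst.
have c2 : continuous (snd : C -> R^o) by move=> ?; exact: cvg_snd.
apply: Ck_cdot => //; apply: Ck_pair => //; last exact: (Ck_lin oU c1 Cf).
apply: (@Ck_eq _ _ _ _ _ _ (fun y => (-1 : R^o) * (f y).2 : R^o)) => //.
  by move=> y _; rewrite mulN1r.
by apply: CkM => //; [exact: Ck_cst|exact: (Ck_lin oU c2 Cf)].
Qed.

End PlaneCalculus.

(** * Fibres and pages of an open book *)

Section OpenBook.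
Context {R : realType} {d : nat}.
Local Notation E := 'rV[R]_d.
Local Notation C := (cplane R).
Variable V : @atlased R E.
Hypothesis Vm : manifold V.
Variables (K : set V) (theta h : V -> C).
Hypothesis DM : defining_map K theta h.
Implicit Types (c : chart E V) (p q : V) (z : C).

Lemma smooth_h : smooth_fun setT h. Proof. by case: DM. Qed.

Lemma KE p : K p <-> h p = 0.
Proof. by case: DM => _ -> _ _. Qed.

Lemma thetaE p : ~ K p -> theta p = (cmod (h p))^-1 *: h p.
Proof. by case: DM => _ _ _; apply. Qed.

Lemma h_neq0 p : ~ K p -> h p != 0.
Proof. by move=> Kp; apply/eqP => /KE. Qed.

Lemma h_theta p : ~ K p -> h p = cmod (h p) *: theta p.
Proof.
move=> Kp; rewrite thetaE// scalerA divff ?scale1r//.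
by rewrite cmod_eq0 h_neq0.
Qed.

Lemma h_Cinf c : atlas V c -> Cinf (cimg c) (h \o cinv c).
Proof.
move=> ac k; apply: Ck_sub (smooth_fun_chart Vm openT smooth_h ac k).
by move=> x cx; split.
Qed.

Lemma h_diff c x : atlas V c -> cimg c x -> differentiable (h \o cinv c) x.
Proof. by move=> ac cx; have [hd _] := h_Cinf ac 1; exact: hd. Qed.

Lemma h_continuous p : {for p, continuous h}.
Proof.
have [_ _ _ /(_ p)[c ac cp] _] := Vm; have cc := atlas_chart Vm ac.
have hc : {for cmap c p, continuous (h \o cinv c)}.
  by apply: differentiable_continuous; apply: h_diff => //; exact: chart_img.
have fE : {near p, (h \o cinv c) \o cmap c =1 h}.
  by apply: filterS (near_cdom cc cp) => q cq; rewrite /= (chartK cc).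
rewrite /prop_for /continuous_at; apply: cvg_trans (near_eq_cvg fE) _.
have := continuous_comp (cmap_continuous cc cp) hc.
by rewrite /prop_for /continuous_at /= (chartK cc).
Qed.

Lemma cdot_h_continuous z : continuous (fun p => cdot z (h p)).
Proof.
move=> p; have hp := h_continuous (p := p).
have h1 : (h q).1 @[q --> p] --> (h p).1 by exact: (@cvg_comp _ _ _ h fst _ (nbhs (h p))) hp (@cvg_fst _ _ _ _ _).
have h2 : (h q).2 @[q --> p] --> (h p).2 by exact: (@cvg_comp _ _ _ h snd _ (nbhs (h p))) hp (@cvg_snd _ _ _ _ _).
by apply: cvgD; apply: cvgMl_tmp.
Qed.

Lemma cdet_h_continuous z : continuous (fun p => cdet z (h p)).
Proof.
have -> : (fun p => cdet z (h p)) = (fun p => cdot (crot z) (h p)).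
  by apply/funext => p; rewrite /cdet /cdot /=; ring.
exact: cdot_h_continuous.
Qed.

Lemma cmod_h_continuous : continuous (fun p => cmod (h p)).
Proof.
move=> p; have hp := h_continuous (p := p).
have h1 : (h q).1 @[q --> p] --> (h p).1 by exact: (@cvg_comp _ _ _ h fst _ (nbhs (h p))) hp (@cvg_fst _ _ _ _ _).
have h2 : (h q).2 @[q --> p] --> (h p).2 by exact: (@cvg_comp _ _ _ h snd _ (nbhs (h p))) hp (@cvg_snd _ _ _ _ _).
have hh : cdot (h q) (h q) @[q --> p] --> cdot (h p) (h p).
  by apply: cvgD; apply: cvgM.
have -> : (fun p => cmod (h p)) = (Num.sqrt \o (fun q => cdot (h q) (h q))).
  by apply/funext => q; rewrite cmodE.
exact: (continuous_comp hh (@sqrt_continuous R _)).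
Qed.

(** The binding is the zero set of [|h|]. *)
Lemma open_notK : open (~` K).
Proof.
have -> : ~` K = (fun p => cmod (h p)) @^-1` [set t | t != 0].
  apply/seteqP; split => p /=; first by move/h_neq0; rewrite cmod_eq0.
  by rewrite cmod_eq0 => /eqP hp /KE.
apply: open_comp; last exact: open_neq.
by move=> p _; exact: cmod_h_continuous.
Qed.

(** Pages are inverse images of rays, so the multivalued angle never has to be
    handled: they are cut out by [cdet z h] and [cdot z h]. *)
Lemma fibreE z p : circle z -> fibre K theta z p <-> cdet z (h p) = 0 /\ 0 < cdot z (h p).
Proof.
move=> zc; have zz := circle_cdot zc; split.
  move=> [Kp tp]; rewrite (h_theta Kp) tp cdetZr cdetzz mulr0; split=> //.
  by rewrite cdotZr zz mulr1 cmod_gt0// h_neq0.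
move=> [cz dz].
have hE := ray_eq zc cz (ltW dz).
have Kp : ~ K p by move=> /KE hp; move: dz; rewrite hp /cdot !mulr0 addr0 ltxx.
split=> //; rewrite thetaE// {2}hE scalerA mulVf ?scale1r//.
by rewrite cmod_eq0 h_neq0.
Qed.

Lemma pageE z p : circle z -> page K theta z p <-> cdet z (h p) = 0 /\ 0 <= cdot z (h p).
Proof.
move=> zc; split.
  case=> [/KE ->|/(fibreE _ zc)[-> /ltW]//].
  by rewrite /cdet /cdot !mulr0 subrr addr0.
move=> [cz dz]; have hE := ray_eq zc cz dz.
have [hp|hp] := eqVneq (h p) 0; first by left; apply/KE.
right; apply/(fibreE _ zc); split=> //; rewrite hE cdotZr circle_cdot// mulr1.
exact: cmod_gt0.
Qed.

Lemma page_minus_K z : page K theta z `\` K = fibre K theta z.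
Proof.
apply/seteqP; split => p; first by case=> -[].
by move=> [Kp tp]; split => //; right.
Qed.

Lemma fibre_cdot z p : circle z -> fibre K theta z p -> h p = cmod (h p) *: z.
Proof. by move=> zc [Kp <-]; exact: h_theta. Qed.

Lemma circle_theta p : ~ K p -> circle (theta p).
Proof.
move=> Kp; rewrite thetaE//; apply: cdot_circle; rewrite cdotZl cdotZr -sqr_cmod.
by rewrite mulrA -invfM -expr2 mulVf// sqrf_eq0 cmod_eq0 h_neq0.
Qed.

Lemma fibre_theta p : ~ K p -> fibre K theta (theta p) p.
Proof. by move=> Kp; split. Qed.

Lemma invmod_Cinf c : atlas V c ->
  Cinf [set x | cimg c x /\ ~ K (cinv c x)] (fun x => (cmod (h (cinv c x)))^-1 : R^o).
Proof.
move=> ac k; have cc := atlas_chart Vm ac.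
have oW := open_chart_pre cc open_notK.
have Ch : Ck k [set x | cimg c x /\ ~ K (cinv c x)] (h \o cinv c).
  by apply: Ck_sub (h_Cinf ac k) => x [].
apply: CkV => //.
  by move=> x [cx Kx]; rewrite cmod_eq0 h_neq0.
have -> : (fun x => cmod (h (cinv c x)) : R^o) =
    (fun x => Num.sqrt (cdot ((h \o cinv c) x) ((h \o cinv c) x)) : R^o).
  by apply/funext => x; rewrite cmodE.
apply: Ck_sqrt => //; last exact: Ck_cdot.
by move=> x [cx Kx]; apply: cdotzz_gt0; exact: h_neq0.
Qed.

Lemma theta_diff c x : atlas V c -> cimg c x -> ~ K (cinv c x) ->
  differentiable (theta \o cinv c) x.
Proof.
move=> ac cx Kx; have cc := atlas_chart Vm ac.
have [nd _] := invmod_Cinf ac 1.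
have nx := nd _ (conj cx Kx).
pose f := (fun y => ((cmod (h (cinv c y)))^-1 * (h (cinv c y)).1 : R^o,
                  (cmod (h (cinv c y)))^-1 * (h (cinv c y)).2 : R^o) : C).
apply: (@differentiable_near _ _ _ f).
  apply: (near_open (open_chart_pre cc open_notK)); first by split.
  by move=> y [cy Ky]; rewrite /f /= thetaE.
have hx := h_diff ac cx.
apply: differentiable_pair; apply: differentiable_mul => //.
  exact: differentiable_fst.
exact: differentiable_snd.
Qed.

Lemma cdet_dtheta c x z v : atlas V c -> cimg c x -> ~ K (cinv c x) ->
  cdet z (h (cinv c x)) = 0 ->
  cdet z (dfun theta c x v) = (cmod (h (cinv c x)))^-1 * cdet z (dfun h c x v).
Proof.
move=> ac cx Kx zh; have cc := atlas_chart Vm ac.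
have tx := theta_diff ac cx Kx; have hx := h_diff ac cx.
have [nd _] := invmod_Cinf ac 1.
have nx := nd _ (conj cx Kx).
have dh := differentiable_cdetl z hx.
have E1 := diff_cdetl z v tx; have E2 := diff_cdetl z v hx.
have E3 := diff_mul v nx dh.
have E4 : 'd (fun y => cdet z (theta (cinv c y)) : R^o) x v =
  'd (fun y => (cmod (h (cinv c y)))^-1 * cdet z (h (cinv c y)) : R^o) x v.
  apply: diff_near; last exact: differentiable_mul.
  apply: (near_open (open_chart_pre cc open_notK)); first by split.
  by move=> y [cy Ky]; rewrite thetaE// cdetZr.
apply: (etrans (esym E1)); apply: (etrans E4); apply: (etrans E3).
apply: (etrans (congr1 (fun t => _ * _ + t * _) zh)).
by rewrite mul0r addr0; congr (_ * _).
Qed.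

(** The vector [dtheta v] is orthogonal to [theta], which has values in the unit
    circle, and it is parallel to [theta] because [v] does not change the
    argument of [h]. *)
Lemma dtheta_eq0 c x v : atlas V c -> cimg c x -> ~ K (cinv c x) ->
  cdet (h (cinv c x)) (dfun h c x v) = 0 -> dfun theta c x v = 0.
Proof.
move=> ac cx Kx zh; have cc := atlas_chart Vm ac.
have tx := theta_diff ac cx Kx.
have t0 : h (cinv c x) != 0 by exact: h_neq0.
have tt : theta (cinv c x) != 0.
  by rewrite -cdotzz_eq0 circle_cdot ?oner_eq0//; exact: circle_theta.
apply: (cdot_cdet0 tt).
  have E1 := diff_cdot v tx tx.
  have E2 : 'd (fun y => cdot ((theta \o cinv c) y) ((theta \o cinv c) y) : R^o) x v = 0.
    have dc : differentiable (cst 1 : E -> R^o) x by exact: differentiable_cst.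
    apply: (etrans (diff_near v _ dc)).
      apply: (near_open (open_chart_pre cc open_notK)); first by split.
      by move=> y [cy Ky]; rewrite /= circle_cdot//; exact: circle_theta.
    exact: (congr1 (fun F : E -> R^o => F v) (diff_cst _ x)).
  have E3 := etrans (esym E1) E2; move: E3.
  rewrite [cdot ('d _ _ _) _]cdotC -mulr2n => /eqP.
  by rewrite mulrn_eq0 => /eqP.
have hth : cdet (theta (cinv c x)) (h (cinv c x)) = 0.
  by rewrite (h_theta Kx) cdetZr cdetzz mulr0.
rewrite cdet_dtheta//.
by rewrite thetaE// cdetZl zh !mulr0.
Qed.

End OpenBook.

(** * Tangent spaces of the fibres and of the binding *)

Section Curves.
Context {R : realType} {d : nat}.
Local Notation E := 'rV[R]_d.
Local Notation C := (cplane R).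
Variable V : @atlased R E.
Hypothesis Vm : manifold V.
Variables (K : set V) (theta h : V -> C).
Hypothesis DM : defining_map K theta h.
Hypothesis OB : open_book K theta.
Implicit Types (c e : chart E V) (p q : V) (z : C).

Local Notation flatC := (Chart setT setT id id : chart C (flat C)).

Lemma atlas_prod e : atlas V e -> atlas (prodm (flat C) V) (prod_chart flatC e).
Proof. by move=> ae; exists flatC, e; split. Qed.

Lemma is_chart_prodC e : atlas V e -> is_chart (prod_chart flatC e : chart _ (prodm (flat C) V)).
Proof.
move=> ae; have cf := @is_chart_flat R C.
exact: (is_chart_prod cf (atlas_chart Vm ae)).
Qed.

Lemma line_diff (F : normedModType R) (x v : F) :
  differentiable (fun t : R^o => x + t *: v) 0 /\
  'd (fun t : R^o => x + t *: v) (0 : R^o) (1 : R^o) = v.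
Proof.
have [dl dE] : is_diff (0 : R^o) (fun t : R^o => x + t *: v) (0 + ( *:%R^~ v)).
  exact: is_diffD.
by split=> //; rewrite dE /= add0r scale1r.
Qed.

(** The local trivialization of [theta] around [p] read in charts, as a pair of
    inverse maps [F] and [G] of vector spaces. *)
Lemma fibration_charts z c p : circle z -> atlas V c -> cdom c p -> fibre K theta z p ->
  exists (e : chart E V) (G : E -> C * E) (F : C * E -> E) (u : E) (J : set C),
  let x := cmap c p in
  [/\ [/\ atlas V e, cimg e u, fibre K theta z (cinv e u) & open J /\ J z],
      [/\ differentiable G x, differentiable F (z, u), G x = (z, u) & F (z, u) = x],
      (\forall y \near x, [/\ F (G y) = y, (G y).1 = theta (cinv c y),
          cimg e (G y).2 & fibre K theta z (cinv e (G y).2)]) &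
      (\forall w \near (z, u), J w.1 -> circle w.1 -> fibre K theta z (cinv e w.2) ->
         [/\ cimg c (F w), ~ K (cinv c (F w)) & theta (cinv c (F w)) = w.1])].
Proof.
move=> zc ac cp pz; have cc := atlas_chart Vm ac.
have [_ _ _ /(_ _ zc)[J [f [g [oJ Jz [fs gs gK fK] ft]]]] _] := OB.
pose A := (J `&` circle) `*` fibre K theta z.
pose B := [set p | ~ K p /\ J (theta p)].
have Bp : B p by case: pz => Kp tp; split => //; rewrite tp.
have Bt : forall q, B q -> (g q).1 = theta q.
  move=> q /fK [[[Jg cg] fg] fq]; rewrite -{2}fq.
  by case: (g q) Jg cg fg => a b /= Ja ca fb; rewrite ft.
have [Agp fgp] := fK _ Bp.
have gp1 : (g p).1 = z by rewrite Bt//; case: pz.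
pose q := (g p).2.
have gpE : g p = (z, q) by rewrite /q -gp1; case: (g p).
have qz : fibre K theta z q by case: Agp.
have [_ _ _ /(_ q)[e ae eq] _] := Vm; have ce := atlas_chart Vm ae.
have cpe := is_chart_prodC ae.
have [G [Gd Gx Gn]] := smooth_on_chart cc cpe ac (atlas_prod ae) gs Bp cp (conj I eq).
have fp : cdom c (f (z, q)) by rewrite -gpE fgp.
have Azq : A (z, q) by rewrite -gpE.
have dpe : cdom (prod_chart flatC e) (z, q) by split.
have [F [Fd Fx Fn]] := smooth_on_chart cpe cc (atlas_prod ae) ac fs Azq dpe fp.
have Gx' : G (cmap c p) = (z, cmap e q) by rewrite Gx gpE.
exists e, G, F, (cmap e q), J; split.
- split=> //; first exact: chart_img.
  by rewrite (chartK ce).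
- by split=> //; rewrite Fx -gpE fgp.
- have nB : \forall y \near cmap c p, B (cinv c y).
    have nBp : \forall r \near p, B r.
      apply: filterI; first by apply: open_nbhs_nbhs; split; [exact: (open_notK Vm DM)|case: Bp].
      have : {for p, continuous theta}.
        have [_ _ [st _] _ _] := OB; have [U [t [oU Up [tc _] tE]]] := st _ (proj1 Bp).
        have nt : {near p, t =1 theta}.
          apply: filterS2 (open_nbhs_nbhs (conj oU Up))
            (open_nbhs_nbhs (conj (open_notK Vm DM) (proj1 Bp))) => r Ur Kr.
          exact: tE.
        rewrite /prop_for /continuous_at; apply: cvg_trans (near_eq_cvg nt) _.
        by rewrite -tE//; [exact: tc|case: Bp].
      by apply; apply: open_nbhs_nbhs; split => //; case: Bp.
    by apply: (@near_cinv _ _ _ _ cc _ B); rewrite ?(chartK cc)//; exact: chart_img.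
  have nFG := differentiable_continuous Gd; rewrite /prop_for /continuous_at Gx' in nFG.
  have {}nFG := nFG _ Fn.
  have ncx := near_cimg cc (chart_img cc cp).
  apply: filterS3 nB (filterI Gn nFG) ncx => y By [Gny FGy] cy.
  have [[/= _ dgy] GyE] := Gny By.
  have [AgB fgB] := fK _ By.
  have E2 : cinv e (G y).2 = (g (cinv c y)).2 by rewrite GyE/= (chartK ce).
  have AG : A ((G y).1, cinv e (G y).2).
    by rewrite E2 GyE/=; case: AgB.
  have [_ FE] := FGy AG.
  split.
  + rewrite FE /= E2 GyE /=.
    have -> : ((g (cinv c y)).1, (g (cinv c y)).2) = g (cinv c y) by case: (g _).
    by rewrite fgB (chartVK cc).
  + by rewrite GyE/= Bt.
  + by rewrite GyE/=; exact: chart_img.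
  + by rewrite E2; case: AgB.
- apply: filterS Fn => w Fw Jw cw zw.
  have Aw : A (w.1, cinv e w.2) by split.
  have [dF FE] := Fw Aw.
  have [[nK _] _] := gK _ Aw.
  by rewrite FE (chartK cc)//; split=> //; [exact: chart_img|exact: ft].
Qed.

(** Map the line [x + t v] by the trivialization [G], freeze its first component
    at [z], and come back by [F].  Freezing does not change the velocity at [0],
    because the first component of [G] is [theta], whose derivative along [v] is
    zero. *)
Theorem fibre_curve z c p v : circle z -> atlas V c -> cdom c p -> fibre K theta z p ->
  cdet (h p) (dfun h c (cmap c p) v) = 0 ->
  exists gam : R^o -> E, [/\ gam 0 = cmap c p, differentiable gam 0,
    'd gam 0 1 = v & \forall t \near (0 : R), fibre K theta z (cinv c (gam t))].
Proof.
move=> zc ac cp pz vt; have cc := atlas_chart Vm ac.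
have [e [G [F [u [J [[ae eu zu [oJ Jz]] [Gd Fd Gx Fx] nG nF]]]]]] :=
  fibration_charts zc ac cp pz.
set x := cmap c p in vt Gd Gx Fx nG nF *.
have cx : cimg c x by exact: chart_img.
have xp : cinv c x = p by rewrite /x (chartK cc).
have [ld lE] := line_diff x v.
pose l (t : R^o) := x + t *: v.
have l0 : l 0 = x by rewrite /l scale0r addr0.
have Gdl : differentiable G (l 0) by rewrite l0.
have Gld := differentiable_comp ld Gdl.
have sc : continuous (snd : C * E -> E) by move=> ?; exact: cvg_snd.
have fc : continuous (fst : C * E -> C) by move=> ?; exact: cvg_fst.
have sd w : differentiable (snd : C * E -> E) w by exact: linear_differentiable.
have fd w : differentiable (fst : C * E -> C) w by exact: linear_differentiable.
have G2d : differentiable (fun t : R^o => (G (l t)).2) 0.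
  exact: (@differentiable_comp _ _ _ _ (G \o l) (snd : C * E -> E)).
have dz : differentiable (cst z : R^o -> C) 0 by exact: differentiable_cst.
pose w (t : R^o) := (z, (G (l t)).2) : C * E.
have wd : differentiable w 0 by exact: differentiable_pair.
have w0 : w 0 = (z, u) by rewrite /w l0 Gx.
have Fdw : differentiable F (w 0) by rewrite w0.
have Kx : ~ K (cinv c x) by rewrite xp; case: pz.
have vt' : cdet (h (cinv c x)) (dfun h c x v) = 0 by rewrite xp.
(* the first component of G is theta *)
have dG1 : ('d G x v).1 = 0.
  have E1 : 'd (fun y => (G y).1) x v = ('d G x v).1.
    have := congr1 (fun D : E -> C => D v) (diff_comp Gd (fd (G x))).
    by rewrite /= diff_lin.
  have E2 : 'd (fun y => (G y).1) x v = dfun theta c x v.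
    apply: diff_near; last exact: (theta_diff Vm DM ac cx Kx).
    by apply: filterS nG => y [_ -> _ _].
  apply: (etrans (esym E1)); apply: (etrans E2).
  exact: (dtheta_eq0 Vm DM ac cx Kx vt').
have FG : 'd F (z, u) ('d G x v) = v.
  have FdG : differentiable F (G x) by rewrite Gx.
  have E1 : 'd (F \o G) x v = 'd F (z, u) ('d G x v).
    have := congr1 (fun D : E -> E => D v) (diff_comp Gd FdG).
    by rewrite /= Gx.
  apply: (etrans (esym E1)).
  have di : differentiable (id : E -> E) x by [].
  apply: (etrans (diff_near v _ di)).
    by apply: filterS nG => y [FGy _ _ _]; rewrite /= FGy.
  by have [_ ->] := is_diff_id x.
exists (F \o w); split.
- by rewrite /= w0.
- exact: differentiable_comp.
- have E1 : 'd (F \o w) 0 1 = 'd F (z, u) ('d w 0 1).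
    have := congr1 (fun D : R^o -> E => D 1) (diff_comp wd Fdw).
    by rewrite /= w0.
  apply: (etrans E1).
  have E2 : 'd w 0 1 = (0, ('d G x v).2) :> C * E.
    have := congr1 (fun D : R^o -> C * E => D 1) (diff_pair dz G2d).
    move=> E2; apply: (etrans E2).
    have E3 : 'd (cst z : R^o -> C) 0 1 = 0.
      exact: (congr1 (fun D : R^o -> C => D 1) (diff_cst _ _)).
    have E4 : 'd (fun t : R^o => (G (l t)).2) 0 1 = ('d G x v).2.
      have := congr1 (fun D : R^o -> E => D 1) (diff_comp Gld (sd _)).
      rewrite /= diff_lin// => E4; apply: (etrans E4).
      congr (snd _).
      have := congr1 (fun D : R^o -> C * E => D 1) (diff_comp ld Gdl).
      by rewrite /= lE scale0r addr0.
    exact: (congr2 pair E3 E4).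
  rewrite E2 -[RHS]FG; congr ('d F (z, u) _).
  by rewrite [RHS]surjective_pairing dG1.
- have lc : l t @[t --> (0 : R^o)] --> x.
    by rewrite -l0; exact: differentiable_continuous.
  have wc : w t @[t --> (0 : R^o)] --> (z, u).
    by rewrite -w0; exact: differentiable_continuous.
  have n1 : \forall t \near (0 : R), fibre K theta z (cinv e (G (l t)).2).
    by apply: (@filterS _ _ _ _ (fun t => fibre K theta z (cinv e (G (l t)).2)) _ (lc _ nG)) => t [].
  pose P2 (t : R) := fibre K theta z (cinv e (w t).2) ->
      ~ K (cinv c (F (w t))) /\ theta (cinv c (F (w t))) = z.
  have n2 : \forall t \near (0 : R), P2 t.
    by apply: (@filterS _ _ _ _ P2 _ (wc _ nF)) => t H H3; have [] := H Jz zc H3.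
  by apply: filterS2 n1 n2 => t zt /(_ zt) [KF tF]; split.
Qed.

End Curves.

Section Tangents.
Context {R : realType} {d : nat}.
Local Notation E := 'rV[R]_d.
Local Notation C := (cplane R).
Variable V : @atlased R E.
Hypothesis Vm : manifold V.
Variables (K : set V) (theta h : V -> C).
Hypothesis DM : defining_map K theta h.
Hypothesis OB : open_book K theta.
Implicit Types (c e : chart E V) (p q : V) (z : C).

Lemma chain_diff (F G H : normedModType R) (f : F -> G) (g : G -> H) x v :
  differentiable f x -> differentiable g (f x) ->
  'd (g \o f) x v = 'd g (f x) ('d f x v).
Proof. by move=> df dg; have := congr1 (fun D : F -> H => D v) (diff_comp df dg). Qed.

Lemma near_right (P : R -> Prop) : (\forall t \near (0 : R), P t) ->
  \forall t \near (0 : R)^'+, P t.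
Proof. exact: (@filterS _ (nbhs (0 : R)) _ _ (fun t : R => 0 < t -> P t) (fun t H _ => H)). Qed.

Lemma smooth_cdet_h z : smooth_fun setT (fun p => cdet z (h p) : R^o).
Proof.
apply: (chart_smooth_fun Vm openT) => c ac k.
have oc := open_cimg (atlas_chart Vm ac).
apply: Ck_sub (_ : Ck k (cimg c) _); first by move=> x [].
apply: (@Ck_cdet _ _ k _ (fun=> z) (h \o cinv c)) => //; first exact: Ck_cst.
exact: (h_Cinf Vm DM ac).
Qed.

Lemma smooth_cdot_h z : smooth_fun setT (fun p => cdot z (h p) : R^o).
Proof.
apply: (chart_smooth_fun Vm openT) => c ac k.
have oc := open_cimg (atlas_chart Vm ac).
apply: Ck_sub (_ : Ck k (cimg c) _); first by move=> x [].
apply: (@Ck_cdot _ _ k _ (fun=> z) (h \o cinv c)) => //; first exact: Ck_cst.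
exact: (h_Cinf Vm DM ac).
Qed.

Lemma dfun_cdet_h z c x v : atlas V c -> cimg c x ->
  dfun (fun p => cdet z (h p) : R^o) c x v = cdet z (dfun h c x v).
Proof. by move=> ac cx; exact: (diff_cdetl z v (h_diff Vm DM ac cx)). Qed.

Lemma dfun_cdot_h z c x v : atlas V c -> cimg c x ->
  dfun (fun p => cdot z (h p) : R^o) c x v = cdot z (dfun h c x v).
Proof. by move=> ac cx; exact: (diff_cdotl z v (h_diff Vm DM ac cx)). Qed.

Lemma open_cdot_h z : open [set p | 0 < cdot z (h p)].
Proof.
have -> : [set p | 0 < cdot z (h p)] = (fun p => cdot z (h p)) @^-1` [set t | 0 < t] by [].
by apply: open_comp; [move=> p _; exact: (cdot_h_continuous Vm DM)|exact: open_gt].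
Qed.

(** A tangent vector kills [cdet z h], which vanishes on the fibre; conversely a
    vector in the kernel is the velocity of a curve in the fibre. *)
Theorem fibre_tangentP z c x v : circle z -> atlas V c -> cimg c x ->
  fibre K theta z (cinv c x) ->
  tangent (fibre K theta z) c x v <-> cdet (h (cinv c x)) (dfun h c x v) = 0.
Proof.
move=> zc ac cx zx; have cc := atlas_chart Vm ac; split.
  move=> tv.
  have T0 : cdet z (dfun h c x v) = 0.
    rewrite -dfun_cdet_h//; apply: (tv [set p | 0 < cdot z (h p)]).
    - exact: open_cdot_h.
    - by case/(fibreE DM _ zc): zx.
    - move=> p _; have [U [g [oU Up sg gE]]] := smooth_cdet_h z (p := p) I.
      by exists U, g; split => // q _ Uq; exact: gE.
    - by move=> q _ /(fibreE DM _ zc)[].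
  by rewrite (fibre_cdot DM zc zx) cdetZl T0 mulr0.
move=> hv.
have cp : cdom c (cinv c x) by exact: chart_dom.
have hv' : cdet (h (cinv c x)) (dfun h c (cmap c (cinv c x)) v) = 0 by rewrite (chartVK cc).
have [gam [g0 gd <- gz]] := fibre_curve Vm DM OB zc ac cp zx hv'.
rewrite (chartVK cc)// in g0.
apply: (tangent_curve Vm ac cx zx g0 gd).
exact: near_right gz.
Qed.

Lemma cos_sin_diff : (differentiable (cos : R^o -> R^o) 0 /\ 'd (cos : R^o -> R^o) 0 1 = 0) /\
  (differentiable (sin : R^o -> R^o) 0 /\ 'd (sin : R^o -> R^o) 0 1 = 1).
Proof.
have dc := is_derive_cos (0 : R); have ds := is_derive_sin (0 : R).
have dcd : differentiable (cos : R^o -> R^o) 0 by apply/derivable1_diffP; exact: ex_derive.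
have dsd : differentiable (sin : R^o -> R^o) 0 by apply/derivable1_diffP; exact: ex_derive.
split; split => //; rewrite -deriveE//.
  by rewrite (@derive_val _ _ _ _ _ _ _ dc) sin0 oppr0.
by rewrite (@derive_val _ _ _ _ _ _ _ ds) cos0.
Qed.

Lemma cdet_rotation z t : circle z -> cdet z (cos t *: z + sin t *: crot z) = sin t.
Proof. by move=> zc; rewrite cdetDr !cdetZr cdetzz cdet_crot circle_cdot// mulr0 add0r mulr1. Qed.

Lemma cdot_rotation z t : circle z -> cdot z (cos t *: z + sin t *: crot z) = cos t.
Proof.
move=> zc; rewrite cdotDr !cdotZr circle_cdot// mulr1.
have -> : cdot z (crot z) = 0 by rewrite /cdot /crot/=; ring.
by rewrite mulr0 addr0.
Qed.

(** The derivative at [0] of an identity [a cos = b sin], stated on numbers so that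
    the algebra does not involve differentials. *)
Lemma product_rule_at0 (a c1 c0 a' b s1 s0 b' : R) :
  a * c1 + c0 * a' = b * s1 + s0 * b' -> c1 = 0 -> s1 = 1 -> c0 = 1 -> s0 = 0 -> a' = b.
Proof.
move=> E c10 s11 c01 s00.
by move: E; rewrite c10 s11 c01 s00 mulr0 mul0r mulr1 mul1r add0r addr0.
Qed.

Lemma circle_rotation z t : circle z -> circle (cos t *: z + sin t *: crot z).
Proof.
move=> /circle_cdot zz; apply: cdot_circle; move: zz.
rewrite /cdot /crot/= /GRing.scale/= => zz; have cs := cos2Dsin2 t.
transitivity ((cos t ^+ 2 + sin t ^+ 2) * (z.1 * z.1 + z.2 * z.2)); first by ring.
by rewrite zz cs mulr1.
Qed.

(** The curve [t |-> F (e^(it) z, u)] turns in the angular direction: its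
    image by [theta] is [e^(it) z], and differentiating
    [cdet z h cos t = cdot z h sin t] along it gives [cdet z (dh v) = |h|]. *)
Theorem fibre_submersive z c x : circle z -> atlas V c -> cimg c x ->
  fibre K theta z (cinv c x) ->
  exists v, cdet (h (cinv c x)) (dfun h c x v) != 0.
Proof.
move=> zc ac cx zx; have cc := atlas_chart Vm ac.
have [e [G [F [u [J]]]]] := fibration_charts Vm DM OB zc ac (chart_dom cc cx) zx.
move=> /= [[ae eu zu [oJ Jz]] [_ Fd _ Fx] _ nF].
rewrite (chartVK cc)// in Fx.
have [[cd c1] [sd s1]] := cos_sin_diff.
pose y (t : R^o) : C := cos t *: z + sin t *: crot z.
have y0 : y 0 = z by rewrite /y cos0 sin0 scale1r scale0r addr0.
have yd : differentiable y 0.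
  by apply: differentiableD; apply: differentiableZl.
have ud : differentiable (cst u : R^o -> E) 0 by exact: differentiable_cst.
pose w (t : R^o) : C * E := (y t, u).
have wd : differentiable w 0 by exact: differentiable_pair.
have w0 : w 0 = (z, u) by rewrite /w y0.
have Fw : differentiable F (w 0) by rewrite w0.
have gd : differentiable (F \o w) 0 by exact: differentiable_comp.
have g0 : (F \o w) 0 = x by rewrite /= w0.
pose H := h \o cinv c.
have Hd : differentiable H ((F \o w) 0) by rewrite g0; exact: (h_diff Vm DM ac cx).
have Hgd : differentiable (H \o (F \o w)) 0 by exact: differentiable_comp.
exists ('d (F \o w) 0 1).
have dH : 'd (H \o (F \o w)) 0 1 = dfun h c x ('d (F \o w) 0 1).
  by have e1 := chain_diff (1 : R^o) gd Hd; rewrite g0 in e1.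
have hx := fibre_cdot DM zc zx.
have m0 : cmod (h (cinv c x)) != 0 by rewrite cmod_eq0 (h_neq0 DM)//; case: zx.
suff E : cdet z (dfun h c x ('d (F \o w) 0 1)) = cmod (h (cinv c x)).
  by rewrite hx cdetZl E mulf_neq0.
have yc : y t @[t --> (0 : R^o)] --> z.
  by rewrite -y0; exact: differentiable_continuous.
have nJ : \forall t \near (0 : R^o), J (y t).
  exact: (yc _ (open_nbhs_nbhs (conj oJ Jz))).
have wc : w t @[t --> (0 : R^o)] --> (z, u).
  by rewrite -w0; exact: differentiable_continuous.
(* h at F (w t) is a multiple of cos t z + sin t i z *)
pose P (t : R^o) := cdet z (H (F (w t))) * cos t = cdot z (H (F (w t))) * sin t.
have nP : \forall t \near (0 : R^o), P t.
  apply: (@filterS2 _ _ _ _ _ P _ nJ (wc _ nF)) => t Jt /= /(_ Jt (circle_rotation t zc) zu).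
  move=> [_ KF tF]; rewrite /P /H /=.
  rewrite (h_theta DM KF) tF cdetZr cdotZr cdet_rotation// cdot_rotation//.
  by rewrite -!mulrA [sin t * _]mulrC.
have D1 := differentiable_cdetl z Hgd.
have D2 := differentiable_cdotl z Hgd.
have E1 := diff_mul (1 : R^o) D1 cd; have E2 := diff_mul (1 : R^o) D2 sd.
have E3 : 'd (fun t : R^o => cdet z ((H \o (F \o w)) t) * cos t : R^o) 0 1 =
          'd (fun t : R^o => cdot z ((H \o (F \o w)) t) * sin t : R^o) 0 1.
  by apply: diff_near; [apply: filterS nP => t /esym|exact: differentiable_mul].
have E4 := etrans (esym E1) (etrans E3 E2).
have E5 : cdot z (H (F (w 0))) = cmod (h (cinv c x)).
  by rewrite w0 Fx /H /= hx cdotZr circle_cdot// mulr1 -hx.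
have {}E4 := product_rule_at0 E4 c1 s1 (cos0 R) (sin0 R).
have E6 := etrans (esym (diff_cdetl z (1 : R^o) Hgd)) E4.
by rewrite -dH; apply: (etrans E6).
Qed.

End Tangents.

Section Binding.
Context {R : realType} {d : nat}.
Local Notation E := 'rV[R]_d.
Local Notation C := (cplane R).
Variable V : @atlased R E.
Hypothesis Vm : manifold V.
Variables (K : set V) (theta h : V -> C).
Hypothesis DM : defining_map K theta h.
Hypothesis OB : open_book K theta.
Implicit Types (c e : chart E V) (p q : V) (z : C).

Local Notation flatC := (Chart setT setT id id : chart C (flat C)).

(** The trivialization of a neighbourhood of the binding read in a chart.  The
    last condition of the second clause holds because [h] and the first component
    of [G] have the same argument. *)
Lemma binding_charts c x : atlas V c -> cimg c x -> K (cinv c x) ->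
  exists (G : E -> C * E) (F : C * E -> E),
  [/\ [/\ differentiable G x, differentiable F (0, x), G x = (0, x) & F (0, x) = x],
      (\forall y \near x, [/\ F (G y) = y, cimg c (G y).2, K (cinv c (G y).2) &
          0 <= cdot (h (cinv c y)) (G y).1]) &
      (\forall w \near ((0 : C), x), disc w.1 -> K (cinv c w.2) -> cimg c w.2 ->
          [/\ cimg c (F w), G (F w) = w, w.1 = 0 -> F w = w.2 & w.1 != 0 ->
            ~ K (cinv c (F w)) /\ theta (cinv c (F w)) = (cmod w.1)^-1 *: w.1])].
Proof.
move=> ac cx Kp; have cc := atlas_chart Vm ac.
set p := cinv c x in Kp.
have cp : cdom c p by exact: chart_dom.
have xp : cmap c p = x by exact: chartVK.
have [_ _ _ _ [N [f [g [KN [fs gs gK fK] f0 ft]]]]] := OB.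
have disc0 : disc (0 : C) by rewrite /disc/= /cmod/= expr0n/= addr0 sqrtr0 ler01.
have Np : N p by apply: nbhs_singleton; exact: KN.
have f0p : f (0, p) = p by exact: f0.
have gp : g p = (0, p) by rewrite -{1}f0p; exact: (gK (0, p) (conj disc0 Kp)).2.
have cpe := is_chart_prodC Vm ac.
have dgp : cdom (prod_chart flatC c) (g p) by rewrite gp; split.
have [G [Gd Gx Gn]] := smooth_on_chart cc cpe ac (atlas_prod ac) gs Np cp dgp.
have fp : cdom c (f (0, p)) by rewrite f0p.
have [F [Fd Fx Fn]] := smooth_on_chart cpe cc (atlas_prod ac) ac fs (conj disc0 Kp : (disc `*` K) (0, p)) (conj I cp : cdom (prod_chart flatC c) (0, p)) fp.
rewrite /= in Fd Fx Fn; rewrite xp in Gd Gx Gn Fd Fx Fn.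
rewrite gp /= xp in Gx; rewrite f0p xp in Fx.
have nN : \forall y \near x, N (cinv c y).
  by apply: (@near_cinv _ _ _ _ cc _ N) => //; exact: KN.
have ncx := near_cimg cc cx.
have nFG := differentiable_continuous Gd; rewrite /prop_for /continuous_at Gx in nFG.
have {}nFG := nFG _ Fn.
have nGF := differentiable_continuous Fd; rewrite /prop_for /continuous_at Fx in nGF.
pose Q y := [/\ N (cinv c y), cimg c y & N (cinv c y) ->
   cdom (prod_chart flatC c : chart _ (prodm (flat C) V)) (g (cinv c y)) /\
   G y = ((g (cinv c y)).1, cmap c (g (cinv c y)).2)].
have nQ : \forall y \near x, Q y by apply: filterS3 nN ncx Gn => y ? ? ?; split.
have {}nGF : nbhs ((0 : C), x) (F @^-1` Q) by exact: nGF _ nQ.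
have Gdec y : cimg c y -> N (cinv c y) -> G y = ((g (cinv c y)).1, cmap c (g (cinv c y)).2) ->
  cdom c (g (cinv c y)).2 ->
  [/\ disc (G y).1, K (cinv c (G y).2), g (cinv c y) = ((G y).1, cinv c (G y).2),
      cimg c (G y).2 & f ((G y).1, cinv c (G y).2) = cinv c y].
  move=> cy Ny -> dgy /=; rewrite (chartK cc)//.
  have [[dg Kg] fg] := fK _ Ny.
  have e1 : ((g (cinv c y)).1, (g (cinv c y)).2) = g (cinv c y) by case: (g _).
  by split=> //; [exact: chart_img|rewrite e1].
exists G, F; split.
- by [].
- apply: filterS3 nN (filterI Gn nFG) ncx => y Ny [Gny FGy] cy.
  have [[/= _ dgy] GyE] := Gny Ny.
  have [dG KG gG cG fG] := Gdec y cy Ny GyE dgy.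
  have AG : (disc `*` K) ((G y).1, cinv c (G y).2) by split.
  have [_ FE] := FGy AG.
  split=> //.
    by rewrite FE /= fG (chartVK cc).
  have [Ky|Ky] := pselect (K (cinv c y)).
    by have /(KE DM) -> := Ky; rewrite /cdot !mul0r addr0.
  have G1 : (G y).1 != 0.
    by apply/eqP => G10; apply: Ky; rewrite -fG G10 f0.
  have tE := ft _ _ dG G1 KG; rewrite fG in tE.
  rewrite (h_theta DM Ky) tE !cdotZl !mulr_ge0//.
  + exact: cmod_ge0.
  + by rewrite invr_ge0 cmod_ge0.
  + exact: cdotzz_ge0.
- pose P (w : C * E) := disc w.1 -> K (cinv c w.2) -> cimg c w.2 ->
          [/\ cimg c (F w), G (F w) = w, w.1 = 0 -> F w = w.2 & w.1 != 0 ->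
            ~ K (cinv c (F w)) /\ theta (cinv c (F w)) = (cmod w.1)^-1 *: w.1].
  apply: (@filterS2 _ _ _ _ _ P _ Fn nGF) => w Fw [NFw cFw GFw] dw Kw cw.
  have Aw : (disc `*` K) (w.1, cinv c w.2) by split.
  have [dF FE] := Fw Aw.
  have [nK gf] := gK _ Aw.
  have cF : cinv c (F w) = f (w.1, cinv c w.2) by rewrite FE (chartK cc).
  have [_ GE] := GFw NFw.
  have GFE : G (F w) = w.
    by rewrite GE cF gf /= (chartVK cc)//; case: (w).
  split=> //.
  + move=> w10; rewrite FE w10 f0// (chartVK cc)//.
  + move=> w1; rewrite cF; split; last exact: ft.
    move=> Kf; have Af : (disc `*` K) ((0 : C), f (w.1, cinv c w.2)) by split; [exact: disc0|exact: Kf].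
    have [_ gff] := gK _ Af; rewrite /= f0// gf in gff.
    by move: w1; rewrite -[w.1]/((w.1, cinv c w.2).1) gff eqxx.
Qed.

Lemma cvg_plane (T : Type) (F : set_system T) {FF : Filter F} (f : T -> C) (l : C) :
  f t @[t --> F] --> l ->
  ((f t).1 @[t --> F] --> l.1) /\ ((f t).2 @[t --> F] --> l.2).
Proof.
move=> fl; split.
  exact: (@cvg_comp _ _ _ f fst _ (nbhs l)) fl (@cvg_fst _ _ _ _ _).
exact: (@cvg_comp _ _ _ f snd _ (nbhs l)) fl (@cvg_snd _ _ _ _ _).
Qed.

Lemma cvg_cdot (T : Type) (F : set_system T) {FF : Filter F} (f g : T -> C) (l m : C) :
  f t @[t --> F] --> l -> g t @[t --> F] --> m ->
  cdot (f t) (g t) @[t --> F] --> cdot l m.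
Proof.
move=> /cvg_plane[f1 f2] /cvg_plane[g1 g2].
by apply: cvgD; apply: cvgM.
Qed.

(** Divide by [s] and let [s] tend to [0]. *)
Lemma quadratic_squeeze (a b : R) :
  (forall s : R, 0 < s -> 0 <= - s * (a + - s * b)) -> a <= 0.
Proof.
move=> H; rewrite leNgt; apply/negP => a0.
have k0 : 0 < `|b| + 1 by rewrite ltr_wpDl.
have s0 : 0 < a / (2 * (`|b| + 1)) by rewrite divr_gt0// mulr_gt0.
have := H _ s0; set s := a / _ in s0 *.
have sb : s * `|b| <= a / 2.
  rewrite /s invfM mulrA -mulrA ler_piMr//; first by rewrite divr_ge0// ltW.
  by rewrite mulrC ler_pdivrMr// mul1r lerDl.
have sb' : s * b <= a / 2 by apply: le_trans sb; rewrite ler_pM2l// ler_norm.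
rewrite mulNr oppr_ge0 pmulr_rle0// mulNr subr_le0 => /le_trans/(_ sb').
by lra.
Qed.

Lemma one_sided0 (g : R^o -> R^o) : differentiable g 0 -> g 0 = 0 ->
  (\forall t \near (0 : R)^'+, g t = 0) -> 'd g 0 1 = 0.
Proof.
move=> gd g0 gn; apply/eqP; rewrite eq_le; apply/andP; split.
  by apply: one_sided_max => //; apply: filterS gn => t ->; rewrite g0.
rewrite -oppr_le0.
have E : 'd (- g) 0 1 = - 'd g 0 1.
  exact: (congr1 (fun D : R^o -> R^o => D 1) (diffN gd)).
rewrite -E; apply: one_sided_max; first exact: differentiableN.
by apply: filterS gn => t; rewrite !fctE => ->; rewrite g0.
Qed.

Lemma plane_one_sided (g : R^o -> C) : differentiable g 0 -> g 0 = 0 ->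
  (\forall t \near (0 : R)^'+, g t = 0) -> 'd g 0 1 = 0.
Proof.
move=> gd g0 gn.
have E1 : ('d g 0 1).1 = 0.
  apply: (etrans (esym (diff_fst (1 : R^o) gd))); apply: one_sided0.
  - exact: differentiable_fst.
  - by rewrite g0.
  - by apply: filterS gn => t ->.
have E2 : ('d g 0 1).2 = 0.
  apply: (etrans (esym (diff_snd (1 : R^o) gd))); apply: one_sided0.
  - exact: differentiable_snd.
  - by rewrite g0.
  - by apply: filterS gn => t ->.
by rewrite [LHS]surjective_pairing E1 E2.
Qed.

Section AtPoint.
Variables (c : chart E V) (x : E).
Hypotheses (ac : atlas V c) (cx : cimg c x) (Kx : K (cinv c x)).

Lemma hx0 : h (cinv c x) = 0. Proof. exact/(KE DM). Qed.

Lemma h_onto w : exists v, dfun h c x v = w.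
Proof.
have cc := atlas_chart Vm ac; have [_ _ hs _] := DM.
have [v] := hs _ Kx c ac (chart_dom cc cx) w.
by rewrite (chartVK cc)//; exists v.
Qed.

(** Two plane-valued functions that vanish at [x] and have nonnegative scalar
    product nearby have differentials with the same property: divide by [t^2]
    along the lines through [x]. *)
Lemma cdot_diff_ge0 (G1 : E -> C) : differentiable G1 x -> G1 x = 0 ->
  (\forall y \near x, 0 <= cdot (h (cinv c y)) (G1 y)) ->
  forall v, 0 <= cdot (dfun h c x v) ('d G1 x v).
Proof.
move=> Gd G0 Gn v.
have hd := h_diff Vm DM ac cx.
have quot (f : E -> C) : differentiable f x -> f x = 0 ->
    t^-1 *: f (x + t *: v) @[t --> (0 : R)^'] --> 'd f x v.
  move=> fd f0; rewrite -deriveE//.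
  have := diff_derivable (v := v) fd; rewrite /derivable => dv.
  have -> : (fun t : R => t^-1 *: f (x + t *: v)) =
     (fun t => t^-1 *: ((f \o shift x) (t *: v) - f x)).
    by apply/funext => t /=; rewrite f0 subr0 addrC.
  exact: dv.
have q1 := quot _ hd hx0; have q2 := quot _ Gd G0.
have lim : cdot (t^-1 *: (h \o cinv c) (x + t *: v)) (t^-1 *: G1 (x + t *: v)) @[t --> (0 : R)^'] -->
    cdot (dfun h c x v) ('d G1 x v).
  exact: (cvg_cdot q1 q2).
rewrite -(cvg_lim _ lim)//; apply: limr_ge; first by apply/cvg_ex; eexists; exact: lim.
have lc : (x + t *: v) @[t --> (0 : R)] --> x.
  have [ld _] := line_diff x v.
  by have := differentiable_continuous ld; rewrite /prop_for /continuous_at scale0r addr0.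
pose P (t : R) := 0 <= cdot (t^-1 *: (h \o cinv c) (x + t *: v)) (t^-1 *: G1 (x + t *: v)).
apply: (@filterS _ (nbhs (0 : R)) _ _ (fun t : R => t != 0 -> P t) _ (lc _ Gn)) => t /= ht _.
by rewrite /P cdotZl cdotZr mulrA -expr2 mulr_ge0// sqr_ge0.
Qed.

(** For [v] in the kernel of [dh] and [v'] with [dh v' = dG1 v], nonnegativity at
    [v - s v'] forces [- s |dG1 v|^2 + O(s^2) >= 0] for all [s > 0]. *)
Lemma diff_eq0_of_cdot_ge0 (G1 : E -> C) : differentiable G1 x -> G1 x = 0 ->
  (\forall y \near x, 0 <= cdot (h (cinv c y)) (G1 y)) ->
  forall v, dfun h c x v = 0 -> 'd G1 x v = 0.
Proof.
move=> Gd G0 Gn v hv; have pos := cdot_diff_ge0 Gd G0 Gn.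
have [v' hv'] := h_onto ('d G1 x v).
apply/eqP; rewrite -cdotzz_eq0 eq_le cdotzz_ge0 andbT.
apply: (quadratic_squeeze (b := cdot ('d G1 x v) ('d G1 x v'))) => s s0.
have := pos (- s *: v' + v); rewrite dfun_linear linearP hv hv' addr0.
by rewrite cdotZl cdotDr cdotZr [_ + cdot _ _]addrC.
Qed.

(** The first component [G1] of the trivialization vanishes on the binding and
    has the argument of [h], so that its differential vanishes on the kernel of
    [dh] ([diff_eq0_of_cdot_ge0]).  Therefore freezing it at [0] along the line
    [x + t v] does not change the velocity, as in [fibre_curve]. *)
Theorem binding_tangent v : dfun h c x v = 0 -> tangent K c x v.
Proof.
move=> hv.
have [G [F [[Gd Fd Gx Fx] nG nF]]] := binding_charts ac cx Kx.
have sc : continuous (snd : C * E -> E) by move=> ?; exact: cvg_snd.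
have fc : continuous (fst : C * E -> C) by move=> ?; exact: cvg_fst.
have sd w : differentiable (snd : C * E -> E) w by exact: linear_differentiable.
have fd w : differentiable (fst : C * E -> C) w by exact: linear_differentiable.
pose G1 y := (G y).1.
have G1d : differentiable G1 x by exact: (@differentiable_comp _ _ _ _ G (fst : C * E -> C)).
have dG1 : ('d G x v).1 = 0.
  have E1 : 'd G1 x v = ('d G x v).1.
    by have := chain_diff v Gd (fd (G x)); rewrite diff_lin.
  apply: (etrans (esym E1)); apply: (diff_eq0_of_cdot_ge0 G1d _ _ hv); first by rewrite /G1 Gx.
  by apply: filterS nG => y [].
have FG : 'd F (0, x) ('d G x v) = v.
  have FdG : differentiable F (G x) by rewrite Gx.
  have E1 := chain_diff v Gd FdG; rewrite Gx in E1.
  apply: (etrans (esym E1)).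
  have di : differentiable (id : E -> E) x by [].
  apply: (etrans (diff_near v _ di)).
    by apply: filterS nG => y [FGy _ _ _]; rewrite /= FGy.
  by have [_ ->] := is_diff_id x.
have [ld lE] := line_diff x v.
pose l (t : R^o) := x + t *: v.
have l0 : l 0 = x by rewrite /l scale0r addr0.
have Gdl : differentiable G (l 0) by rewrite l0.
have Gld := differentiable_comp ld Gdl.
have G2d : differentiable (fun t : R^o => (G (l t)).2) 0.
  exact: (@differentiable_comp _ _ _ _ (G \o l) (snd : C * E -> E)).
have dz : differentiable (cst 0 : R^o -> C) 0 by exact: differentiable_cst.
pose w (t : R^o) := (0, (G (l t)).2) : C * E.
have wd : differentiable w 0 by exact: differentiable_pair.
have w0 : w 0 = (0, x) by rewrite /w l0 Gx.
have Fdw : differentiable F (w 0) by rewrite w0.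
have dw : 'd w 0 1 = (0, ('d G x v).2) :> C * E.
  have E2 := congr1 (fun D : R^o -> C * E => D 1) (diff_pair dz G2d).
  apply: (etrans E2).
  have E3 : 'd (cst 0 : R^o -> C) 0 1 = 0.
    exact: (congr1 (fun D : R^o -> C => D 1) (diff_cst _ _)).
  have E4 : 'd (fun t : R^o => (G (l t)).2) 0 1 = ('d G x v).2.
    have E1 := chain_diff (1 : R^o) Gld (sd _); rewrite diff_lin// in E1.
    apply: (etrans E1).
    have E5 := chain_diff (1 : R^o) ld Gdl.
    by rewrite lE in E5; rewrite E5 /= scale0r addr0.
  exact: (congr2 pair E3 E4).
have gd : differentiable (F \o w) 0 by exact: differentiable_comp.
have gE : 'd (F \o w) 0 1 = v.
  have E1 := chain_diff (1 : R^o) wd Fdw; rewrite w0 dw in E1.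
  apply: (etrans E1); rewrite -[RHS]FG; congr ('d F (0, x) _).
  by rewrite [RHS]surjective_pairing dG1.
have g0 : (F \o w) 0 = x by rewrite /= w0.
have lc : l t @[t --> (0 : R^o)] --> x.
  by rewrite -l0; exact: differentiable_continuous.
have wc : w t @[t --> (0 : R^o)] --> ((0 : C), x).
  by rewrite -w0; exact: differentiable_continuous.
have disc0 : disc (0 : C) by rewrite /disc/= /cmod/= expr0n/= addr0 sqrtr0 ler01.
rewrite -gE; apply: (tangent_curve Vm ac cx Kx g0 gd); apply: near_right.
apply: (@filterS2 _ (nbhs (0 : R)) _ _ _ (fun t : R => K (cinv c ((F \o w) t))) _ (lc _ nG) (wc _ nF)).
move=> t [_ cGt KGt _] /(_ disc0 KGt cGt) [_ _ + _] => /(_ erefl) /=.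
by rewrite /w => ->.
Qed.

(** Take the velocity of the ray [t |-> F (t z, x)], for [t >= 0].  Its image by
    [G1] is [t z], whose velocity [z] is not zero, so [dh v] is not zero; and
    [dh v] is a multiple of [z] since [h] is one along the ray. *)
Theorem page_radial z : circle z ->
  exists2 v, tangent (page K theta z) c x v & cdot z (dfun h c x v) != 0.
Proof.
move=> zc; have cc := atlas_chart Vm ac.
have [G [F [[Gd Fd Gx Fx] nG nF]]] := binding_charts ac cx Kx.
pose y (t : R^o) : C := t *: z.
have [yd yE] : differentiable y 0 /\ 'd y 0 1 = z.
  have [ld lE] := line_diff (0 : C) z.
  have -> : y = (fun t : R^o => 0 + t *: z) by apply/funext => t; rewrite add0r.
  by [].
have ud : differentiable (cst x : R^o -> E) 0 by exact: differentiable_cst.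
pose w (t : R^o) : C * E := (y t, x).
have wd : differentiable w 0 by exact: differentiable_pair.
have w0 : w 0 = (0, x) by rewrite /w /y scale0r.
have Fw : differentiable F (w 0) by rewrite w0.
have gd : differentiable (F \o w) 0 by exact: differentiable_comp.
have g0 : (F \o w) 0 = x by rewrite /= w0.
set v := 'd (F \o w) 0 1.
have z0 : z != 0 by rewrite -cdotzz_eq0 circle_cdot// oner_eq0.
have wc : w t @[t --> (0 : R^o)] --> ((0 : C), x).
  by rewrite -w0; exact: differentiable_continuous.
pose P (t : R) := [/\ G (F (w t)) = w t, ~ K (cinv c (F (w t))) & theta (cinv c (F (w t))) = z].
have nP : \forall t \near (0 : R)^'+, P t.
  have n1 : \forall t \near (0 : R)^'+, t <= 1 by exact: nbhs_right_le.
  have n0 : \forall t \near (0 : R)^'+, 0 < t by exact: nbhs_right_gt.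
  have nw := near_right (wc _ nF).
  apply: (@filterS3 _ _ _ _ _ _ P _ n0 n1 nw) => t t0 t1 H.
  have yt : cmod (y t) = t.
    by rewrite /y cmodE cdotZl cdotZr circle_cdot// mulr1 -expr2 sqrtr_sqr gtr0_norm.
  have dt : disc (w t).1 by rewrite /disc/= yt.
  have [_ GF _] := H dt Kx cx.
  have y0 : (w t).1 != 0 by rewrite /w/= /y scaler_eq0 negb_or gt_eqF.
  move=> /(_ y0) [KF tF]; split => //; rewrite tF /w/= yt /y scalerA mulVf ?scale1r//.
  by rewrite gt_eqF.
have tv : tangent (page K theta z) c x v.
  apply: (tangent_curve Vm ac cx _ g0 gd); first by left.
  by apply: (@filterS _ _ _ _ (fun t => page K theta z (cinv c ((F \o w) t))) _ nP) => t [_ KF tF]; right.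
exists v => //.
pose G1 y := (G y).1.
have fc : continuous (fst : C * E -> C) by move=> ?; exact: cvg_fst.
have fd u : differentiable (fst : C * E -> C) u by exact: linear_differentiable.
have G1d : differentiable G1 x by exact: (@differentiable_comp _ _ _ _ G (fst : C * E -> C)).
have G10 : G1 x = 0 by rewrite /G1 Gx.
have hd := h_diff Vm DM ac cx.
have G1d' : differentiable G1 ((F \o w) 0) by rewrite g0.
have hd' : differentiable (h \o cinv c) ((F \o w) 0) by rewrite g0.
have dG1 : 'd G1 x v = z.
  pose D (t : R^o) := G1 ((F \o w) t) - y t.
  have Dd : differentiable D 0.
    by apply: differentiableB => //; exact: (@differentiable_comp _ _ _ _ (F \o w) G1).
  have E1 : 'd D 0 1 = 'd G1 x v - z.
    have GFd : differentiable (G1 \o (F \o w)) 0 by exact: differentiable_comp.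
    have := congr1 (fun D : R^o -> C => D 1) (diffB GFd yd) => E1.
    apply: (etrans E1); congr (_ - _) => //.
    by have := chain_diff (1 : R^o) gd G1d'; rewrite g0.
  have E2 : 'd D 0 1 = 0.
    apply: plane_one_sided => //; first by rewrite /D g0 G10 /y scale0r subrr.
    by apply: (@filterS _ _ _ _ (fun t => D t = 0) _ nP) => t [GF _ _]; rewrite /D /G1/= GF subrr.
  by apply/eqP; rewrite -subr_eq0 -E1 E2.
have hv0 : dfun h c x v != 0.
  apply: contraNneq z0 => hv; rewrite -dG1 (diff_eq0_of_cdot_ge0 G1d G10 _ hv)//.
  by apply: filterS nG => u [].
have cz : cdet z (dfun h c x v) = 0.
  have Hd : differentiable ((h \o cinv c) \o (F \o w)) 0 by exact: differentiable_comp.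
  have Dd := differentiable_cdetl z Hd.
  have E1 : 'd (fun t : R^o => cdet z (h (cinv c ((F \o w) t))) : R^o) 0 1 = cdet z (dfun h c x v).
    have := diff_cdetl z (1 : R^o) Hd => E1; apply: (etrans E1); congr (cdet z _).
    by have := chain_diff (1 : R^o) gd hd'; rewrite g0.
  apply: (etrans (esym E1)); apply: one_sided0 => //.
  - by rewrite g0 hx0 /cdet !mulr0 subrr.
  - apply: (@filterS _ _ _ _ (fun t => cdet z (h (cinv c ((F \o w) t))) = 0) _ nP) => t [_ KF tF].
    by rewrite (h_theta DM KF) tF cdetZr cdetzz mulr0.
by apply: contraNneq hv0 => hz; apply/eqP; exact: (cdot_cdet0 z0).
Qed.

End AtPoint.
End Binding.

(** * The exterior derivative *)

Section Forms.
Context {R : realType} {d : nat}.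
Local Notation E := 'rV[R]_d.
Variable V : @atlased R E.
Hypothesis Vm : manifold V.
Implicit Types (c e : chart E V) (p q : V) (a b : form1 V) (F : V -> R) (U : set V).

Local Notation dR F := (dfun (F : V -> R^o)).

Lemma dfun_linfun1 F c x : linfun1 (dR F c x).
Proof. by move=> t v w; exact: (dfun_linear (F : V -> R^o)). Qed.

Lemma form_linfun1 U a c x : smooth_form U a -> atlas V c -> cimg c x -> U (cinv c x) ->
  linfun1 (a c x).
Proof. by case=> al _ _ ac cx Ux t v w; exact: al. Qed.

Lemma form_diff U a c x v : open U -> smooth_form U a -> atlas V c -> cimg c x ->
  U (cinv c x) -> differentiable (fun y => a c y v : R^o) x.
Proof. by move=> oU [_ as_ _] ac cx Ux; have [fd _] := as_ c v ac 1; exact: fd. Qed.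

Lemma extd_diff U a c x v w : open U -> smooth_form U a -> atlas V c -> cimg c x ->
  U (cinv c x) ->
  extd a c x v w = 'd (fun y => a c y w : R^o) x v - 'd (fun y => a c y v : R^o) x w.
Proof.
by move=> oU sa ac cx Ux; rewrite /extd !deriveE//; exact: (form_diff _ oU sa).
Qed.

Lemma extdN a c x v w : extd a c x v w = - extd a c x w v.
Proof. by rewrite /extd opprB. Qed.

Lemma near_dom U c x : open U -> atlas V c -> cimg c x -> U (cinv c x) ->
  \forall y \near x, cimg c y /\ U (cinv c y).
Proof.
move=> oU ac cx Ux; apply: open_nbhs_nbhs; split; last by split.
exact: (open_chart_pre (atlas_chart Vm ac) oU).
Qed.

Lemma sub_combination (t A Au Av B Bu Bv : R) : A = t * Au + Av -> B = t * Bu + Bv ->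
  A - B = t * (Au - Bu) + (Av - Bv).
Proof. by move=> -> ->; ring. Qed.

Lemma extd_linl U a c x w : open U -> smooth_form U a -> atlas V c -> cimg c x ->
  U (cinv c x) -> linfun1 (fun v => extd a c x v w).
Proof.
move=> oU sa ac cx Ux t u v.
have D z := form_diff z oU sa ac cx Ux.
have E1 : 'd (fun y => a c y (t *: u + v) : R^o) x w =
    t * 'd (fun y => a c y u : R^o) x w + 'd (fun y => a c y v : R^o) x w.
  have Du := differentiableZ t (D u).
  have E2 : 'd (fun y => a c y (t *: u + v) : R^o) x w =
      'd ((t *: (fun y => a c y u : R^o)) + (fun y => a c y v : R^o)) x w.
    apply: diff_near; last exact: differentiableD.
    apply: filterS (near_dom oU ac cx Ux) => y [cy Uy].
    by rewrite (form_linfun1 sa ac cy Uy).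
  apply: (etrans E2).
  have E3 := congr1 (fun D : E -> R^o => D w) (diffD Du (D v)).
  apply: (etrans E3).
  have E4 := congr1 (fun D : E -> R^o => D w) (diffZ t (D u)).
  exact: (congr1 (fun s : R => s + _) E4).
have L : 'd (fun y => a c y w : R^o) x (t *: u + v) =
    t * 'd (fun y => a c y w : R^o) x u + 'd (fun y => a c y w : R^o) x v.
  exact: (linearP ('d (fun y => a c y w : R^o) x) t u v).
have X1 := extd_diff (t *: u + v) w oU sa ac cx Ux.
have X2 := extd_diff u w oU sa ac cx Ux; have X3 := extd_diff v w oU sa ac cx Ux.
apply: (etrans X1); apply: (etrans (sub_combination L E1)).
exact: (congr2 (fun p q : R => t * p + q) (esym X2) (esym X3)).
Qed.

Lemma extd_linr U a c x w : open U -> smooth_form U a -> atlas V c -> cimg c x ->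
  U (cinv c x) -> linfun1 (extd a c x w).
Proof.
move=> oU sa ac cx Ux t u v; rewrite extdN (extd_linl _ oU sa)// [in RHS]extdN.
by rewrite [extd a c x w v]extdN mulrN opprD.
Qed.

Lemma extd_near a b c x v w :
  (\forall y \near x, forall u, a c y u = b c y u) -> extd a c x v w = extd b c x v w.
Proof.
move=> ab; rewrite /extd.
have E1 := @near_eq_derive _ _ _ (fun y => a c y w : R^o) (fun y => b c y w : R^o) x v.
have E2 := @near_eq_derive _ _ _ (fun y => a c y v : R^o) (fun y => b c y v : R^o) x w.
by rewrite E1 ?E2//; apply: filterS ab => y.
Qed.

Lemma leibniz_rearrange (F A B dFv dFw aw av : R) :
  F * A + aw * dFv - (F * B + av * dFw) = F * (A - B) + (dFv * aw - dFw * av).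
Proof. ring. Qed.

(** The Leibniz formula [d(F a) = F da + dF /\ a]. *)
Lemma extd_scalef U F a c x v w : open U -> smooth_form U a -> atlas V c -> cimg c x ->
  U (cinv c x) -> differentiable ((F : V -> R^o) \o cinv c) x ->
  extd (scalef F a) c x v w =
  F (cinv c x) * extd a c x v w + (dR F c x v * a c x w - dR F c x w * a c x v).
Proof.
move=> oU sa ac cx Ux Fd.
have D z := form_diff z oU sa ac cx Ux.
have E1 z := differentiable_mul Fd (D z).
have E2 z u := diff_mul u Fd (D z).
rewrite (extd_diff _ _ oU sa ac cx Ux).
have -> : extd (scalef F a) c x v w =
  'd (fun y => ((F : V -> R^o) \o cinv c) y * a c y w : R^o) x v -
  'd (fun y => ((F : V -> R^o) \o cinv c) y * a c y v : R^o) x w.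
  exact: (congr2 (fun s t : R => s - t) (deriveE v (E1 w)) (deriveE w (E1 v))).
apply: (etrans (congr2 (fun s t : R => s - t) (E2 w v) (E2 v w))).
exact: leibniz_rearrange.
Qed.

(** Coordinates of the transition maps, to which scalar calculus applies. *)
Lemma trans_entry c e k : atlas V c -> atlas V e ->
  Cinf [set x | cimg c x /\ cdom e (cinv c x)]
    (fun y => entry k (cmap e (cinv c y)) : R^o).
Proof.
move=> ac ae m; have cc := atlas_chart Vm ac.
have oW := open_chart_pre cc (open_cdom (atlas_chart Vm ae)).
exact: (Ck_lin oW (@entry_continuous _ _ k) (trans_Cinf Vm ac ae m)).
Qed.

Lemma dfun_entry c e x v k : atlas V c -> atlas V e -> cimg c x -> cdom e (cinv c x) ->
  dfun (cmap e) c x v ord0 k = 'D_v (fun y => entry k (cmap e (cinv c y)) : R^o) x.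
Proof.
move=> ac ae cx ex; have dt := trans_diff Vm ac ae cx ex.
have [kd _] := trans_entry k ac ae 1; have kdx := kd _ (conj cx ex).
rewrite deriveE//.
have ed : differentiable (entry k : E -> R^o) ((cmap e \o cinv c) x).
  by apply: linear_differentiable; exact: entry_continuous.
have := congr1 (fun D : E -> R^o => D v) (diff_comp dt ed) => E1.
apply/esym; apply: (etrans E1).
have ec := @entry_continuous R d k.
by rewrite /= diff_lin.
Qed.

Lemma sum_leibniz_cancel (I : finType) (A dAv dAw Pv Pw Q Q' : I -> R) :
  (forall k, Q k = Q' k) ->
  \sum_k (A k * Q k + Pw k * dAv k) - \sum_k (A k * Q' k + Pv k * dAw k) =
  \sum_k (Pw k * dAv k) - \sum_k (Pv k * dAw k).
Proof.
move=> QQ; rewrite !big_split/=.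
by under eq_bigr do rewrite QQ; rewrite opprD addrACA subrr add0r.
Qed.

(** Writing the form in the chart [c] as a sum of [A k (phi) D_u (f k)], where the
    [f k] are the coordinates of the transition map [phi], the second derivatives
    of the [f k] cancel by [derive_comm]. *)
Theorem extd_trans U a c e x v w : open U -> smooth_form U a ->
  atlas V c -> atlas V e -> cimg c x -> cdom e (cinv c x) -> U (cinv c x) ->
  extd a c x v w =
  extd a e (cmap e (cinv c x)) (dfun (cmap e) c x v) (dfun (cmap e) c x w).
Proof.
move=> oU sa ac ae cx ex Ux.
have cc := atlas_chart Vm ac; have ce := atlas_chart Vm ae.
set x' := cmap e (cinv c x).
have ex' : cimg e x' by exact: chart_img.
have Ux' : U (cinv e x') by rewrite /x' (chartK ce).
pose A k y := a e y (delta_mx ord0 k) : R^o.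
pose f k y := entry k (cmap e (cinv c y)) : R^o.
pose phi := cmap e \o cinv c.
have dphi : differentiable phi x by exact: trans_diff.
have Ad k : differentiable (A k) (phi x) by exact: (form_diff _ oU sa).
have Apd k : differentiable (A k \o phi) x by exact: differentiable_comp.
have fC k : Ck 2 [set x | cimg c x /\ cdom e (cinv c x)] (f k).
  exact: (trans_entry k ac ae 2).
have fDd k u : differentiable ('D_u (f k)) x.
  by have [_ fD] := fC k; have [fDd _] := fD u; exact: fDd.
have aE u : \forall y \near x, \sum_k (A k \o phi) y * 'D_u (f k) y = a c y u.
  have nd := near_dom (openI oU (open_cdom ce)) ac cx (conj Ux ex).
  apply: filterS nd => y [cy [Uy ey]].
  have [_ _ tr] := sa; rewrite (tr c e y u ac ae cy Uy ey).
  have Uy' : U (cinv e (cmap e (cinv c y))) by rewrite (chartK ce).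
  rewrite (linfun1_delta _ (form_linfun1 sa ae (chart_img ce ey) Uy')).
  by apply: eq_bigr => k _; rewrite (dfun_entry _ _ ac ae cy ey) mulrC.
pose S u y := \sum_k (A k \o phi) y * 'D_u (f k) y : R^o.
have Dsum u z : 'D_z (S u) x =
    \sum_k (A k x' * 'D_z ('D_u (f k)) x + 'D_u (f k) x * 'd (A k) x' (dfun (cmap e) c x z)).
  have T k := differentiable_mul (Apd k) (fDd k u).
  have -> : S u = \sum_k (fun y => (A k \o phi) y * 'D_u (f k) y : R^o).
    by apply/funext => y; rewrite fct_sumE.
  rewrite derive_sum; last by move=> k; apply: diff_derivable; exact: T.
  apply: eq_bigr => k _; rewrite deriveE//.
  apply: (etrans (diff_mul z (Apd k) (fDd k u))).
  have X1 := deriveE z (fDd k u).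
  have X2 := congr1 (fun D : E -> R^o => D z) (diff_comp dphi (Ad k)).
  exact: (congr2 (fun p q : R => A k x' * p + 'D_u (f k) x * q) (esym X1) X2).
have -> : extd a c x v w = 'D_v (S w) x - 'D_w (S v) x.
  rewrite /extd; congr (_ - _); apply: near_eq_derive.
    by apply: filterS (aE w) => y /esym.
  by apply: filterS (aE v) => y /esym.
rewrite !Dsum sum_leibniz_cancel; last first.
  move=> k; apply: (@derive_comm _ _ (f k) _ x w v _ _ (fC k)) => //.
  exact: (open_chart_pre cc (open_cdom ce)).
have Dlin u z : 'd (fun y => a e y (dfun (cmap e) c x u) : R^o) x' z =
    \sum_k 'D_u (f k) x * 'd (A k) x' z.
  pose S' y := \sum_k 'D_u (f k) x * A k y : R^o.
  have E1 : 'd (fun y => a e y (dfun (cmap e) c x u) : R^o) x' z = 'd S' x' z.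
    apply: diff_near; last first.
      have -> : S' = \sum_k ('D_u (f k) x *: A k) by apply/funext => y; rewrite fct_sumE.
      by apply: differentiable_sum => k; apply: differentiableZ; exact: Ad.
    apply: filterS (near_dom oU ae ex' Ux') => y [cy Uy].
    rewrite (linfun1_delta _ (form_linfun1 sa ae cy Uy)).
    by apply: eq_bigr => k _; rewrite (dfun_entry _ _ ac ae cx ex).
  apply: (etrans E1).
  have -> : S' = \sum_k ('D_u (f k) x *: A k) by apply/funext => y; rewrite fct_sumE.
  have Td k : differentiable ('D_u (f k) x *: A k) x' by apply: differentiableZ; exact: Ad.
  rewrite -deriveE; last by apply: differentiable_sum.
  rewrite derive_sum; last by move=> k; exact: diff_derivable.
  apply: eq_bigr => k _; rewrite deriveE//.
  exact: (congr1 (fun D : E -> R^o => D z) (diffZ _ (Ad k))).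
apply/esym.
apply: (etrans (extd_diff (dfun (cmap e) c x v) (dfun (cmap e) c x w) oU sa ae ex' Ux')).
exact: (congr2 (fun p q : R => p - q) (Dlin w _) (Dlin v _)).
Qed.

End Forms.

(** * Linear algebra of the Liouville vector *)

Section Contraction.
Context {R : realType} {d : nat}.
Local Notation E := 'rV[R]_d.
Implicit Types (w : E -> E -> R) (b t g : E -> R) (Y v : E).

Definition bilin2 w := (forall v, linfun1 (w v)) /\ (forall v, linfun1 (w ^~ v)).

(** The kernel of [t] plays the part of the tangent space of a page. *)
Definition nondeg t w := forall v, t v = 0 -> v != 0 -> exists2 v', t v' = 0 & w v v' != 0.

(** For [t] an equation of the page, [w = d a0] and [b = a0], this characterizes the
    Liouville vector. *)
Definition contracts t w b Y := t Y = 0 /\ forall v, t v = 0 -> w Y v = b v.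

Lemma contracts_uniq t w b Y Y' : linfun1 t -> bilin2 w -> nondeg t w ->
  contracts t w b Y -> contracts t w b Y' -> Y = Y'.
Proof.
move=> tl [wr wl] nd [tY bY] [tY' bY'].
apply/eqP; rewrite -subr_eq0; apply/negPn/negP => YY.
have t0 : t (Y - Y') = 0 by rewrite linfun1_D// linfun1_N// tY tY' subrr.
have [v tv] := nd _ t0 YY.
have -> : w (Y - Y') v = 0; last by rewrite eqxx.
by rewrite (linfun1_D _ _ (wl v)) (linfun1_N _ (wl v)) bY// bY'// subrr.
Qed.

(** The contraction of [f w + g /\ b] with [Y] is [(f + g Y) b], so [Y] is in the
    kernel if [f + g Y = 0] (and if [Y = 0], then [f + g Y = f]).  Otherwise a
    vector [v] in the kernel satisfies [b v = 0], hence [f v + (g v) Y] is in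
    the kernel of [w] and vanishes; applying [g] gives [(f + g Y) g v = 0], so
    [g v = 0] and [v = 0]. *)
Lemma nondeg_rescale t w b g Y (f : R) :
  linfun1 t -> linfun1 b -> linfun1 g -> bilin2 w -> (forall u v, w u v = - w v u) ->
  nondeg t w -> contracts t w b Y -> f != 0 ->
  nondeg t (fun u v => f * w u v + (g u * b v - g v * b u)) <-> f + g Y != 0.
Proof.
move=> tl bl gl [wr wl] wN nd [tY bY] f0.
have wYY : w Y Y = 0.
  by have /eqP := wN Y Y; rewrite -addr_eq0 -mulr2n mulrn_eq0 => /eqP.
have bYY : b Y = 0 by rewrite -bY.
have key v : t v = 0 ->
    f * w Y v + (g Y * b v - g v * b Y) = (f + g Y) * b v.
  by move=> tv; rewrite bY// bYY mulr0 subr0 mulrDl.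
split.
  move=> nd'; apply/negP => /eqP s0.
  have [Y0|Y0] := eqVneq Y 0.
    by move: s0; rewrite Y0 linfun1_0// addr0 => /eqP; rewrite (negbTE f0).
  by have [v tv] := nd' _ tY Y0; rewrite key// s0 mul0r eqxx.
move=> s0 v tv v0.
apply: contrapT => nex.
have W0 : forall u, t u = 0 -> f * w v u + (g v * b u - g u * b v) = 0.
  by move=> u tu; apply/eqP/negPn/negP => H; apply: nex; exists u.
have bv : b v = 0.
  have := W0 _ tY; rewrite wN mulrN -opprB -opprD key// => /eqP.
  by rewrite oppr_eq0 mulf_eq0 (negbTE s0) => /eqP.
have fw u : t u = 0 -> w (f *: v + g v *: Y) u = 0.
  move=> tu; rewrite (linfun1_D _ _ (wl u)) !(linfun1_Z _ _ (wl u)) bY//.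
  by have := W0 _ tu; rewrite bv mulr0 subr0.
have fv : f *: v + g v *: Y = 0.
  apply/eqP/negPn/negP => H.
  have tH : t (f *: v + g v *: Y) = 0.
    by rewrite linfun1_D// !linfun1_Z// tv tY !mulr0 addr0.
  by have [u tu] := nd _ tH H; rewrite fw// eqxx.
have gv : g v = 0.
  have := congr1 g fv; rewrite linfun1_D// !linfun1_Z// linfun1_0//.
  rewrite [g v * g Y]mulrC -mulrDl => /eqP; rewrite mulf_eq0 (negbTE s0).
  by move=> /eqP.
by move: fv; rewrite gv scale0r addr0 => /eqP; rewrite scaler_eq0 (negbTE f0) (negbTE v0).
Qed.

(** The matrix of [w] bordered by the coordinates of [t].  It is invertible when
    [w] is nondegenerate on the kernel of [t] and [t] is not zero, which gives a
    formula for the contracting vector without a choice of a basis of the kernel,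
    whence its continuous dependence on the data. *)
Definition bordered t w : 'M[R]_(d + 1) :=
  block_mx (\matrix_(i, j) w (delta_mx ord0 i) (delta_mx ord0 j))
    (\matrix_(i < d, j < 1) t (delta_mx ord0 i))
    (\matrix_(i < 1, j < d) t (delta_mx ord0 j)) 0.

Lemma bordered_ul t w i j : bordered t w (lshift 1 i) (lshift 1 j) =
  w (delta_mx ord0 i) (delta_mx ord0 j).
Proof. by rewrite block_mxEul mxE. Qed.

Lemma bordered_ur t w i j : bordered t w (lshift 1 i) (rshift d j) = t (delta_mx ord0 i).
Proof. by rewrite block_mxEur mxE. Qed.

Lemma bordered_dl t w i j : bordered t w (rshift d i) (lshift 1 j) = t (delta_mx ord0 j).
Proof. by rewrite block_mxEdl mxE. Qed.

Lemma bordered_dr t w i j : bordered t w (rshift d i) (rshift d j) = 0.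
Proof. by rewrite block_mxEdr mxE. Qed.

Definition border_rhs b : 'rV[R]_(d + 1) := row_mx (\row_j b (delta_mx ord0 j)) 0.

Lemma border_rhs_l b j : border_rhs b ord0 (lshift 1 j) = b (delta_mx ord0 j).
Proof. by rewrite row_mxEl mxE. Qed.

Lemma border_rhs_r b j : border_rhs b ord0 (rshift d j) = 0.
Proof. by rewrite row_mxEr mxE. Qed.

Definition contraction_vec t w b : E := lsubmx (border_rhs b *m invmx (bordered t w)).

Lemma contraction_vecE t w b k : contraction_vec t w b ord0 k =
  \sum_j border_rhs b ord0 j * invmx (bordered t w) j (lshift 1 k).
Proof. by rewrite mxE mxE. Qed.

Lemma bordered_mul t w Y (s : 'M[R]_1) : linfun1 t -> bilin2 w ->
  row_mx Y s *m bordered t w =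
  row_mx (\row_j (w Y (delta_mx ord0 j) + s ord0 ord0 * t (delta_mx ord0 j))) (t Y)%:M.
Proof.
move=> tl [wr wl]; rewrite mul_row_block; congr row_mx.
  apply/rowP => j; rewrite !mxE big_ord1 mxE; congr (_ + _).
  by rewrite (linfun1_delta Y (wl _)); apply: eq_bigr => i _; rewrite !mxE.
rewrite mulmx0 addr0; apply/matrixP => i j; rewrite !mxE !ord1 eqxx mulr1n.
by rewrite (linfun1_delta Y tl); apply: eq_bigr => k _; rewrite !mxE.
Qed.

Lemma bordered_unit t w : linfun1 t -> bilin2 w -> nondeg t w ->
  (exists v, t v != 0) -> bordered t w \in unitmx.
Proof.
move=> tl wb nd [v0 tv0]; rewrite -row_free_unit; apply: inj_row_free => u.
rewrite -[u]hsubmxK bordered_mul//; set Y := lsubmx u; set s := rsubmx u.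
rewrite -[X in _ = X -> _]row_mx0 => /eq_row_mx[wY tY].
have tY0 : t Y = 0 by have := congr1 (fun A : 'M[R]_(1, 1) => A ord0 ord0) tY; rewrite !mxE eqxx mulr1n.
have wE v : w Y v + s ord0 ord0 * t v = 0.
  have [wr wl] := wb.
  rewrite (linfun1_delta v (wr Y)) (linfun1_delta v tl) mulr_sumr -big_split/= big1// => k _.
  have := congr1 (fun A : 'rV[R]_d => A ord0 k) wY; rewrite !mxE => H.
  by rewrite mulrCA -mulrDr H mulr0.
(* the row vector (Y, s) in the kernel of the matrix encodes w Y + s t = 0 and t Y = 0 *)
have Y0 : Y = 0.
  apply/eqP/negPn/negP => Y0; have [v tv] := nd _ tY0 Y0.
  by have := wE v; rewrite tv mulr0 addr0 => ->; rewrite eqxx.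
have s0 : s = 0.
  apply/matrixP => i j; rewrite !ord1 [RHS]mxE; have := wE v0.
  have [wr wl] := wb; rewrite Y0 (linfun1_0 (wl v0)) add0r => /eqP.
  by rewrite mulf_eq0 (negbTE tv0) orbF => /eqP.
by rewrite Y0 s0 row_mx0.
Qed.

Lemma contractionP t w b : linfun1 t -> linfun1 b -> bilin2 w -> nondeg t w ->
  (exists v, t v != 0) -> contracts t w b (contraction_vec t w b).
Proof.
move=> tl bl wb nd t0; have [wr wl] := wb.
have U := bordered_unit tl wb nd t0.
have := mulmxKV U (border_rhs b).
rewrite /contraction_vec; set u := border_rhs b *m invmx _; rewrite -{1}[u]hsubmxK bordered_mul//.
set Y := lsubmx u; set s := rsubmx u.
move=> /eq_row_mx[wY tY].
have tY0 : t Y = 0 by have := congr1 (fun A : 'M[R]_(1, 1) => A ord0 ord0) tY; rewrite !mxE eqxx mulr1n.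
split => // v tv.
rewrite -[LHS]addr0 -[X in _ + X](mulr0 (s ord0 ord0)) -tv.
rewrite (linfun1_delta v (wr Y)) (linfun1_delta v tl) (linfun1_delta v bl) mulr_sumr -big_split/=.
apply: eq_bigr => k _.
have := congr1 (fun A : 'rV[R]_d => A ord0 k) wY; rewrite !mxE => H.
by rewrite mulrCA -mulrDr H.
Qed.

End Contraction.

Section MatrixContinuity.
Context {R : realType} {T : Type} {F : set_system T} {FF : Filter F}.

Lemma cvg_fsum (I : Type) (r : seq I) (f : I -> T -> R) (l : I -> R) :
  (forall i, f i t @[t --> F] --> l i) ->
  (\sum_(i <- r) f i t) @[t --> F] --> \sum_(i <- r) l i.
Proof.
move=> fl; elim: r => [|i r IH].
  by under eq_fun do rewrite big_nil; rewrite big_nil; exact: cvg_cst.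
by under eq_fun do rewrite big_cons; rewrite big_cons; exact: cvgD (fl i) IH.
Qed.

Lemma cvg_fprod (I : Type) (r : seq I) (f : I -> T -> R) (l : I -> R) :
  (forall i, f i t @[t --> F] --> l i) ->
  (\prod_(i <- r) f i t) @[t --> F] --> \prod_(i <- r) l i.
Proof.
move=> fl; elim: r => [|i r IH].
  by under eq_fun do rewrite big_nil; rewrite big_nil; exact: cvg_cst.
by under eq_fun do rewrite big_cons; rewrite big_cons; exact: cvgM (fl i) IH.
Qed.

Lemma cvg_det n (A : T -> 'M[R]_n) (L : 'M[R]_n) :
  (forall i j, A t i j @[t --> F] --> L i j) -> \det (A t) @[t --> F] --> \det L.
Proof.
move=> AL; rewrite /determinant; apply: cvg_fsum => s.
by apply: cvgM; [exact: cvg_cst|exact: cvg_fprod].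
Qed.

Lemma cvg_adj n (A : T -> 'M[R]_n) (L : 'M[R]_n) i j :
  (forall i j, A t i j @[t --> F] --> L i j) -> (\adj (A t)) i j @[t --> F] --> (\adj L) i j.
Proof.
move=> AL; rewrite mxE /cofactor; under eq_fun do rewrite mxE.
apply: cvgM; first exact: cvg_cst.
by apply: cvg_det => k l; rewrite !mxE; under eq_fun do rewrite !mxE; exact: AL.
Qed.

(** By Cramer's formula. *)
Lemma cvg_invmx n (A : T -> 'M[R]_n) (L : 'M[R]_n) i j : L \in unitmx ->
  (forall i j, A t i j @[t --> F] --> L i j) -> (invmx (A t)) i j @[t --> F] --> (invmx L) i j.
Proof.
move=> UL AL.
have dL : \det L != 0 by rewrite -unitfE -unitmxE.
have nd : \forall t \near F, \det (A t) != 0 by exact: (cvgr_neq0 _ (cvg_det AL) dL).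
have E : {near F, (fun t => (\det (A t))^-1 * (\adj (A t)) i j) =1 (fun t => (invmx (A t)) i j)}.
  by apply: filterS nd => t dt; rewrite /invmx unitmxE unitfE dt [RHS]mxE.
apply: cvg_trans (near_eq_cvg E) _.
have -> : (invmx L) i j = (\det L)^-1 * (\adj L) i j by rewrite /invmx UL [LHS]mxE.
apply: cvgM; last exact: cvg_adj.
by apply: cvgV => //; exact: cvg_det.
Qed.

End MatrixContinuity.

(** * The Liouville field along the fibres *)

Lemma cvg_const (R : realType) (E : normedModType R) (x : E) (r : R) : r @[_ --> x] --> r.
Proof. exact: cvg_cst. Qed.

Section Liouville.
Context {R : realType} {d : nat}.
Local Notation E := 'rV[R]_d.
Local Notation C := (cplane R).
Variable V : @atlased R E.
Hypothesis Vm : manifold V.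
Variables (K : set V) (theta h : V -> C).
Hypothesis DM : defining_map K theta h.
Hypothesis OB : open_book K theta.
Variable a0 : form1 V.
Hypothesis sa0 : smooth_form setT a0.
Hypothesis nd0 : forall z, circle z -> nondegenerate_on (fibre K theta z) (extd a0).
Implicit Types (c e : chart E V) (p q : V) (z : C) (F : V -> R).

(** The 1-form whose kernel is the tangent space of the page, off the binding. *)
Definition page_eq c x (v : E) : R := cdet (h (cinv c x)) (dfun h c x v).

(** The values on the binding are arbitrary, which allows [|h|^-1]. *)
Definition smooth_offK F := forall c, atlas V c ->
  Cinf [set x | cimg c x /\ ~ K (cinv c x)] ((F : V -> R^o) \o cinv c).

Local Notation dR F := (dfun (F : V -> R^o)).

Lemma page_eq_lin c x : linfun1 (page_eq c x).
Proof. by move=> t v w; rewrite /page_eq dfun_linear cdetDr cdetZr. Qed.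

Lemma extd0_bilin c x : atlas V c -> cimg c x -> bilin2 (extd a0 c x).
Proof.
move=> ac cx; split=> v.
  exact: (extd_linr Vm v openT sa0 ac cx).
exact: (extd_linl Vm v openT sa0 ac cx).
Qed.

Lemma a0_lin c x : atlas V c -> cimg c x -> linfun1 (a0 c x).
Proof. by move=> ac cx; exact: (form_linfun1 sa0 ac cx). Qed.

Lemma page_tangentP z c x v : circle z -> atlas V c -> cimg c x ->
  fibre K theta z (cinv c x) ->
  tangent (fibre K theta z) c x v <-> page_eq c x v = 0.
Proof. exact: (fibre_tangentP Vm DM OB). Qed.

Section OffK.
Variables (c : chart E V) (x : E).
Hypotheses (ac : atlas V c) (cx : cimg c x) (Kx : ~ K (cinv c x)).

Lemma extd0_nondeg : nondeg (page_eq c x) (extd a0 c x).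
Proof.
move=> v tv v0; have zc := circle_theta DM Kx; have fx := fibre_theta theta Kx.
have [v' tv' w'] := nd0 zc ac cx fx (proj2 (page_tangentP v zc ac cx fx) tv) v0.
by exists v' => //; exact/(page_tangentP v' zc ac cx fx).
Qed.

Lemma page_eq_neq0 : exists v, page_eq c x v != 0.
Proof.
have zc := circle_theta DM Kx; have fx := fibre_theta theta Kx.
exact: (fibre_submersive Vm DM OB zc ac cx fx).
Qed.

End OffK.

(** The Liouville field of [a0] along the fibres, in the chart [c]. *)
Definition liouville c x : E := contraction_vec (page_eq c x) (extd a0 c x) (a0 c x).

Lemma liouvilleP c x : atlas V c -> cimg c x -> ~ K (cinv c x) ->
  contracts (page_eq c x) (extd a0 c x) (a0 c x) (liouville c x).
Proof.
move=> ac cx Kx; apply: contractionP.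
- exact: page_eq_lin.
- exact: a0_lin.
- exact: extd0_bilin.
- exact: extd0_nondeg.
- exact: page_eq_neq0.
Qed.

Section Transition.
Variables (c e : chart E V) (x : E).
Hypotheses (ac : atlas V c) (ae : atlas V e) (cx : cimg c x) (ex : cdom e (cinv c x)).
Let x' := cmap e (cinv c x).

Lemma trans_img : cimg e x'.
Proof. by apply: chart_img ex; exact: atlas_chart. Qed.

Lemma transK : cinv e x' = cinv c x.
Proof. by rewrite /x' (chartK (atlas_chart Vm ae)). Qed.

Lemma page_eq_trans v : page_eq e x' (dfun (cmap e) c x v) = page_eq c x v.
Proof.
have hd : differentiable (h \o cinv e) x' by exact: (h_diff Vm DM ae trans_img).
by rewrite /page_eq transK -(dfun_trans Vm v ac ae cx ex hd).
Qed.

Lemma trans_onto v' : exists v, v' = dfun (cmap e) c x v.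
Proof.
exists (dfun (cmap c) e x' v').
have ce := atlas_chart Vm ae; have cc := atlas_chart Vm ac.
have cx' : cdom c (cinv e x') by rewrite transK; exact: chart_dom.
have := dfun_cmapK Vm v' ae ac trans_img cx'.
by rewrite transK (chartVK cc).
Qed.

(** By uniqueness ([contracts_uniq]), since the data that determine the field do
    not depend on the chart. *)
Lemma liouville_trans : ~ K (cinv c x) ->
  liouville e x' = dfun (cmap e) c x (liouville c x).
Proof.
move=> Kx; have ex' := trans_img.
have Kx' : ~ K (cinv e x') by rewrite transK.
apply: (contracts_uniq (page_eq_lin e x') (extd0_bilin ae ex') (extd0_nondeg ae ex' Kx')
  (liouvilleP ae ex' Kx')).
have [tY bY] := liouvilleP ac cx Kx.
split; first by rewrite page_eq_trans.
move=> v'; have [v ->] := trans_onto v'; rewrite page_eq_trans => tv.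
rewrite -(extd_trans Vm _ _ openT sa0 ac ae cx ex I) bY//.
by have [_ _ tr] := sa0; exact: (tr c e x v ac ae cx I ex).
Qed.

End Transition.

Lemma smooth_offK_diff F c x : smooth_offK F -> atlas V c -> cimg c x -> ~ K (cinv c x) ->
  differentiable ((F : V -> R^o) \o cinv c) x.
Proof. by move=> sF ac cx Kx; have [Fd _] := sF c ac 1; exact: Fd. Qed.

Definition dliouville_chart F c x : R := dR F c x (liouville c x).

Lemma dliouville_chart_trans F c e x : smooth_offK F -> atlas V c -> atlas V e -> cimg c x ->
  cdom e (cinv c x) -> ~ K (cinv c x) -> dliouville_chart F e (cmap e (cinv c x)) = dliouville_chart F c x.
Proof.
move=> sF ac ae cx ex Kx; rewrite /dliouville_chart (liouville_trans ac ae cx ex Kx).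
have Kx' : ~ K (cinv e (cmap e (cinv c x))) by rewrite (transK ae ex).
have Fd := smooth_offK_diff sF ae (trans_img ae ex) Kx'.
by rewrite -(dfun_trans Vm _ ac ae cx ex Fd).
Qed.

Lemma chart_at_ex p : exists c, atlas V c /\ cdom c p.
Proof. by have [_ _ _ /(_ p)[c ac cp] _] := Vm; exists c. Qed.

Definition chart_at p := sval (cid (chart_at_ex p)).

Lemma chart_atP p : atlas V (chart_at p) /\ cdom (chart_at p) p.
Proof. exact: (svalP (cid (chart_at_ex p))). Qed.

(** The derivative along the Liouville field as a function on the manifold, for
    which a chart is chosen at each point. *)
Definition dliouville F p : R := dliouville_chart F (chart_at p) (cmap (chart_at p) p).

Lemma dliouvilleE F c x : smooth_offK F -> atlas V c -> cimg c x -> ~ K (cinv c x) ->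
  dliouville F (cinv c x) = dliouville_chart F c x.
Proof.
move=> sF ac cx Kx; rewrite /dliouville; have [ae ep] := chart_atP (cinv c x).
exact: dliouville_chart_trans.
Qed.

Lemma Ck1_cvgD (U : set E) (f : E -> R^o) x v : open U -> Ck 1 U f -> U x ->
  'd f y v @[y --> x] --> 'd f x v.
Proof.
move=> oU [fd fD] Ux; have := fD v x Ux => fc.
have E1 : {near x, 'D_v f =1 (fun y => 'd f y v)}.
  by apply: near_open oU Ux _ => y Uy; rewrite deriveE//; exact: fd.
have E2 := deriveE v (fd x Ux).
exact: (eq_ind _ (fun l : R^o => 'd f y v @[y --> x] --> l) (cvg_trans (near_eq_cvg E1) fc) _ E2).
Qed.

Lemma dfun_cvg F c x v : smooth_offK F -> atlas V c -> cimg c x -> ~ K (cinv c x) ->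
  dR F c y v @[y --> x] --> dR F c x v.
Proof.
move=> sF ac cx Kx.
have oW := open_chart_pre (atlas_chart Vm ac) (open_notK Vm DM).
exact: (Ck1_cvgD oW (sF c ac 1) (conj cx Kx)).
Qed.

Lemma dh_cvg c x v : atlas V c -> cimg c x -> dfun h c y v @[y --> x] --> dfun h c x v.
Proof.
move=> ac cx; have [hd hD] := h_Cinf Vm DM ac 1.
have := hD v x cx => fc.
have oc := open_cimg (atlas_chart Vm ac).
have E1 : {near x, 'D_v (h \o cinv c) =1 (fun y => dfun h c y v)}.
  by apply: near_open oc cx _ => y Uy; rewrite deriveE//; exact: hd.
have E2 := deriveE v (hd x cx).
exact: (eq_ind _ (fun l : C => dfun h c y v @[y --> x] --> l) (cvg_trans (near_eq_cvg E1) fc) _ E2).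
Qed.

Lemma hc_cvg c x : atlas V c -> cimg c x -> h (cinv c y) @[y --> x] --> h (cinv c x).
Proof. by move=> ac cx; exact: (differentiable_continuous (h_diff Vm DM ac cx)). Qed.

Lemma cvg_cdet (T : Type) (G : set_system T) {FG : Filter G} (f g : T -> C) (l m : C) :
  f t @[t --> G] --> l -> g t @[t --> G] --> m ->
  cdet (f t) (g t) @[t --> G] --> cdet l m.
Proof.
move=> /cvg_plane[f1 f2] /cvg_plane[g1 g2].
by apply: cvgB; apply: cvgM.
Qed.

Lemma page_eq_cvg c x v : atlas V c -> cimg c x -> page_eq c y v @[y --> x] --> page_eq c x v.
Proof. by move=> ac cx; exact: (cvg_cdet (hc_cvg ac cx) (dh_cvg ac cx)). Qed.

Lemma a0_cvg c x v : atlas V c -> cimg c x -> a0 c y v @[y --> x] --> a0 c x v.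
Proof.
by move=> ac cx; exact: (differentiable_continuous (form_diff v openT sa0 ac cx I)).
Qed.

Lemma extd0_cvg c x v w : atlas V c -> cimg c x ->
  extd a0 c y v w @[y --> x] --> extd a0 c x v w.
Proof.
move=> ac cx; have [_ as_ _] := sa0.
have [_ Dw] := as_ c w ac 1; have [_ Dv] := as_ c v ac 1.
have A : 'D_v (fun y => a0 c y w : R^o) y @[y --> x] --> 'D_v (fun y => a0 c y w : R^o) x.
  exact: (Dw v x (conj cx I)).
have B : 'D_w (fun y => a0 c y v : R^o) y @[y --> x] --> 'D_w (fun y => a0 c y v : R^o) x.
  exact: (Dv w x (conj cx I)).
rewrite /extd; exact: (cvgB A B).
Qed.

Lemma cvg_eq_fun (f g : E -> R) x : (forall y, f y = g y) ->
  g y @[y --> x] --> g x -> f y @[y --> x] --> f x.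
Proof. by move=> fg; have -> : f = g by apply/funext. Qed.

(** The field is given by the inverse of a matrix with continuous entries. *)
Lemma liouville_cvg c x k : atlas V c -> cimg c x -> ~ K (cinv c x) ->
  liouville c y ord0 k @[y --> x] --> liouville c x ord0 k.
Proof.
move=> ac cx Kx.
have FF : Filter (nbhs x) by exact: nbhs_filter.
have U : bordered (page_eq c x) (extd a0 c x) \in unitmx.
  apply: bordered_unit; [exact: page_eq_lin|exact: extd0_bilin|exact: extd0_nondeg|exact: page_eq_neq0].
have Bc i j : bordered (page_eq c y) (extd a0 c y) i j @[y --> x] -->
    bordered (page_eq c x) (extd a0 c x) i j.
  case: (split_ordP i) => i' ->; case: (split_ordP j) => j' ->.
  - apply: (cvg_eq_fun (fun y => bordered_ul (page_eq c y) (extd a0 c y) i' j')).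
    exact: extd0_cvg.
  - apply: (cvg_eq_fun (fun y => bordered_ur (page_eq c y) (extd a0 c y) i' j')).
    exact: page_eq_cvg.
  - apply: (cvg_eq_fun (fun y => bordered_dl (page_eq c y) (extd a0 c y) i' j')).
    exact: page_eq_cvg.
  - apply: (cvg_eq_fun (fun y => bordered_dr (page_eq c y) (extd a0 c y) i' j')).
    exact: cvg_const.
have E1 y : liouville c y ord0 k = \sum_j border_rhs (a0 c y) ord0 j *
    invmx (bordered (page_eq c y) (extd a0 c y)) j (lshift 1 k).
  exact: contraction_vecE.
apply: (@cvg_eq_fun (fun y => liouville c y ord0 k) _ x E1).
apply: cvg_fsum => j; apply: cvgM; last exact: cvg_invmx.
case: (split_ordP j) => j' ->.
- apply: (cvg_eq_fun (fun y => border_rhs_l (a0 c y) j')); exact: a0_cvg.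
- apply: (cvg_eq_fun (fun y => border_rhs_r (a0 c y) j')); exact: cvg_const.
Qed.

Lemma dliouville_chart_cvg F c x : smooth_offK F -> atlas V c -> cimg c x -> ~ K (cinv c x) ->
  dliouville_chart F c y @[y --> x] --> dliouville_chart F c x.
Proof.
move=> sF ac cx Kx.
have E1 y : dliouville_chart F c y = \sum_(k < d) liouville c y ord0 k * dR F c y (delta_mx ord0 k).
  exact: (linfun1_delta _ (@dfun_linfun1 _ _ _ F c y)).
have FF : Filter (nbhs x) by exact: nbhs_filter.
apply: (cvg_eq_fun E1).
by apply: cvg_fsum => k; apply: cvgM; [exact: liouville_cvg|exact: dfun_cvg].
Qed.

Lemma dliouville_continuous F p : smooth_offK F -> ~ K p -> {for p, continuous (dliouville F)}.
Proof.
move=> sF Kp; have [c [ac cp]] := chart_at_ex p; have cc := atlas_chart Vm ac.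
have cx := chart_img cc cp.
have Kx : ~ K (cinv c (cmap c p)) by rewrite (chartK cc).
have fE : {near p, (dliouville_chart F c) \o cmap c =1 dliouville F}.
  have nK : \forall q \near p, ~ K q by apply: open_nbhs_nbhs; split; [exact: (open_notK Vm DM)|].
  apply: filterS2 (near_cdom cc cp) nK => q cq Kq.
  have Kq' : ~ K (cinv c (cmap c q)) by rewrite (chartK cc).
  by rewrite /= -(dliouvilleE sF ac (chart_img cc cq) Kq') (chartK cc).
rewrite /prop_for /continuous_at; apply: cvg_trans (near_eq_cvg fE) _.
have -> : dliouville F p = dliouville_chart F c (cmap c p) by rewrite -(dliouvilleE sF ac cx Kx) (chartK cc).
exact: (continuous_comp (cmap_continuous cc cp) (dliouville_chart_cvg sF ac cx Kx)).
Qed.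

(** Apply [nondeg_rescale] at each point, the form [d(F a0)] being given by
    [extd_scalef]. *)
Theorem nondegenerate_rescale F z : circle z -> smooth_offK F ->
  (forall p, ~ K p -> F p != 0) ->
  nondegenerate_on (fibre K theta z) (extd (scalef F a0)) <->
  (forall p, fibre K theta z p -> F p + dliouville F p != 0).
Proof.
move=> zc sF F0.
have key c x : atlas V c -> cimg c x -> fibre K theta z (cinv c x) ->
  (nondeg (page_eq c x) (extd (scalef F a0) c x) <-> F (cinv c x) + dliouville F (cinv c x) != 0).
  move=> ac cx fx; have Kx : ~ K (cinv c x) by case: fx.
  rewrite (dliouvilleE sF ac cx Kx).
  have := nondeg_rescale (page_eq_lin c x) (a0_lin ac cx) (@dfun_linfun1 _ _ _ F c x)
    (extd0_bilin ac cx) (@extdN _ _ _ a0 c x) (extd0_nondeg ac cx Kx)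
    (liouvilleP ac cx Kx) (F0 _ Kx).
  have -> : (fun u v => F (cinv c x) * extd a0 c x u v +
     (dR F c x u * a0 c x v - dR F c x v * a0 c x u)) = extd (scalef F a0) c x.
    apply/funext => u; apply/funext => v.
    exact/esym/(extd_scalef _ _ openT sa0 ac cx I (smooth_offK_diff sF ac cx Kx)).
  exact.
split.
  move=> nd p pz; have [c [ac cp]] := chart_at_ex p; have cc := atlas_chart Vm ac.
  have cx := chart_img cc cp.
  have fx : fibre K theta z (cinv c (cmap c p)) by rewrite (chartK cc).
  have := key _ _ ac cx fx; rewrite (chartK cc)// => -[+ _]; apply => v tv v0.
  have [v' tv' w'] := nd c _ v ac cx fx (proj2 (page_tangentP v zc ac cx fx) tv) v0.
  by exists v' => //; exact/(page_tangentP v' zc ac cx fx).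
move=> H c x v ac cx fx tv v0.
have [_ nd] := key _ _ ac cx fx.
have [v' tv' w'] := nd (H _ fx) v (proj1 (page_tangentP v zc ac cx fx) tv) v0.
by exists v' => //; exact/(page_tangentP v' zc ac cx fx).
Qed.

End Liouville.

(** * The sign of F + Y F *)

Section Positivity.
Context {R : realType} {d : nat}.
Local Notation E := 'rV[R]_d.
Local Notation C := (cplane R).
Variable V : @atlased R E.
Hypothesis Vm : manifold V.
Hypothesis Vc : compact [set: V].
Variables (K : set V) (theta h : V -> C).
Hypothesis DM : defining_map K theta h.
Hypothesis OB : open_book K theta.
Variable a0 : form1 V.
Hypothesis sa0 : smooth_form setT a0.
Hypothesis nd0 : forall z, circle z -> nondegenerate_on (fibre K theta z) (extd a0).
Implicit Types (c e : chart E V) (p q : V) (z : C) (F : V -> R).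
Local Notation smooth_offK := (smooth_offK K).
Local Notation dliouville := (dliouville Vm h a0).

Lemma smooth_offK_continuous F p : smooth_offK F -> ~ K p -> {for p, continuous F}.
Proof.
move=> sF Kp; have [c [ac cp]] := chart_at_ex Vm p; have cc := atlas_chart Vm ac.
have Kx : ~ K (cinv c (cmap c p)) by rewrite (chartK cc).
have Fc := differentiable_continuous (smooth_offK_diff sF ac (chart_img cc cp) Kx).
have fE : {near p, (F \o cinv c) \o cmap c =1 F}.
  by apply: filterS (near_cdom cc cp) => q cq; rewrite /= (chartK cc).
rewrite /prop_for /continuous_at; apply: cvg_trans (near_eq_cvg fE) _.
have := continuous_comp (cmap_continuous cc cp) Fc.
by rewrite /prop_for /continuous_at /= (chartK cc).
Qed.

Lemma page_closed z : circle z -> closed (page K theta z).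
Proof.
move=> zc.
have -> : page K theta z = (fun p => cdet z (h p)) @^-1` [set 0] `&`
    (fun p => cdot z (h p)) @^-1` [set t | 0 <= t].
  apply/seteqP; split=> p; first by move/(pageE DM p zc).
  by move=> pz; exact/(pageE DM p zc).
apply: closedI; apply: closed_comp.
- by move=> p _; exact: (cdet_h_continuous Vm DM).
- exact: closed_eq.
- by move=> p _; exact: (cdot_h_continuous Vm DM).
- exact: closed_ge.
Qed.

Lemma page_compact z : circle z -> compact (page K theta z).
Proof. by move=> zc; apply: subclosed_compact Vc _ => //; exact: page_closed. Qed.

Lemma stretch_continuous F p : smooth_offK F -> ~ K p ->
  {for p, continuous (fun q => F q + dliouville F q)}.
Proof.
move=> sF Kp; apply: cvgD; first exact: smooth_offK_continuous.
exact: (dliouville_continuous DM OB sa0 nd0 sF Kp).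
Qed.

(** Differentiate [F] along a curve in the fibre with velocity [Y]. *)
Lemma dliouville_ge0_at_min F z p : circle z -> smooth_offK F -> fibre K theta z p ->
  (\forall q \near p, fibre K theta z q -> F p <= F q) -> 0 <= dliouville F p.
Proof.
move=> zc sF pz pmin; have Kp : ~ K p by case: pz.
have [c [ac cp]] := chart_at_ex Vm p; have cc := atlas_chart Vm ac.
have cx := chart_img cc cp; have xp := chartK cc cp.
have Kx : ~ K (cinv c (cmap c p)) by rewrite xp.
have [tY _] := liouvilleP Vm DM OB sa0 nd0 ac cx Kx.
set Y := liouville _ _ _ _ in tY.
have tY' : cdet (h p) (dfun h c (cmap c p) Y) = 0 by move: tY; rewrite /page_eq xp.
have [gam [g0 gd gY gz]] := fibre_curve Vm DM OB zc ac cp pz tY'.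
have -> : dliouville F p = dfun (F : V -> R^o) c (cmap c p) Y.
  by rewrite -[in LHS]xp (dliouvilleE Vm DM OB sa0 nd0 sF ac cx Kx).
have Fd : differentiable ((F : V -> R^o) \o cinv c) (gam 0).
  by rewrite g0; exact: (smooth_offK_diff sF ac cx Kx).
have gFd := differentiable_comp gd Fd.
have E1 := chain_diff (1 : R^o) gd Fd; rewrite gY g0 in E1.
have E2 : 'd (- ((F : V -> R^o) \o cinv c \o gam)) 0 1 = - dfun (F : V -> R^o) c (cmap c p) Y.
  have := congr1 (fun D : R^o -> R^o => D 1) (diffN gFd) => E2.
  by apply: (etrans E2); exact: (congr1 (fun s : R => - s) E1).
rewrite -oppr_le0; apply: le_trans (_ : 'd (- ((F : V -> R^o) \o cinv c \o gam)) 0 1 <= 0).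
  by rewrite E2.
apply: one_sided_max; first exact: differentiableN.
apply: near_right.
have nm : \forall y \near cmap c p, fibre K theta z (cinv c y) -> F p <= F (cinv c y).
  apply: (@near_cinv _ _ _ _ cc _ (fun q => fibre K theta z q -> F p <= F q) cx).
  by rewrite xp.
have gc : gam t @[t --> (0 : R^o)] --> cmap c p.
  by rewrite -g0; exact: differentiable_continuous.
apply: (@filterS2 _ (nbhs (0 : R)) _ _ _ (fun t : R =>
  (- ((F : V -> R^o) \o cinv c \o gam)) t <= (- ((F : V -> R^o) \o cinv c \o gam)) 0) _ gz (gc _ nm)).
move=> t zt /(_ zt) Ft; rewrite !fctE /= lerN2 g0 xp; exact: Ft.
Qed.

(** If [F + Y F] is negative somewhere on a fibre, [phi = 1/F] has a maximum on the
    set [N] of the points of the page where [F + Y F < 0] and [phi] is not smaller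
    than at the given point.  This set is compact: it avoids the binding, where
    [phi] vanishes, and it is closed since [F + Y F] has no zero.  At the maximum,
    [F] has a local minimum along the fibre, so [Y F >= 0], which contradicts
    [F + Y F < 0]. *)
Theorem stretch_gt0 F (phi : V -> R) z : circle z -> smooth_offK F ->
  (forall p, ~ K p -> 0 < F p) -> continuous phi ->
  (forall p, ~ K p -> phi p = (F p)^-1) -> (forall p, K p -> phi p = 0) ->
  (forall p, fibre K theta z p -> F p + dliouville F p != 0) ->
  forall p, fibre K theta z p -> 0 < F p + dliouville F p.
Proof.
move=> zc sF F0 phic phiE phiK s0 p0 p0z.
rewrite lt_neqAle eq_sym s0//= leNgt; apply/negP => neg.
have Kp0 : ~ K p0 by case: p0z.
pose s p := F p + dliouville F p.
have phi0 : 0 < phi p0 by rewrite phiE// invr_gt0 F0.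
(* Q avoids the binding *)
pose Q := page K theta z `&` phi @^-1` [set t | phi p0 <= t].
have Qc : closed Q.
  apply: closedI; first exact: page_closed.
  by apply: closed_comp; [move=> q _; exact: phic|exact: closed_ge].
have QK q : Q q -> fibre K theta z q.
  move=> [[Kq|//]] Hq; have {Hq} : phi p0 <= phi q by exact: Hq.
  by rewrite (phiK _ Kq) leNgt phi0.
pose N := Q `&` [set q | s q < 0].
have Nc : closed N.
  rewrite -openC openE => q Nq.
  have [Qq|Qq] := pselect (Q q); last first.
    have : \forall r \near q, (~` Q) r.
      by apply: open_nbhs_nbhs; split => //; exact: closed_openC.
    by apply: filterS => r Qr [].
  have zq := QK _ Qq; have Kq : ~ K q by case: zq.
  have sq : 0 < s q.
    rewrite lt_neqAle eq_sym s0//= leNgt; apply/negP => sq; exact: Nq.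
  have : \forall r \near q, 0 < s r.
    by have := stretch_continuous sF Kq; move/cvgr_gt; apply.
  by apply: filterS => r sr [_ /=]; rewrite ltNge (ltW sr).
have Ncomp : compact N by apply: subclosed_compact Nc Vc _.
have N0 : N !=set0.
  by exists p0; split => //; split; [right|rewrite /=].
have phiN : {within N, continuous phi} by exact: continuous_subspaceT.
(* a maximum of phi on N is a local maximum along the fibre, because s < 0 is an open condition *)
have [p1 /set_mem [Qp1 sp1] p1max] := compact_EVT_max N0 Ncomp phiN.
have p1z := QK _ Qp1; have Kp1 : ~ K p1 by case: p1z.
have : 0 <= dliouville F p1.
  apply: (dliouville_ge0_at_min zc sF p1z).
  have sn : \forall r \near p1, s r < 0.
    by have := stretch_continuous sF Kp1; move/cvgr_lt; apply.
  apply: filterS sn => q sq qz; have Kq : ~ K q by case: qz.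
  have : phi q <= phi p1.
    have [pq|/ltW pq] := leP (phi p0) (phi q).
      by apply: p1max; rewrite inE; split => //; split; [right|].
    by apply: le_trans pq _; case: Qp1.
  by rewrite !phiE// lef_pV2// posrE F0.
move=> LY0; have s1 : 0 < s p1 by rewrite /s ltr_pwDl// F0.
by move: sp1 => /=; rewrite ltNge (ltW s1).
Qed.

End Positivity.

(** * Equations of a contact structure *)

Section Equations.
Context {R : realType} {n : nat}.
Local Notation d := (n.*2.+1).
Local Notation E := 'rV[R]_d.
Variable V : @atlased R E.
Hypothesis Vm : manifold V.
Implicit Types (c e : chart E V) (p q : V) (a b : form1 V) (xi : cohyp V).

Lemma cvolE m a c x (e : seq E) : cvol m a c x e =
  2^-1 ^+ m * alt (vpairs (a c x) (extd a c x)) (seqfun m.*2.+1 e).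
Proof. exact: wedge1_alt. Qed.

Lemma pow2E m a c x (e : seq E) : pow2 m (extd a) c x e =
  2^-1 ^+ m * alt (pairs (extd a c x)) (seqfun m.*2 e).
Proof. exact: wpow_alt. Qed.

Lemma tangentT c x (v : E) : atlas V c -> cimg c x -> tangent [set: V] c x v.
Proof.
move=> ac cx U f oU Ux sf f0; have cc := atlas_chart Vm ac.
have dc : differentiable (cst 0 : E -> R^o) x by exact: differentiable_cst.
apply: (etrans (diff_near v _ dc)).
  have nU : \forall y \near x, U (cinv c y).
    by apply: (@near_cinv _ _ _ _ cc _ U cx); exact: open_nbhs_nbhs.
  by apply: filterS nU => y Uy; rewrite /= f0.
exact: (congr1 (fun D : E -> R^o => D v) (diff_cst _ _)).
Qed.

Lemma contact_neq0 a c x : contact_on setT n a -> atlas V c -> cimg c x ->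
  exists v, a c x v != 0.
Proof.
move=> ca ac cx; apply: contrapT => nex.
have a0 v : a c x v = 0 by apply/eqP/negPn/negP => H; apply: nex; exists v.
pose e := vbasis (fullv : {vspace E}).
have se : size e = n.*2.+1 by rewrite size_tuple dimvf /dim/= mul1n.
have := ca c x e ac cx I se (basis_free (vbasisP _)) (fun v _ => tangentT v ac cx).
rewrite cvolE /alt big1 ?mulr0 ?eqxx// => s _.
by rewrite /vpairs a0 mul0r mulr0.
Qed.

(** Fix [u] with [g u > 0]; for every [v], the vector [v - (g v / g u) u] is in the
    common kernel. *)
Lemma linfun1_proportional (f g : E -> R) : linfun1 f -> linfun1 g ->
  [set v | f v = 0] = [set v | g v = 0] -> [set v | 0 < f v] = [set v | 0 < g v] ->
  (exists v, g v != 0) -> exists2 r, 0 < r & forall v, f v = r * g v.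
Proof.
move=> fl gl kE pE [v0 gv0].
have [u gu] : exists u, 0 < g u.
  have [|H|/eqP] := ltgtP (g v0) 0; last by rewrite (negbTE gv0).
    by exists (- v0); rewrite linfun1_N// oppr_gt0.
  by exists v0.
have fu : 0 < f u by have : [set v | 0 < g v] u by []; rewrite -pE.
exists (f u / g u); first by rewrite divr_gt0.
move=> v; have g0 : g (v - (g v / g u) *: u) = 0.
  by rewrite linfun1_D// linfun1_N// linfun1_Z// divfK ?gt_eqF// subrr.
have : f (v - (g v / g u) *: u) = 0.
  by have : [set v | g v = 0] (v - (g v / g u) *: u) by []; rewrite -kE.
rewrite linfun1_D// linfun1_N// linfun1_Z// => /eqP; rewrite subr_eq0 => /eqP ->.
by rewrite mulrC mulrA mulrAC.
Qed.

(** Equations of the same cooriented hyperplane field are pointwise positively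
    proportional; the factor is smooth since it is locally the quotient of the
    values of the two forms on a constant vector field. *)
Lemma equation_ratio xi a b : equation xi a -> equation xi b ->
  (forall c x, atlas V c -> cimg c x -> exists v, b c x v != 0) ->
  exists f : V -> R, [/\ forall p, 0 < f p,
    forall c x v, atlas V c -> cimg c x -> a c x v = scalef f b c x v &
    forall c, atlas V c -> Cinf (cimg c) ((f : V -> R^o) \o cinv c)].
Proof.
move=> [sa ea] [sb eb] b0.
have ptw c x : atlas V c -> cimg c x -> exists2 r, 0 < r & forall v, a c x v = r * b c x v.
  move=> ac cx; have [ka pa] := ea c x ac cx; have [kb pb] := eb c x ac cx.
  apply: linfun1_proportional.
  - exact: (form_linfun1 sa ac cx I).
  - exact: (form_linfun1 sb ac cx I).
  - by rewrite -ka -kb.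
  - by rewrite -pa -pb.
  - exact: b0.
have ex p : exists r, 0 < r /\ forall c, atlas V c -> cdom c p ->
    forall v, a c (cmap c p) v = r * b c (cmap c p) v.
  have [_ _ _ /(_ p)[e ae ep] _] := Vm; have ce := atlas_chart Vm ae.
  have [r r0 rE] := ptw e _ ae (chart_img ce ep).
  exists r; split => // c ac cp v; have cc := atlas_chart Vm ac.
  have cx := chart_img cc cp.
  have ex : cdom e (cinv c (cmap c p)) by rewrite (chartK cc).
  have [_ _ ta] := sa; have [_ _ tb] := sb.
  rewrite (ta c e _ v ac ae cx I ex) (tb c e _ v ac ae cx I ex) (chartK cc)//.
have [f fP] := choice ex.
have fE c x v : atlas V c -> cimg c x -> a c x v = f (cinv c x) * b c x v.
  move=> ac cx; have cc := atlas_chart Vm ac.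
  have [_ H] := fP (cinv c x).
  by have := H c ac (chart_dom cc cx) v; rewrite (chartVK cc).
exists f; split=> //; first by move=> p; have [] := fP p.
move=> c ac k; have cc := atlas_chart Vm ac; have oc := open_cimg cc.
apply: Ck_local => x cx; have [v0 bv0] := b0 c x ac cx.
have Cf (g : form1 V) : smooth_form setT g -> Ck k (cimg c) (fun y => g c y v0 : R^o).
  by move=> [_ gC _]; apply: Ck_sub (gC c v0 ac k) => y cy; split.
have Ca := Cf _ sa; have Cb := Cf _ sb.
pose W := cimg c `&` [set y | b c y v0 != 0].
have oW : open W.
  rewrite openE => y [cy by0]; apply: filterI; first by apply: open_nbhs_nbhs; split.
  have := Ck_continuous Cb cy => bc.
  exact: (cvgr_neq0 _ bc by0).
exists W, (fun y => a c y v0 * (b c y v0)^-1 : R^o); split => //.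
- by apply: CkM => //; [apply: Ck_sub Ca => y []|apply: CkV => //; [move=> y []|apply: Ck_sub Cb => y []]].
- by move=> y [cy by0]; rewrite (fE c y v0 ac cy)/= mulfK.
Qed.

(** The terms of [(d(f a))^m] that contain [df /\ a] are killed by [a]. *)
Lemma cvol_scalef m f a c x (l : seq E) : smooth_form setT a ->
  differentiable ((f : V -> R^o) \o cinv c) x -> atlas V c -> cimg c x ->
  cvol m (scalef f a) c x l = f (cinv c x) ^+ m.+1 * cvol m a c x l.
Proof.
move=> sa fd ac cx; rewrite !cvolE mulrCA; congr (_ * _).
apply: (alt_vpairs_rescale (b := dfun (f : V -> R^o) c x)) => u v.
exact: (extd_scalef u v openT sa ac cx I fd).
Qed.

Lemma contact_scalef m f a (S : set V) : smooth_form setT a ->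
  (forall c x, atlas V c -> cimg c x -> differentiable ((f : V -> R^o) \o cinv c) x) ->
  (forall p, f p != 0) -> contact_on S m a -> contact_on S m (scalef f a).
Proof.
move=> sa fd f0 ca c x e ac cx Sx se fe te.
rewrite (cvol_scalef m e sa (fd c x ac cx) ac cx); apply: mulf_neq0; last exact: ca.
exact: expf_neq0.
Qed.

Lemma contact_near S m a b : 
  (forall c x v, atlas V c -> cimg c x -> a c x v = b c x v) ->
  contact_on S m b -> contact_on S m a.
Proof.
move=> ab cb c x e ac cx Sx se fe te.
have -> : cvol m a c x e = cvol m b c x e; last exact: cb.
have ab' : a c x = b c x by apply/funext => v; exact: ab.
have dab : extd a c x = extd b c x.
  apply/funext => v; apply/funext => w; apply: extd_near.
  apply: filterS (near_cimg (atlas_chart Vm ac) cx) => y cy u; exact: ab.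
by rewrite !cvolE ab' dab.
Qed.

Lemma smooth_scalef U (f : V -> R) a : open U -> smooth_form U a ->
  (forall c, atlas V c -> Cinf [set x | cimg c x /\ U (cinv c x)] ((f : V -> R^o) \o cinv c)) ->
  smooth_form U (scalef f a).
Proof.
move=> oU [al aC at_] fC; split.
- by move=> c x ac cx Ux t v w; rewrite /scalef al// mulrDr mulrCA.
- move=> c v ac k; have oW := open_chart_pre (atlas_chart Vm ac) oU.
  exact: (CkM oW (fC c ac k) (aC c v ac k)).
- move=> c e x v ac ae cx Ux ex; rewrite /scalef (at_ c e x v)//.
  by rewrite (chartK (atlas_chart Vm ae)).
Qed.

Lemma smooth_form_sub (U W : set V) a : W `<=` U -> smooth_form U a -> smooth_form W a.
Proof.
move=> WU [al aC at_]; split.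
- by move=> c x ac cx /WU; exact: al.
- move=> c v ac k; apply: Ck_sub (aC c v ac k) => x [cx /WU Ux]; by split.
- by move=> c e x v ac ae cx /WU; exact: at_.
Qed.

End Equations.

(** * Positive multiples of the supporting equation *)

Section Convexity.
Context {R : realType} {n : nat}.
Local Notation d := (n.*2.+1).
Local Notation E := 'rV[R]_d.
Local Notation C := (cplane R).
Variable V : @atlased R E.
Hypothesis Vm : manifold V.
Hypothesis Vc : compact [set: V].
Variables (K : set V) (theta h : V -> C).
Hypothesis DM : defining_map K theta h.
Hypothesis OB : open_book K theta.
Variables (xi : cohyp V) (a0 : form1 V).
Hypothesis ea0 : equation xi a0.
Hypothesis nz0 : forall c x, atlas V c -> cimg c x -> exists v, a0 c x v != 0.
Hypothesis ct0 : contact_on K n.-1 a0.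
Hypothesis nd0 : forall z, circle z -> nondegenerate_on (fibre K theta z) (extd a0).
Implicit Types (c e : chart E V) (p q : V) (z : C) (a b : form1 V) (f F G : V -> R).
Local Notation smooth_offK := (smooth_offK K).
Local Notation dliouville := (dliouville Vm h a0).

Let sa0 : smooth_form setT a0 := proj1 ea0.
Let invh p : R := (cmod (h p))^-1.

Definition smooth_on_charts f := forall c, atlas V c ->
  Cinf (cimg c) ((f : V -> R^o) \o cinv c).

(** Forms are functions on all charts and all coordinates, but only the values in
    the charts of the atlas matter; hence this equality in place of Leibniz
    equality. *)
Definition same_form a b := forall c x v, atlas V c -> cimg c x -> a c x v = b c x v.

Lemma smooth_fun_sub (H : normedModType R) (U : set V) (f : V -> H) :
  smooth_fun setT f -> smooth_fun U f.
Proof.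
move=> sf p _; have [W [g [oW Wp sg gE]]] := sf p I.
by exists W, g; split => // q _; exact: gE.
Qed.

Lemma smooth_form_same U a b : open U -> same_form a b -> smooth_form U b -> smooth_form U a.
Proof.
move=> oU ab [bl bC bt]; split.
- by move=> c x ac cx Ux t v w; rewrite !ab//; exact: bl.
- move=> c v ac k; have oW := open_chart_pre (atlas_chart Vm ac) oU.
  by apply: Ck_eq (bC c v ac k) => // x [cx _]; exact: ab.
- move=> c e x v ac ae cx Ux ex; rewrite !ab//; first exact: bt.
  by apply: chart_img ex; exact: atlas_chart.
Qed.

Lemma extd_same a b c x v w : same_form a b -> atlas V c -> cimg c x ->
  extd a c x v w = extd b c x v w.
Proof.
move=> ab ac cx; apply: extd_near.
by apply: filterS (near_cimg (atlas_chart Vm ac) cx) => y cy u; exact: ab.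
Qed.

Lemma equation_scalef f a : same_form a (scalef f a0) -> (forall p, 0 < f p) ->
  smooth_on_charts f -> equation xi a.
Proof.
move=> af f0 sf; have [_ e0] := ea0; split.
  apply: (smooth_form_same openT af); apply: smooth_scalef => //.
  - exact: openT.
  - by move=> c ac k; apply: Ck_sub (sf c ac k) => x [].
move=> c x ac cx; have [-> ->] := e0 c x ac cx; have fp := f0 (cinv c x).
split; apply/seteqP; split => v; rewrite /= af// /scalef.
- by move=> ->; rewrite mulr0.
- by move=> /eqP; rewrite mulf_eq0 gt_eqF//= => /eqP.
- by move=> av; rewrite mulr_gt0.
- by rewrite pmulr_rgt0.
Qed.

Lemma invh_smooth : smooth_offK invh.
Proof. by move=> c ac; exact: (invmod_Cinf Vm DM ac). Qed.

Lemma invh_gt0 p : ~ K p -> 0 < invh p.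
Proof. by move=> Kp; rewrite invr_gt0 cmod_gt0//; exact: (h_neq0 DM). Qed.

Lemma smooth_offKM F G : smooth_offK F -> smooth_offK G -> smooth_offK (fun p => F p * G p).
Proof.
move=> sF sG c ac k; have oW := open_chart_pre (atlas_chart Vm ac) (open_notK Vm DM).
exact: (CkM oW (sF c ac k) (sG c ac k)).
Qed.

Lemma smooth_on_charts_offK f : smooth_on_charts f -> smooth_offK f.
Proof. by move=> sf c ac k; apply: Ck_sub (sf c ac k) => x []. Qed.

(** Apply [nondegenerate_rescale] to [F = f / |h|]. *)
Lemma nondegenerate_stretch f a z : same_form a (scalef f a0) -> (forall p, 0 < f p) ->
  smooth_on_charts f -> circle z ->
  nondegenerate_on (fibre K theta z) (extd (scalef invh a)) <->
  (forall p, fibre K theta z p -> f p * invh p + dliouville (fun p => f p * invh p) p != 0).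
Proof.
move=> af f0 sf zc; pose F p := f p * invh p.
have sF : smooth_offK F.
  by apply: smooth_offKM; [exact: smooth_on_charts_offK|exact: invh_smooth].
have F0 p : ~ K p -> F p != 0.
  by move=> Kp; rewrite mulf_neq0 ?gt_eqF//; exact: invh_gt0.
have same : same_form (scalef invh a) (scalef F a0).
  by move=> c x v ac cx; rewrite /scalef af// /scalef /F mulrCA mulrA.
have := nondegenerate_rescale Vm DM OB sa0 nd0 zc sF F0.
rewrite -/F => <-; split=> nd c x v ac cx fx tv v0; have [v' tv' w'] := nd c x v ac cx fx tv v0.
  by exists v' => //; rewrite -(extd_same v v' same ac cx).
by exists v' => //; rewrite (extd_same v v' same ac cx).
Qed.

Lemma smooth_on_charts_continuous f : smooth_on_charts f -> continuous f.
Proof.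
move=> sf p; have [c [ac cp]] := chart_at_ex Vm p; have cc := atlas_chart Vm ac.
have fc := Ck_continuous (sf c ac 0) (chart_img cc cp).
have fE : {near p, (f \o cinv c) \o cmap c =1 f}.
  by apply: filterS (near_cdom cc cp) => q cq; rewrite /= (chartK cc).
apply: cvg_trans (near_eq_cvg fE) _.
have := continuous_comp (cmap_continuous cc cp) fc.
by rewrite /prop_for /continuous_at /= (chartK cc).
Qed.

(** Apply [stretch_gt0] with [phi = |h| / f]. *)
Theorem good_stretch f a z : same_form a (scalef f a0) -> (forall p, 0 < f p) ->
  smooth_on_charts f -> circle z ->
  nondegenerate_on (fibre K theta z) (extd (scalef invh a)) ->
  forall p, fibre K theta z p -> 0 < f p * invh p + dliouville (fun p => f p * invh p) p.
Proof.
move=> af f0 sf zc /(nondegenerate_stretch af f0 sf zc) s0.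
have fc := smooth_on_charts_continuous sf.
apply: (stretch_gt0 Vc DM OB sa0 nd0 (phi := fun p => cmod (h p) * (f p)^-1)) => //.
- by apply: smooth_offKM; [exact: smooth_on_charts_offK|exact: invh_smooth].
- by move=> p Kp; rewrite mulr_gt0//; exact: invh_gt0.
- move=> p; apply: cvgM; first exact: (cmod_h_continuous Vm DM).
  by apply: cvgV; [rewrite gt_eqF|exact: fc].
- by move=> p Kp; rewrite /invh invfM invrK mulrC.
- by move=> p /(KE DM) ->; rewrite (eqP (_ : cmod 0 == 0)) ?mul0r// cmod_eq0.
Qed.

(** Off the binding, the page is locally the zero set of [cdet z h]; along the
    binding, it is defined by [cdet z h = 0] and [cdot z h >= 0]. *)
Lemma page_domain z : circle z -> domain (page K theta z) K.
Proof.
move=> zc; have zz := circle_cdot zc; split.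
- exact: (page_compact Vm Vc DM zc).
- by move=> p Kp; left.
- move=> p pF Kp; have pz : fibre K theta z p by case: pF.
  exists [set p | 0 < cdot z (h p)], (fun p => cdet z (h p)); split.
  + exact: (open_cdot_h Vm DM).
  + by case/(fibreE DM p zc): pz.
  + by apply: smooth_fun_sub; exact: (smooth_cdet_h Vm DM).
  + move=> c ac cp y; have cc := atlas_chart Vm ac; have cx := chart_img cc cp.
    have fx : fibre K theta z (cinv c (cmap c p)) by rewrite (chartK cc).
    have [v] := fibre_submersive Vm DM OB zc ac cx fx.
    rewrite (fibre_cdot DM zc fx) cdetZl mulf_eq0 negb_or => /andP[_ v0].
    exists ((y / cdet z (dfun h c (cmap c p) v)) *: v).
    by rewrite (dfun_cdet_h Vm DM _ _ ac cx) /dfun linearZ cdetZr -/(dfun _ _ _ _) divfK.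
  + move=> q Uq; have hq : 0 < cdot z (h q) by exact: Uq.
    split.
      by move=> /(KE DM) h0; move: hq; rewrite h0 /cdot !mulr0 addr0 ltxx.
    split; first by move/(pageE DM q zc) => [].
    by move=> h0; apply/(pageE DM q zc); split => //; exact: ltW.
- move=> p Kp.
  exists setT, (fun q => (cdet z (h q), cdot z (h q)) : C); split => //.
  + exact: openT.
  + apply: (chart_smooth_fun Vm openT) => c ac k.
    have oc := open_cimg (atlas_chart Vm ac).
    apply: Ck_sub (_ : Ck k (cimg c) _); first by move=> x [].
    have hC := h_Cinf Vm DM ac k.
    apply: Ck_pair => //.
      exact: (Ck_cdet oc (Ck_cst k (cimg c) z) hC).
    exact: (Ck_cdot oc (Ck_cst k (cimg c) z) hC).
  + move=> c ac cp y; have cc := atlas_chart Vm ac; have cx := chart_img cc cp.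
    have Kx : K (cinv c (cmap c p)) by rewrite (chartK cc).
    have [v hv] := h_onto Vm DM ac cx Kx (y.2 *: z + y.1 *: crot z).
    exists v; have hd := h_diff Vm DM ac cx.
    have D1 := differentiable_cdetl z hd; have D2 := differentiable_cdotl z hd.
    have := congr1 (fun D : E -> C => D v) (diff_pair D1 D2) => E1.
    apply: (etrans E1).
    apply: (etrans (congr2 pair (diff_cdetl z v hd) (diff_cdotl z v hd))).
    have -> : 'd (h \o cinv c) (cmap c p) v = y.2 *: z + y.1 *: crot z by exact: hv.
    rewrite cdetDr cdotDr !cdetZr !cdotZr cdetzz cdet_crot zz.
    have -> : cdot z (crot z) = 0 by rewrite /cdot /crot/=; ring.
    by rewrite !mulr0 !mulr1 add0r addr0 -surjective_pairing.
  + move=> q _; split.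
      exact: (pageE DM q zc).
    split; first by move=> /(KE DM) ->; rewrite /cdet /cdot /= !mulr0 subrr addr0.
    move=> [cz dz]; apply/(KE DM); apply: (cdot_cdet0 (z := z)) => //.
    by rewrite -cdotzz_eq0 zz oner_eq0.
Qed.

(** The function [u = cdot z h] is [|h|] on the page, so [u (a / |h|) = a].  It is
    regular along the binding by [page_radial]. *)
Theorem ideal_liouville_of f a z : same_form a (scalef f a0) -> (forall p, 0 < f p) ->
  smooth_on_charts f -> circle z ->
  nondegenerate_on (fibre K theta z) (extd (scalef invh a)) ->
  ideal_liouville n (page K theta z) K (extd (scalef invh a)).
Proof.
move=> af f0 sf zc nd; have [sa _] := equation_scalef af f0 sf.
rewrite /ideal_liouville page_minus_K; split.
- exact: page_domain.
- exact: nd.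
- exists (scalef invh a), (~` K); split.
  + exact: (open_notK Vm DM).
  + by move=> p [].
  + apply: smooth_scalef; [exact: Vm|exact: (open_notK Vm DM)| |exact: invh_smooth].
    exact: smooth_form_sub sa.
  + by [].
  + exists (fun p => cdot z (h p)), a, setT; split.
    * by split => //; exact: openT.
    * split.
      - exact: (smooth_cdot_h Vm DM).
      - by move=> p /(pageE DM p zc)[].
      - move=> p /(pageE DM p zc)[cz dz]; split.
          by move=> /(KE DM) ->; rewrite /cdot !mulr0 addr0.
        move=> d0; apply/(KE DM); apply: (cdot_cdet0 (z := z)) => //.
        by rewrite -cdotzz_eq0 circle_cdot// oner_eq0.
      - move=> c x ac cx Kx.
        have [v tv v0] := page_radial Vm DM OB ac cx Kx zc.
        by exists v => //; rewrite (dfun_cdot_h Vm DM).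
    * exact: sa.
    * move=> c x v ac cx fx _; have Kx : ~ K (cinv c x) by case: fx.
      rewrite /scalef {1}(fibre_cdot DM zc fx) cdotZr circle_cdot// mulr1 mulrA /invh divff ?mul1r//.
      by rewrite cmod_eq0 (h_neq0 DM).
    * apply: (contact_near Vm af); apply: contact_scalef => //.
        by move=> c x ac cx; have [fd _] := sf c ac 1; exact: fd.
      by move=> p; rewrite gt_eqF.
Qed.

End Convexity.

(** * Volumes evaluated on lists of vectors *)

Section Slots.
Context {R : realType} {d : nat}.
Local Notation E := 'rV[R]_d.
Implicit Types (l : seq E) (a : E -> R) (w : E -> E -> R).

Lemma seqfun_set_nth N l (k : 'I_N) v :
  seqfun N (set_nth 0 l k v) = upd (seqfun N l) k v.
Proof. by apply/funext => i; rewrite /seqfun /upd nth_set_nth /=. Qed.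

Lemma alt_seq_linfun1 N (Phi : ('I_N -> E) -> R) l (k : 'I_N) : multilinear Phi ->
  linfun1 (fun v => alt Phi (seqfun N (set_nth 0 l k v))).
Proof. by move=> /alt_multilinear ml t v u; rewrite !seqfun_set_nth ml. Qed.

Lemma alt_seq_eq0 N (Phi : ('I_N -> E) -> R) l (i j : 'I_N) : i != j -> l`_i = l`_j ->
  alt Phi (seqfun N l) = 0.
Proof. by move=> ij lij; apply: (@alt_eq0 _ _ _ _ _ i j). Qed.

(** The values of [a /\ w^m] on lists of vectors, up to a positive factor (see
    [cvolE]); likewise [pfaff] for [w^m] (see [pow2E]). *)
Definition vol m a w l : R := alt (vpairs a w) (seqfun m.*2.+1 l).
Definition pfaff m w l : R := alt (pairs w) (seqfun m.*2 l).

Lemma bilin2_bilin w : bilin2 w -> bilin w.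
Proof. by move=> [wr wl]; split=> *; [exact: wl|exact: wr]. Qed.

Section Vol.
Variables (m : nat) (a : E -> R) (w : E -> E -> R).
Hypotheses (al : linfun1 a) (wb : bilin2 w).

Lemma vol_linfun1 l (k : 'I_m.*2.+1) : linfun1 (fun v => vol m a w (set_nth 0 l k v)).
Proof. by apply: alt_seq_linfun1; apply: vpairs_multilinear => //; exact: bilin2_bilin. Qed.

Lemma vol_eq0 l (i j : 'I_m.*2.+1) : i != j -> l`_i = l`_j -> vol m a w l = 0.
Proof. exact: alt_seq_eq0. Qed.
End Vol.

Section Leading.
Variables (m : nat) (a : E -> R) (w : E -> E -> R) (l : seq E).
Hypotheses (al : linfun1 a) (wb : bilin2 w).
Let B u v := vol m.+1 a w [:: u, v & l].

Lemma vol_lead1 v : linfun1 (B ^~ v).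
Proof. exact: (@vol_linfun1 m.+1 a w al wb [:: 0, v & l] ord0). Qed.

Lemma vol_lead2 u : linfun1 (B u).
Proof. exact: (@vol_linfun1 m.+1 a w al wb [:: u, 0 & l] (lift ord0 ord0)). Qed.

Lemma vol_lead_diag u : B u u = 0.
Proof. exact: (@vol_eq0 m.+1 a w [:: u, u & l] ord0 (lift ord0 ord0)). Qed.

Lemma vol_lead_swap u v : B u v = - B v u.
Proof.
have := vol_lead_diag (u + v).
rewrite (linfun1_D _ _ (vol_lead1 _)) !(linfun1_D _ _ (vol_lead2 _)) !vol_lead_diag.
by rewrite add0r addr0 => /eqP; rewrite addr_eq0 => /eqP.
Qed.

(** The form is alternating in its first two arguments. *)
Lemma vol_lead_comb u v (s t s' t' : R) :
  B (s *: u + t *: v) (s' *: u + t' *: v) = (s * t' - t * s') * B u v.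
Proof.
rewrite (linfun1_D _ _ (vol_lead1 _)) !(linfun1_Z _ _ (vol_lead1 _)).
rewrite !(linfun1_D _ _ (vol_lead2 _)) !(linfun1_Z _ _ (vol_lead2 _)) !vol_lead_diag.
by rewrite (vol_lead_swap v u); ring.
Qed.

End Leading.

Lemma vol_opp_third m a w u v x l : linfun1 a -> bilin2 w ->
  vol m.+1 a w [:: u, v, - x & l] = - vol m.+1 a w [:: u, v, x & l].
Proof.
move=> al wb.
exact: (linfun1_N x (@vol_linfun1 m.+1 a w al wb [:: u, v, 0 & l] (lift ord0 (lift ord0 ord0)))).
Qed.

(** [alt_pairs_cons] for lists: contraction of the power of [w] by [v]. *)
Lemma pfaff_cons m w v l : (forall u v, w u v = - w v u) ->
  pfaff m.+1 w (v :: l) = m.+1.*2%:R * vol m (w v) w l.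
Proof. by move=> wN; rewrite /pfaff (alt_pairs_cons _ wN). Qed.

Lemma vol_ext m a a' w l : (size l = m.*2.+1)%N -> {in l, a =1 a'} ->
  vol m a w l = vol m a' w l.
Proof.
move=> sl aa; rewrite /vol /alt; apply: eq_bigr => s _; congr (_ * _).
rewrite /vpairs /= /seqfun aa//; apply: mem_nth.
by rewrite sl.
Qed.

Lemma pfaff_lead_linfun1 m w l : bilin2 w -> linfun1 (fun v => pfaff m.+1 w (v :: l)).
Proof.
move=> wb.
have ml : multilinear (@pairs _ _ m.+1 w) by apply: pairs_multilinear; exact: bilin2_bilin.
exact: (@alt_seq_linfun1 m.+1.*2 _ (0 :: l) ord0 ml).
Qed.

Lemma pfaff_lead_span m w l v : bilin2 w -> (size l = m.*2.+1)%N -> v \in span l ->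
  pfaff m.+1 w (v :: l) = 0.
Proof.
move=> wb sl vl; have pl := pfaff_lead_linfun1 m l wb.
have -> : v = \sum_(i < size l) coord (in_tuple l) i v *: l`_i.
  by have := coord_span (X := in_tuple l) vl.
rewrite (linfun1_sum _ _ _ pl) big1// => i _.
have il : (i.+1 < m.+1.*2)%N by rewrite -[m.+1.*2]/(m.*2.+2) ltnS -sl ltn_ord.
rewrite [X in _ * X](_ : _ = 0) ?mulr0//.
exact: (@alt_seq_eq0 m.+1.*2 _ (l`_i :: l) ord0 (Ordinal il)).
Qed.

End Slots.

Section Frame.
Context {R : realType} {d : nat}.
Local Notation E := 'rV[R]_d.
Local Notation C := (cplane R).

(** Complete lifts of the two basis vectors of the plane by a basis of the
    kernel. *)
Lemma adapted_frame (f : E -> C) : linear f -> (forall w, exists v, f v = w) ->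
  exists r nu (e : seq E), [/\ f r = (1, 0), f nu = (0, 1), ((size e).+2 = d)%N,
    {in e, forall v, f v = 0} & free [:: r, nu & e] /\ forall v, f v = 0 -> v \in span e].
Proof.
move=> fl fo.
have [r fr] := fo (1, 0); have [nu fnu] := fo (0, 1).
pose A : 'M[R]_(d, 2) := \matrix_(i, j)
  (if j == ord0 then (f (delta_mx ord0 i)).1 else (f (delta_mx ord0 i)).2).
have f1 : linfun1 (fun v => (f v).1) by move=> t u v; rewrite fl.
have f2 : linfun1 (fun v => (f v).2) by move=> t u v; rewrite fl.
pose g := linfun (mulmxr A : E -> 'rV[R]_2).
have gE v : g v = \row_j (if j == ord0 then (f v).1 else (f v).2).
  apply/rowP => j; rewrite lfunE /= !mxE.
  case: ifP => j0; [rewrite (linfun1_delta v f1)|rewrite (linfun1_delta v f2)];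
    by apply: eq_bigr => k _; rewrite mxE j0.
have g0 v : (v \in lker g) = (f v == 0).
  rewrite memv_ker gE; apply/eqP/eqP => [H|->]; last by apply/rowP => j; rewrite !mxE; case: ifP.
  have e1 := congr1 (fun A : 'rV[R]_2 => A ord0 ord0) H.
  have e2 := congr1 (fun A : 'rV[R]_2 => A ord0 (lift ord0 ord0)) H.
  rewrite !mxE /= in e1 e2; by rewrite [LHS]surjective_pairing e1 e2.
have gim : limg g = fullv.
  apply/eqP; rewrite eqEsubv subvf/=; apply/subvP => w _.
  have [v fv] := fo (w ord0 ord0, w ord0 (lift ord0 ord0)).
  have -> : w = g v; last exact: memv_img (memvf v).
  apply/rowP => j; rewrite gE mxE fv; case: ifP => [/eqP->//|j0].
  by congr (w _ _); apply/val_inj; case: j j0 => -[|[|]].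
have dimK : ((\dim (lker g)).+2 = d)%N.
  have := limg_ker_dim g fullv; rewrite capfv gim !dimvf /dim /= !mul1n.
  by rewrite addn2.
exists r, nu, (vbasis (lker g)); split => //.
- by rewrite size_tuple.
- by move=> v /vbasis_mem; rewrite g0 => /eqP.
- split; last by move=> v fv; rewrite (span_basis (vbasisP (lker g))) g0 fv.
  rewrite !free_cons (basis_free (vbasisP (lker g))) andbT; apply/andP; split.
    apply/negP => H.
    have : (nu :: vbasis (lker g) : seq E) = [:: nu] ++ vbasis (lker g) by [].
    move=> E0; move: H; rewrite E0 span_cat span_seq1 (span_basis (vbasisP (lker g))).
    move=> /memv_addP[u /vlineP[t ->] [v]]; rewrite g0 => /eqP fv rE.
    have := congr1 (fun v => (f v).1) rE; rewrite fr (linfun1_D _ _ f1) (linfun1_Z _ _ f1) fnu fv /=.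
    by move/eqP; rewrite mulr0 addr0 oner_eq0.
  rewrite (span_basis (vbasisP (lker g))) g0 fnu; apply/eqP => /(congr1 snd)/eqP.
  by rewrite oner_eq0.
Qed.

End Frame.

(** * The Liouville field near the binding *)

Section NearBinding.
Context {R : realType} {n : nat}.
Local Notation d := (n.*2.+1).
Local Notation E := 'rV[R]_d.
Local Notation C := (cplane R).
Variable V : @atlased R E.
Hypothesis Vm : manifold V.
Variables (K : set V) (theta h : V -> C).
Hypothesis DM : defining_map K theta h.
Hypothesis OB : open_book K theta.
Variable a0 : form1 V.
Hypothesis sa0 : smooth_form setT a0.
Hypothesis nd0 : forall z, circle z -> nondegenerate_on (fibre K theta z) (extd a0).
Hypothesis ct0 : contact_on setT n a0.
Hypothesis orK : forall c x r nu (e : seq E), atlas V c -> cimg c x -> K (cinv c x) ->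
  size e = (n.-1).*2.+1 -> {in e, forall v, tangent K c x v} ->
  0 < cdet (dfun h c x r) (dfun h c x nu) ->
  0 < cvol n a0 c x [:: r, nu & e] -> 0 < cvol n.-1 a0 c x e.
Hypothesis orF : forall z, circle z -> forall c x nu (e : seq E), atlas V c -> cimg c x ->
  fibre K theta z (cinv c x) ->
  size e = n.*2 -> {in e, forall v, tangent (fibre K theta z) c x v} ->
  0 < cdet z (dfun theta c x nu) ->
  0 < cvol n a0 c x (nu :: e) -> 0 < pow2 n (extd a0) c x e.
Implicit Types (c : chart E V) (p q : V) (z : C).

Definition field_cvg (v : E -> E) x := forall k, v y ord0 k @[y --> x] --> v x ord0 k.

Lemma field_cvg_cst v x : field_cvg (fun=> v) x.
Proof. by move=> k; exact: cvg_const. Qed.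

Lemma field_cvg_near (f g : E -> R) x : (\forall y \near x, f y = g y) -> f x = g x ->
  g y @[y --> x] --> g x -> f y @[y --> x] --> f x.
Proof.
move=> fg fgx gx; rewrite fgx.
have gf : {near x, g =1 f} by apply: filterS fg => y ->.
exact: cvg_trans (near_eq_cvg gf) gx.
Qed.

Lemma near_gt0 (f : E -> R) (x : E) (L : R) : f y @[y --> x] --> L -> 0 < L ->
  \forall y \near x, 0 < f y.
Proof. by move=> fL L0; exact: (@cvgr_gt _ _ _ (nbhs_filter x) _ _ fL _ L0). Qed.

Lemma a0_field_cvg c x v : atlas V c -> cimg c x -> field_cvg v x ->
  a0 c y (v y) @[y --> x] --> a0 c x (v x).
Proof.
move=> ac cx vc; have FF : Filter (nbhs x) by exact: nbhs_filter.
have E1 y : cimg c y -> a0 c y (v y) = \sum_k v y ord0 k * a0 c y (delta_mx ord0 k).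
  by move=> cy; exact: (linfun1_delta _ (a0_lin sa0 ac cy)).
apply: (field_cvg_near (g := fun y => \sum_k v y ord0 k * a0 c y (delta_mx ord0 k))).
- by apply: filterS (near_cimg (atlas_chart Vm ac) cx) => y cy; exact: E1.
- exact: E1.
- by apply: cvg_fsum => k; apply: cvgM; [exact: vc|exact: (a0_cvg sa0 ac cx)].
Qed.

Lemma extd_field_cvg c x v u : atlas V c -> cimg c x -> field_cvg v x -> field_cvg u x ->
  extd a0 c y (v y) (u y) @[y --> x] --> extd a0 c x (v x) (u x).
Proof.
move=> ac cx vc uc; have FF : Filter (nbhs x) by exact: nbhs_filter.
pose g y := \sum_k v y ord0 k * \sum_j u y ord0 j * extd a0 c y (delta_mx ord0 k) (delta_mx ord0 j).
have E1 y : cimg c y -> extd a0 c y (v y) (u y) = g y.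
  move=> cy; have [wr wl] := extd0_bilin Vm sa0 ac cy.
  rewrite (linfun1_delta (v y) (wl (u y))); apply: eq_bigr => k _; congr (_ * _).
  exact: (linfun1_delta _ (wr _)).
apply: (field_cvg_near (g := g)).
- by apply: filterS (near_cimg (atlas_chart Vm ac) cx) => y cy; exact: E1.
- exact: E1.
- apply: cvg_fsum => k; apply: cvgM; first exact: vc.
  by apply: cvg_fsum => j; apply: cvgM; [exact: uc|exact: (extd0_cvg sa0 ac cx)].
Qed.

Lemma vol_cvg m c x (l : E -> seq E) : atlas V c -> cimg c x ->
  (forall i, field_cvg (fun y => (l y)`_i) x) ->
  vol m (a0 c y) (extd a0 c y) (l y) @[y --> x] --> vol m (a0 c x) (extd a0 c x) (l x).
Proof.
move=> ac cx lc; have FF : Filter (nbhs x) by exact: nbhs_filter.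
apply: cvg_fsum => s; apply: cvgM; first exact: cvg_const.
rewrite /vpairs /pairs /seqfun /=; apply: cvgM; first exact: (a0_field_cvg ac cx (lc _)).
by apply: cvg_fprod => i; exact: (extd_field_cvg ac cx (lc _) (lc _)).
Qed.

Definition rho p : R := cdot (h p) (h p).

Lemma rho_smooth c : atlas V c -> Cinf (cimg c) ((rho : V -> R^o) \o cinv c).
Proof.
move=> ac k; have oc := open_cimg (atlas_chart Vm ac).
have hC := h_Cinf Vm DM ac k.
exact: (Ck_cdot oc hC hC).
Qed.

Lemma rho_offK : smooth_offK K rho.
Proof. by move=> c ac k; apply: Ck_sub (rho_smooth ac k) => x []. Qed.

Lemma cdot_double (a b : C) : cdot a b + cdot b a = 2 * cdot a b.
Proof. by rewrite [cdot b a]cdotC; ring. Qed.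

Lemma drho c x v : atlas V c -> cimg c x ->
  dfun (rho : V -> R^o) c x v = 2 * cdot (h (cinv c x)) (dfun h c x v).
Proof.
move=> ac cx; have hd := h_diff Vm DM ac cx.
apply: (etrans (diff_cdot v hd hd)); exact: cdot_double.
Qed.

Lemma cramer (a b w : C) : cdet a b *: w = cdet w b *: a + cdet a w *: b.
Proof.
case: a b w => a1 a2 [b1 b2] [w1 w2]; rewrite /cdet.
by apply/pair_equal_spec; split; rewrite /= /GRing.scale/=; ring.
Qed.

Lemma cdet_comb (a b : C) (s t s' t' : R) :
  cdet (s *: a + t *: b) (s' *: a + t' *: b) = (s * t' - t * s') * cdet a b.
Proof. by case: a b => a1 a2 [b1 b2]; rewrite /cdet /= /GRing.scale/=; ring. Qed.

Lemma cdetDZl (t : R) (u v w : C) : cdet (t *: u + v) w = t * cdet u w + cdet v w.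
Proof. by rewrite /cdet /= /GRing.scale/=; ring. Qed.

Lemma module_comb (A A' B B' s t : R) (r nu : E) :
  ((t * A + B) / s) *: r + ((t * A' + B') / s) *: nu =
  t *: ((A / s) *: r + (A' / s) *: nu) + ((B / s) *: r + (B' / s) *: nu).
Proof. by rewrite scalerDr !scalerA !mulrDl !mulrA !scalerDl addrACA. Qed.

Section Frame.
Variables (c : chart E V) (r nu : E).
Hypothesis ac : atlas V c.

Let D y := cdet (dfun h c y r) (dfun h c y nu).
(** Cramer's rule for the lift of [w] to the span of [r] and [nu]; subtracting it projects onto the kernel of [dh]. *)
Definition frame_lift y (w : C) : E :=
  (cdet w (dfun h c y nu) / D y) *: r + (cdet (dfun h c y r) w / D y) *: nu.
Definition frame_proj y v : E := v - frame_lift y (dfun h c y v).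

Lemma dh_lift y w : D y != 0 -> dfun h c y (frame_lift y w) = w.
Proof.
move=> D0; rewrite /frame_lift dfun_linear.
have -> : dfun h c y ((cdet (dfun h c y r) w / D y) *: nu) =
   (cdet (dfun h c y r) w / D y) *: dfun h c y nu by exact: linearZ.
rewrite ![_ / D y]mulrC -!scalerA -scalerDr -cramer scalerA mulVf ?scale1r//.
Qed.

Lemma dh_proj y v : D y != 0 -> dfun h c y (frame_proj y v) = 0.
Proof.
move=> D0.
have -> : dfun h c y (frame_proj y v) = dfun h c y v - dfun h c y (frame_lift y (dfun h c y v)).
  exact: linearB.
by rewrite dh_lift// subrr.
Qed.

Lemma frame_lift_linear y : linear (frame_lift y).
Proof.
move=> t u v; rewrite /frame_lift cdetDr cdetZr cdetDZl.
exact: module_comb.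
Qed.

Lemma frame_proj_linear y : linear (frame_proj y).
Proof.
move=> t u v; rewrite /frame_proj dfun_linear frame_lift_linear scalerBr opprD.
by rewrite addrACA.
Qed.

Lemma frame_lift_r y : D y != 0 -> frame_lift y (dfun h c y r) = r.
Proof. by move=> D0; rewrite /frame_lift cdetzz mul0r scale0r addr0 divff// scale1r. Qed.

Lemma frame_lift_nu y : D y != 0 -> frame_lift y (dfun h c y nu) = nu.
Proof. by move=> D0; rewrite /frame_lift cdetzz mul0r scale0r add0r divff// scale1r. Qed.

Lemma D_cvg x : cimg c x -> D y @[y --> x] --> D x.
Proof.
move=> cx; have FF : Filter (nbhs x) by exact: nbhs_filter.
exact: (cvg_cdet (dh_cvg Vm DM (v := r) ac cx) (dh_cvg Vm DM (v := nu) ac cx)).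
Qed.

Lemma frame_proj_cvg v x : cimg c x -> D x != 0 -> field_cvg (fun y => frame_proj y v) x.
Proof.
move=> cx D0 k; have FF : Filter (nbhs x) by exact: nbhs_filter.
have dv := dh_cvg Vm DM (v := v) ac cx.
have V1 : (D y)^-1 @[y --> x] --> (D x)^-1 by apply: cvgV => //; exact: D_cvg.
have A1 := cvgM (cvg_cdet dv (dh_cvg Vm DM (v := nu) ac cx)) V1.
have A2 := cvgM (cvg_cdet (dh_cvg Vm DM (v := r) ac cx) dv) V1.
have E1 y : frame_proj y v ord0 k = v ord0 k -
   ((cdet (dfun h c y v) (dfun h c y nu) / D y) * r ord0 k +
    (cdet (dfun h c y r) (dfun h c y v) / D y) * nu ord0 k).
  by rewrite /frame_proj /frame_lift !mxE.
apply: (cvg_eq_fun E1); apply: cvgB; first exact: cvg_const.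
by apply: cvgD; apply: cvgM; first [exact: A1|exact: A2|exact: cvg_const].
Qed.

End Frame.

Lemma half_pow_gt0 k : 0 < 2^-1 ^+ k :> R.
Proof. by rewrite exprn_gt0// invr_gt0. Qed.

Lemma cvol_gt0 m c x (l : seq E) :
  (0 < cvol m a0 c x l) = (0 < vol m (a0 c x) (extd a0 c x) l).
Proof. by rewrite cvolE pmulr_rgt0// half_pow_gt0. Qed.

Lemma pow2_gt0 m c x (l : seq E) :
  (0 < pow2 m (extd a0) c x l) = (0 < pfaff m (extd a0 c x) l).
Proof. by rewrite pow2E pmulr_rgt0// half_pow_gt0. Qed.

Lemma size_tail k j m : k.+2 = j.*2.+1 -> j = m.+1 -> k = m.*2.+1.
Proof. by move=> kj jm; move: kj; rewrite jm doubleS => -[]. Qed.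

Lemma size_cons2 k j m : k = m.*2.+1 -> j = m.+1 -> k.+2 = j.*2.+1.
Proof. by move=> -> ->; rewrite doubleS. Qed.

Lemma size_cons1 k j m : k = m.*2.+1 -> j = m.+1 -> k.+1 = j.*2.
Proof. by move=> -> ->; rewrite doubleS. Qed.

Lemma size_pred k j m : k = m.*2.+1 -> j = m.+1 -> k = j.-1.*2.+1.
Proof. by move=> -> ->. Qed.

(** The dimension of the ambient space depends on [n], so [n] cannot be rewritten
    everywhere in a goal; this rewrites only the degree. *)
Lemma vol_cast j k (a : E -> R) (w : E -> E -> R) (l : seq E) :
  j = k -> vol j a w l = vol k a w l.
Proof. by move->. Qed.

Lemma pfaff_cast j k (w : E -> E -> R) (l : seq E) :
  j = k -> pfaff j w l = pfaff k w l.
Proof. by move->. Qed.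

Lemma double_pos k j : k.+2 = j.*2.+1 -> exists m, j = m.+1.
Proof. by case: j => [//|j] _; exists j. Qed.

(** The sign of one vector of the frame is chosen so that the frame is
    positive in [V]; the orientation of the binding then makes its restriction to
    the binding positive. *)
Lemma binding_frame c x : atlas V c -> cimg c x -> K (cinv c x) ->
  exists m r nu (e : seq E), [/\ n = m.+1,
    dfun h c x r = (1, 0) /\ dfun h c x nu = (0, 1),
    size e = m.*2.+1 /\ {in e, forall v, dfun h c x v = 0},
    (forall v, dfun h c x v = 0 -> v \in span e) &
    0 < vol m.+1 (a0 c x) (extd a0 c x) [:: r, nu & e] /\
    0 < vol m (a0 c x) (extd a0 c x) e].
Proof.
move=> ac cx Kx.
have hl : linear (dfun h c x) by move=> t u v; exact: dfun_linear.
have [r [nu [e [hr hnu se he [fe spe]]]]] := adapted_frame hl (h_onto Vm DM ac cx Kx).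
have [m nE] : exists m, n = m.+1.
  by exact: (double_pos se).
have pE : n.-1 = m by rewrite (congr1 predn nE).
have se' : size e = m.*2.+1.
  exact: (size_tail se nE).
have volE l : free l -> size l = n.*2.+1 -> vol n (a0 c x) (extd a0 c x) l != 0.
  move=> fl sl; have := ct0 ac cx I sl fl (fun v _ => tangentT Vm v ac cx).
  by rewrite cvolE mulf_eq0 negb_or => /andP[_].
have al := a0_lin sa0 ac cx; have wb := extd0_bilin Vm sa0 ac cx.
have finish e' : size e' = m.*2.+1 -> {in e', forall v, dfun h c x v = 0} ->
    0 < vol m.+1 (a0 c x) (extd a0 c x) [:: r, nu & e'] ->
    0 < vol m (a0 c x) (extd a0 c x) e'.
  move=> s' h' v'; rewrite -(vol_cast _ _ _ pE) -cvol_gt0.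
  apply: (orK (r := r) (nu := nu) ac cx Kx).
  - exact: (size_pred s' nE).
  - by move=> v /h'; exact: (binding_tangent Vm DM OB ac cx Kx).
  - by rewrite hr hnu /cdet /= mul0r subr0 mulr1 ltr01.
  - by rewrite cvol_gt0 (vol_cast _ _ _ nE).
have := volE [:: r, nu & e] fe (size_cons2 se' nE); rewrite (vol_cast _ _ _ nE) => v0.
have [vneg|vpos|/eqP] := ltgtP (vol m.+1 (a0 c x) (extd a0 c x) [:: r, nu & e]) 0;
  last by rewrite (negbTE v0).
  case: e se he fe spe se' v0 vneg => [//|e1 es] se he fe spe se' v0 vneg.
  have v'0 : 0 < vol m.+1 (a0 c x) (extd a0 c x) [:: r, nu, - e1 & es].
    by rewrite vol_opp_third// oppr_gt0.
  have he' : {in - e1 :: es, forall v, dfun h c x v = 0}.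
    move=> v; rewrite inE => /orP[/eqP ->|ves]; last by apply: he; rewrite inE ves orbT.
    have -> : dfun h c x (- e1) = - dfun h c x e1 by exact: linearN.
    by rewrite he ?oppr0// inE eqxx.
  exists m, r, nu, (- e1 :: es); split => //.
  - move=> v /spe; rewrite !span_cons => /memv_addP[u /vlineP[t ->] [w wes ->]].
    apply: memv_add => //.
    by rewrite -[t *: e1]opprK -scalerN -scaleNr; apply: memvZ; exact: memv_line.
  - by split => //; exact: finish.
by exists m, r, nu, e; split => //; split => //; exact: finish.
Qed.

Lemma vec_lambda (z w : C) : z != 0 -> cdet z w = 0 ->
  w = (cdot z w / cdot z z) *: z.
Proof.
move=> z0 zw; have zz : cdot z z != 0 by rewrite cdotzz_eq0.
have := plane_decomp z w; rewrite zw scale0r addr0 => H.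
by rewrite mulrC -scalerA -H scalerA mulVf ?scale1r.
Qed.

(** The projection is given as a function, not as a bundled linear map. *)
Lemma span_map_linear (P : E -> E) (e : seq E) v : linear P -> v \in span e ->
  P v \in span (map P e).
Proof.
move=> Pl ve; have := coord_span (X := in_tuple e) ve => /= vE.
have P0 : P 0 = 0.
  by have := Pl (-1) 0 0; rewrite scaler0 addr0 scaleN1r addNr.
have PD u w : P (u + w) = P u + P w by have := Pl 1 u w; rewrite !scale1r.
have PZ t u : P (t *: u) = t *: P u by have := Pl t u 0; rewrite P0 !addr0.
have PS (I : Type) (s : seq I) (F : I -> E) : P (\sum_(i <- s) F i) = \sum_(i <- s) P (F i).
  by elim: s => [|i s IH]; rewrite ?big_nil// !big_cons PD IH.
rewrite vE PS; apply: memv_suml => i _; rewrite PZ; apply: memvZ.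
by apply: memv_span; apply: map_f; exact: mem_nth.
Qed.

(** Let [r'] and [nu'] be lifts of [h] and [i h] by [dh], and [e'] a basis of the
    kernel of [dh], obtained from a frame at the nearby point of the binding.  By
    continuity, [(r', nu', e')] is positive in [V] and [a0 /\ (d a0)^(n-1)] is
    positive on [e'].  The vector [nu'] increases the angle, so [(- r', e')] is a
    positive basis of the page, on which [(d a0)^n] is positive.  Since [Y] is tangent
    to the page, [Y = lam r'] modulo the span of [e'], so that [(d a0)^n] takes on
    [(Y, e')] the value [lam] times its value on [(r', e')], which is negative.
    But the contraction by [Y] is a positive multiple of [a0 /\ (d a0)^(n-1)] on
    [e'], so [lam < 0], and the derivative of [|h|^2] along [Y] is
    [2 lam |h|^2]. *)
Theorem dliouville_rho_lt0 p : K p -> \forall q \near p, ~ K q -> dliouville Vm h a0 rho q < 0.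
Proof.
move=> Kp; have [c [ac cp]] := chart_at_ex Vm p; have cc := atlas_chart Vm ac.
have cx := chart_img cc cp; have xp := chartK cc cp.
have Kx : K (cinv c (cmap c p)) by rewrite xp.
set x := cmap c p in cx xp Kx.
have [m [r [nu [e [nE [hr hnu] [se he] spe [vol1 vol2]]]]]] := binding_frame ac cx Kx.
pose D y := cdet (dfun h c y r) (dfun h c y nu).
have Dx : D x = 1 by rewrite /D hr hnu /cdet /= mul0r subr0 mulr1.
have D0 : D x != 0 by rewrite Dx oner_eq0.
pose e' y := map (frame_proj c r nu y) e.
have lift0 : frame_lift c r nu x 0 = 0.
  by rewrite /frame_lift /cdet /= !mul0r !mulr0 subrr !mul0r !scale0r addr0.
have e'x : e' x = e.
  rewrite -[RHS]map_id; apply/eq_in_map => v ve.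
  by rewrite /frame_proj he// lift0 subr0.
have e'c i : field_cvg (fun y => (e' y)`_i) x.
  have [ie|ie] := ltnP i (size e).
    have -> : (fun y => (e' y)`_i) = (fun y => frame_proj c r nu y e`_i).
      by apply/funext => y; rewrite /e' (nth_map 0).
    have H := @frame_proj_cvg c r nu ac e`_i x cx D0. exact: H.
  have -> : (fun y => (e' y)`_i) = (fun=> 0).
    by apply/funext => y; rewrite /e' nth_default// size_map.
  exact: field_cvg_cst.
have l'c i : field_cvg (fun y => [:: r, nu & e' y]`_i) x.
  by case: i => [|[|i]]; [exact: field_cvg_cst|exact: field_cvg_cst|exact: e'c].
have C1 := @vol_cvg m.+1 c x (fun y => [:: r, nu & e' y]) ac cx l'c.
have C2 := @vol_cvg m c x e' ac cx e'c.
rewrite -e'x in vol1 vol2.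
have n1 := near_gt0 (f := fun y => vol m.+1 (a0 c y) (extd a0 c y) [:: r, nu & e' y]) C1 vol1.
have n2 := near_gt0 (f := fun y => vol m (a0 c y) (extd a0 c y) (e' y)) C2 vol2.
have D1 : 0 < D x by rewrite Dx.
have n3 := near_gt0 (D_cvg (r := r) (nu := nu) ac cx) D1.
have n4 := near_cimg cc cx.
pose P y := [/\ 0 < vol m.+1 (a0 c y) (extd a0 c y) [:: r, nu & e' y],
   0 < vol m (a0 c y) (extd a0 c y) (e' y), 0 < D y & cimg c y].
have nP : \forall y \near x, P y.
  have n12 := @filterI _ _ (nbhs_filter x) _ _ n1 n2.
  have n34 := @filterI _ _ (nbhs_filter x) _ _ n3 n4.
  by apply: (@filterS2 _ _ (nbhs_filter x) _ _ P _ n12 n34) => y [? ?] [? ?]; split.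
have nq := near_cmap cc cp nP.
apply: (@filterS2 _ _ _ _ _ (fun q => ~ K q -> dliouville Vm h a0 rho q < 0) _ (near_cdom cc cp) nq).
move=> q cq Pq Kq; set y := cmap c q in Pq.
have [{}vol1 {}vol2 Dy cy] := Pq; have yq : cinv c y = q by exact: chartK.
have Ky : ~ K (cinv c y) by rewrite yq.
have Dy0 : D y != 0 by rewrite gt_eqF.
rewrite -yq (dliouvilleE Vm DM OB sa0 nd0 rho_offK ac cy Ky) /dliouville_chart.
have [tY bY] := liouvilleP Vm DM OB sa0 nd0 ac cy Ky.
set Y := liouville h a0 c y in tY bY *.
rewrite drho//.
have h0 : h (cinv c y) != 0 by exact: (h_neq0 DM Ky).
have hh0 := cdotzz_gt0 h0.
have al := a0_lin sa0 ac cy; have wb := extd0_bilin Vm sa0 ac cy.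
set hy := h (cinv c y) in h0 hh0 *.
pose lam := cdot hy (dfun h c y Y) / cdot hy hy.
have hY : dfun h c y Y = lam *: hy by exact: vec_lambda.
suff lam0 : lam < 0 by rewrite hY cdotZr pmulr_rlt0// pmulr_llt0.
pose r' := frame_lift c r nu y hy; pose nu' := frame_lift c r nu y (crot hy).
have hr' : dfun h c y r' = hy by exact: dh_lift.
have hnu' : dfun h c y nu' = crot hy by exact: dh_lift.
have he' : {in e' y, forall v, dfun h c y v = 0}.
  by move=> v /mapP[u ue ->]; exact: dh_proj.
have se' : size (e' y) = m.*2.+1 by rewrite size_map.
have Te' v : v \in e' y -> page_eq h c y v = 0.
  by move=> /he' hv; rewrite /page_eq hv /cdet /= !mulr0 subrr.
have Tr' : page_eq h c y r' = 0 by rewrite /page_eq hr' cdetzz.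
have zc := circle_theta DM Ky; have fy := fibre_theta theta Ky.
(* the basis (nu', - r', e') of the ambient space is as positive as (r', nu', e') *)
have posF : 0 < pfaff m.+1 (extd a0 c y) (- r' :: e' y).
  rewrite -(pfaff_cast _ _ nE) -pow2_gt0.
  apply: (orF zc (nu := nu') ac cy fy).
  - exact: (size_cons1 se' nE).
  - move=> v; rewrite inE => /orP[/eqP ->|ve]; apply/(page_tangentP Vm DM OB _ zc ac cy fy).
      by rewrite linfun1_N ?Tr' ?oppr0//; exact: page_eq_lin.
    exact: Te'.
  - have cdet0 : cdet (theta (cinv c y)) (h (cinv c y)) = 0.
      by rewrite (h_theta DM Ky) cdetZr cdetzz mulr0.
    rewrite (cdet_dtheta Vm DM _ ac cy Ky cdet0) hnu' (thetaE DM Ky) cdetZl cdet_crot.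
    by rewrite !mulr_gt0// invr_gt0 cmod_gt0.
  - rewrite cvol_gt0 (vol_cast _ _ _ nE).
    have L1 := vol_lead1 m (e' y) al wb nu'.
    have SW : vol m.+1 (a0 c y) (extd a0 c y) [:: nu', - r' & e' y] =
        vol m.+1 (a0 c y) (extd a0 c y) [:: r', nu' & e' y].
      apply: (etrans (vol_lead_swap m (e' y) al wb nu' (- r'))).
      apply: (etrans (congr1 -%R (linfun1_N r' L1))); exact: opprK.
    rewrite SW (vol_lead_comb m (e' y) al wb r nu) mulr_gt0//.
    rewrite -(pmulr_lgt0 _ Dy) -cdet_comb.
    have E1 : dfun h c y r' = (cdet hy (dfun h c y nu) / D y) *: dfun h c y r +
        (cdet (dfun h c y r) hy / D y) *: dfun h c y nu.
      rewrite /r' /frame_lift dfun_linear; congr (_ + _); exact: linearZ.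
    have E2 : dfun h c y nu' = (cdet (crot hy) (dfun h c y nu) / D y) *: dfun h c y r +
        (cdet (dfun h c y r) (crot hy) / D y) *: dfun h c y nu.
      rewrite /nu' /frame_lift dfun_linear; congr (_ + _); exact: linearZ.
    by rewrite -E1 -E2 hr' hnu' cdet_crot.
(* d a0 (Y, v) = a0 v for v in e', which is tangent to the page *)
have YE : pfaff m.+1 (extd a0 c y) (Y :: e' y) =
    m.+1.*2%:R * vol m (a0 c y) (extd a0 c y) (e' y).
  rewrite pfaff_cons; last by move=> u v; exact: extdN.
  by congr (_ * _); apply: vol_ext => // v /Te'; exact: bY.
have posY : 0 < pfaff m.+1 (extd a0 c y) (Y :: e' y) by rewrite YE mulr_gt0.
have Ql := pfaff_lead_linfun1 m (e' y) wb.
(* dh kills Y - lam r', and the kernel of dh at y is the image by the projection of the span of e *)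
have Ye : Y - lam *: r' \in span (e' y).
  have hv : dfun h c y (Y - lam *: r') = 0.
    have -> : dfun h c y (Y - lam *: r') = dfun h c y Y - lam *: dfun h c y r'.
      by rewrite /dfun linearB linearZ.
    by rewrite hr' hY subrr.
  set v := Y - lam *: r' in hv *.
  have Pv : frame_proj c r nu y v = v.
    rewrite /frame_proj hv.
    by rewrite /frame_lift /cdet /= !mul0r !mulr0 subrr !mul0r !scale0r addr0 subr0.
  have vE : v - (dfun h c x v).1 *: r - (dfun h c x v).2 *: nu \in span e.
    apply: spe; rewrite /dfun !linearB !linearZ -/(dfun h c x v) -/(dfun h c x r) -/(dfun h c x nu) hr hnu.
    case: (dfun h c x v) => a b.
    by apply/pair_equal_spec; split; rewrite /= /GRing.scale/=; ring.
  have := span_map_linear (frame_proj_linear c r nu y) vE.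
  set s := (dfun h c x v).1; set t := (dfun h c x v).2.
  have Pl := frame_proj_linear c r nu y.
  have Pr : frame_proj c r nu y r = 0 by rewrite /frame_proj frame_lift_r// subrr.
  have Pnu : frame_proj c r nu y nu = 0 by rewrite /frame_proj frame_lift_nu// subrr.
  have -> : v - s *: r - t *: nu = (- t) *: nu + ((- s) *: r + v).
    by rewrite !scaleNr [_ + v]addrC [RHS]addrC.
  by rewrite !Pl Pr Pnu !scaler0 !add0r Pv.
have Q0 : pfaff m.+1 (extd a0 c y) (Y - lam *: r' :: e' y) = 0 by exact: pfaff_lead_span.
have QY : pfaff m.+1 (extd a0 c y) (Y :: e' y) = lam * pfaff m.+1 (extd a0 c y) (r' :: e' y).
  move: Q0; rewrite (linfun1_D _ _ Ql) (linfun1_N _ Ql) (linfun1_Z _ _ Ql) => /eqP.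
  by rewrite subr_eq0 => /eqP.
move: posF; rewrite (linfun1_N _ Ql) oppr_gt0 => negF.
by move: posY; rewrite QY nmulr_lgt0.
Qed.

End NearBinding.

(** * Existence of a suitable multiple *)

Section LiouvilleDerivation.
Context {R : realType} {d : nat}.
Local Notation E := 'rV[R]_d.
Local Notation C := (cplane R).
Variable V : @atlased R E.
Hypothesis Vm : manifold V.
Variables (K : set V) (theta h : V -> C).
Hypothesis DM : defining_map K theta h.
Hypothesis OB : open_book K theta.
Variable a0 : form1 V.
Hypothesis sa0 : smooth_form setT a0.
Hypothesis nd0 : forall z, circle z -> nondegenerate_on (fibre K theta z) (extd a0).
Implicit Types (p q : V) (F G : V -> R).
Local Notation smooth_offK := (smooth_offK K).
Local Notation dliouville := (dliouville Vm h a0).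

(** Derivation rules along the field are proved in a single chart, where they
    reduce to those of the differential. *)
Lemma offK_chart p : ~ K p -> exists c, exists x, [/\ atlas V c, cimg c x, ~ K (cinv c x),
  cinv c x = p & forall F, smooth_offK F ->
    dliouville F p = dfun (F : V -> R^o) c x (liouville h a0 c x)].
Proof.
move=> Kp; have [c [ac cp]] := chart_at_ex Vm p; have cc := atlas_chart Vm ac.
have cx := chart_img cc cp; have xp := chartK cc cp.
have Kx : ~ K (cinv c (cmap c p)) by rewrite xp.
exists c, (cmap c p); split; [exact: ac|exact: cx|exact: Kx|exact: xp|] => F sF.
exact: (etrans (congr1 _ (esym xp)) (dliouvilleE Vm DM OB sa0 nd0 sF ac cx Kx)).
Qed.

Lemma dliouville_mul F G p : smooth_offK F -> smooth_offK G -> ~ K p ->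
  dliouville (fun q => F q * G q) p = F p * dliouville G p + G p * dliouville F p.
Proof.
move=> sF sG Kp; have [c [x [ac cx Kx xp L]]] := offK_chart Kp.
have sFG : smooth_offK (fun q => F q * G q).
  move=> e ae k; have oW := open_chart_pre (atlas_chart Vm ae) (open_notK Vm DM).
  exact: (CkM oW (sF e ae k) (sG e ae k)).
rewrite (L _ sFG) (L _ sF) (L _ sG) -xp.
exact: (diff_mul _ (smooth_offK_diff sF ac cx Kx) (smooth_offK_diff sG ac cx Kx)).
Qed.

Lemma smooth_offK_cst (r : R) : smooth_offK (fun=> r).
Proof. by move=> c ac k; exact: (Ck_cst k _ (r : R^o)). Qed.

Lemma dliouville_cst (r : R) p : ~ K p -> dliouville (fun=> r) p = 0.
Proof.
move=> Kp; have [c [x [ac cx Kx xp L]]] := offK_chart Kp.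
rewrite (L _ (smooth_offK_cst r)).
exact: (congr1 (fun D : E -> R^o => D _) (diff_cst (r : R^o) x)).
Qed.

Lemma dliouville_lin (s t : R) F G p : smooth_offK F -> smooth_offK G -> ~ K p ->
  dliouville (fun q => s * F q + t * G q) p = s * dliouville F p + t * dliouville G p.
Proof.
move=> sF sG Kp; have [c [x [ac cx Kx xp L]]] := offK_chart Kp.
have sFG : smooth_offK (fun q => s * F q + t * G q).
  move=> e ae k; have oW := open_chart_pre (atlas_chart Vm ae) (open_notK Vm DM).
  apply: (CkD oW).
    exact: (CkM oW (Ck_cst k _ (s : R^o)) (sF e ae k)).
  exact: (CkM oW (Ck_cst k _ (t : R^o)) (sG e ae k)).
rewrite (L _ sFG) (L _ sF) (L _ sG); set Y := liouville _ _ _ _.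
have Fd := smooth_offK_diff sF ac cx Kx; have Gd := smooth_offK_diff sG ac cx Kx.
have E1 := congr1 (fun D : E -> R^o => D Y) (diffD (differentiableZ s Fd) (differentiableZ t Gd)).
have E2 := congr1 (fun D : E -> R^o => D Y) (diffZ s Fd).
have E3 := congr1 (fun D : E -> R^o => D Y) (diffZ t Gd).
apply: (etrans E1); exact: (congr2 (fun p q : R => p + q) E2 E3).
Qed.

(** The functions may differ on the binding, where [|h|^-1] is not meaningful. *)
Lemma dliouville_ext F G p : smooth_offK F -> smooth_offK G -> (forall q, ~ K q -> F q = G q) ->
  ~ K p -> dliouville F p = dliouville G p.
Proof.
move=> sF sG FG Kp; have [c [x [ac cx Kx xp L]]] := offK_chart Kp.
rewrite (L _ sF) (L _ sG); apply: diff_near; last exact: (smooth_offK_diff sG ac cx Kx).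
have nK : \forall y \near x, ~ K (cinv c y).
  apply: (@near_cinv _ _ _ _ (atlas_chart Vm ac) _ (fun q => ~ K q) cx).
  by apply: open_nbhs_nbhs; split; [exact: (open_notK Vm DM)|].
apply: (@filterS _ _ _ _ (fun y => (G \o cinv c) y = (F \o cinv c) y) _ nK) => y Ky.
by rewrite /= FG.
Qed.

End LiouvilleDerivation.

Section Existence.
Context {R : realType} {n : nat}.
Local Notation d := (n.*2.+1).
Local Notation E := 'rV[R]_d.
Local Notation C := (cplane R).
Variable V : @atlased R E.
Hypothesis Vm : manifold V.
Hypothesis Vc : compact [set: V].
Variables (K : set V) (theta h : V -> C).
Hypothesis DM : defining_map K theta h.
Hypothesis OB : open_book K theta.
Variable a0 : form1 V.
Hypothesis sa0 : smooth_form setT a0.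
Hypothesis nd0 : forall z, circle z -> nondegenerate_on (fibre K theta z) (extd a0).
Hypothesis LYK : forall p, K p -> \forall q \near p, ~ K q -> dliouville Vm h a0 (rho h) q < 0.
Implicit Types (p q : V).
Local Notation dliouville := (dliouville Vm h a0).
Local Notation rho := (rho h).

Lemma rho_ge0 p : 0 <= rho p.
Proof. exact: cdotzz_ge0. Qed.

Lemma rho_gt0 p : ~ K p -> 0 < rho p.
Proof. by move=> Kp; apply: cdotzz_gt0; exact: (h_neq0 DM Kp). Qed.

(** Near a point of the binding the left side is negative, and any [A >= 0] works;
    near any other point the left side is bounded and [rho] is bounded below, so
    all large [A] work.  Compactness gives a common [A]. *)
Lemma dliouville_rho_bound : exists2 A : R, 0 <= A & forall p, ~ K p -> dliouville rho p < A * rho p ^+ 2.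
Proof.
pose P (A : R) q := 0 <= A /\ (~ K q -> dliouville rho q < A * rho q ^+ 2).
have /compact_near_coveringP cov := Vc.
suff H : \forall A \near +oo%R, [set: V] `<=` P A.
  have [A HA] := filter_ex H.
  by have [V0|/existsNP[p _]] := pselect (forall p : V, False);
    [exists 0 => // p; case: (V0 p)|exists A => [|q]; [case: (HA p I)|case: (HA q I)]].
apply: cov => p _; have [Kp|Kp] := pselect (K p).
  exists ([set q | ~ K q -> dliouville rho q < 0], [set A | 0 < A]) => /=.
    by split; [exact: LYK|exact: (nbhs_pinfty_gt (num_real _))].
  move=> [q A] /= [Hq A0]; split; first exact: ltW.
  by move=> /Hq H; apply: (lt_le_trans H); rewrite mulr_ge0 ?sqr_ge0// ltW.
have r0 := rho_gt0 Kp.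
(* near p the derivative of rho is less than its value plus 1, and rho is at least half of its value *)
pose B : R := (`|dliouville rho p| + 1) / (rho p / 2) ^+ 2.
have Lc := dliouville_continuous DM OB sa0 nd0 (rho_offK Vm DM) Kp.
have rc := smooth_offK_continuous Vm (rho_offK Vm DM) Kp.
have rh : rho p / 2 < rho p by rewrite ltr_pdivrMr// mulr_natr mulr2n ltrDl.
have Lh : dliouville rho p < `|dliouville rho p| + 1 by rewrite ltr_pwDr// ler_norm.
have n1 : \forall q \near p, rho p / 2 < rho q.
  exact: (@cvgr_gt _ _ _ (nbhs_filter p) _ _ rc _ rh).
have n2 : \forall q \near p, dliouville rho q < `|dliouville rho p| + 1.
  exact: (@cvgr_lt _ _ _ (nbhs_filter p) _ _ (Lc Vm) _ Lh).
exists ([set q | rho p / 2 < rho q /\ dliouville rho q < `|dliouville rho p| + 1], [set A | B < A]) => /=.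
  by split; [exact: (@filterI _ _ (nbhs_filter p) _ _ n1 n2)|exact: (nbhs_pinfty_gt (num_real _))].
have h0 : 0 < rho p / 2 by rewrite divr_gt0.
have B0 : 0 <= B by rewrite divr_ge0 ?addr_ge0// exprn_ge0// ltW.
move=> [q A] /= [[Hr HL] BA]; split; first exact: le_trans B0 (ltW BA).
move=> _; apply: (lt_le_trans HL).
have -> : `|dliouville rho p| + 1 = B * (rho p / 2) ^+ 2 by rewrite divfK// expf_neq0// gt_eqF.
apply: ler_pM => //; [by rewrite exprn_ge0// ltW|exact: ltW|].
by rewrite lerXn2r// ?nnegrE ?ltW// (lt_trans h0).
Qed.

(** Here [r = |h|^2], [L = Y r] and [L' = Y F], and the fourth hypothesis is the
    derivative of the third one.  Eliminating [L'] gives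
    [2 F r^2 (F + L') = 2 r (1 + A r) - L]. *)
Lemma stretch_identity (r A F L L' : R) : 0 < r -> 0 < F -> r * (F * F) = 1 + A * r ->
  r * (F * L' + F * L') + F * F * L = A * L -> 2 * A * r ^+ 2 > L ->
  0 < F + L'.
Proof.
move=> r0 F0 FF D LA.
have key : 2 * F * r ^+ 2 * (F + L') = 2 * r * (r * (F * F)) + r * (r * (F * L' + F * L')) by ring.
have D' : r * (F * L' + F * L') = A * L - F * F * L by rewrite -D; ring.
have E1 : r * (A * L - F * F * L) = - L.
  have -> : r * (A * L - F * F * L) = (A * r - r * (F * F)) * L by ring.
  by rewrite FF; ring.
have F2 : 0 < 2 * F * r ^+ 2 by rewrite !mulr_gt0// exprn_gt0.
rewrite -(pmulr_rgt0 _ F2) key D' E1 FF.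
nra.
Qed.

(** Take [f = sqrt (1 + A |h|^2)], so that [F = f / |h|] satisfies
    [|h|^2 F^2 = 1 + A |h|^2]; differentiating this relation along [Y] and using
    [dliouville_rho_bound] gives the claim. *)
Theorem exists_stretch : exists2 f : V -> R, (forall p, 0 < f p) /\ smooth_on_charts f &
  forall p, ~ K p ->
  0 < f p * (cmod (h p))^-1 + dliouville (fun q => f q * (cmod (h q))^-1) p.
Proof.
have [A A0 LA] := dliouville_rho_bound.
pose g p := 1 + A * rho p.
have g0 p : 0 < g p by rewrite ltr_pwDl// mulr_ge0// rho_ge0.
pose f p : R := Num.sqrt (g p).
have sg : smooth_on_charts g.
  move=> c ac k; have oc := open_cimg (atlas_chart Vm ac).
  apply: (CkD oc (Ck_cst k _ (1 : R^o))).
  exact: (CkM oc (Ck_cst k _ (A : R^o)) (rho_smooth Vm DM ac k)).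
have sf : smooth_on_charts f.
  move=> c ac k; have oc := open_cimg (atlas_chart Vm ac).
  by apply: (Ck_sqrt oc _ (sg c ac k)) => x _; exact: g0.
have f0 p : 0 < f p by rewrite sqrtr_gt0.
exists f => // p Kp; pose F q := f q * (cmod (h q))^-1.
have sF : smooth_offK K F.
  by apply: (smooth_offKM Vm DM); [exact: smooth_on_charts_offK|exact: (invh_smooth Vm DM)].
have sFF := smooth_offKM Vm DM sF sF.
have sr := rho_offK Vm DM.
have srFF := smooth_offKM Vm DM sr sFF.
have FE q : ~ K q -> rho q * (F q * F q) = 1 + A * rho q.
  move=> Kq; have m0 : 0 < cmod (h q) by apply: cmod_gt0; exact: (h_neq0 DM Kq).
  have ff : f q * f q = g q by rewrite -expr2 sqr_sqrtr// ltW.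
  have rE : rho q = cmod (h q) ^+ 2 by rewrite sqr_cmod.
  have H (m t : R) : 0 < m -> m ^+ 2 * ((t * m^-1) * (t * m^-1)) = t * t.
    by move=> m_gt0; field; rewrite gt_eqF.
  by rewrite {1}rE /F H.
have sgK : smooth_offK K g by exact: smooth_on_charts_offK.
have E1 := dliouville_ext Vm DM OB sa0 nd0 srFF sgK FE Kp.
have E2 : dliouville g p = A * dliouville rho p.
  have := dliouville_lin Vm DM OB sa0 nd0 1 A (smooth_offK_cst K 1) sr Kp.
  have -> : (fun q => 1 * 1 + A * rho q) = g by apply/funext => q; rewrite mulr1.
  by move=> ->; rewrite (dliouville_cst Vm DM OB sa0 nd0 1 Kp) mulr0 add0r.
have E3 := dliouville_mul Vm DM OB sa0 nd0 sr sFF Kp.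
have E4 := dliouville_mul Vm DM OB sa0 nd0 sF sF Kp.
apply: (@stretch_identity (rho p) A (F p) (dliouville rho p)) => //.
- exact: rho_gt0.
- by rewrite mulr_gt0// invr_gt0 cmod_gt0//; exact: (h_neq0 DM Kp).
- exact: FE.
- by rewrite -E4 -E3 E1 E2.
- apply: (lt_le_trans (LA p Kp)); rewrite ler_pM2r ?exprn_gt0 ?rho_gt0//.
  by rewrite ler_peMl// ler1n.
Qed.

End Existence.

(** * The cone of equations *)

Section Characterization.
Context {R : realType} {n : nat}.
Local Notation d := (n.*2.+1).
Local Notation E := 'rV[R]_d.
Local Notation C := (cplane R).
Variable V : @atlased R E.
Hypothesis Vm : manifold V.
Hypothesis Vc : compact [set: V].
Variables (K : set V) (theta h : V -> C).
Hypothesis DM : defining_map K theta h.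
Hypothesis OB : open_book K theta.
Variables (xi : cohyp V) (a0 : form1 V).
Hypothesis ea0 : equation xi a0.
Hypothesis nz0 : forall c x, atlas V c -> cimg c x -> exists v, a0 c x v != 0.
Hypothesis ct0 : contact_on K n.-1 a0.
Hypothesis nd0 : forall z, circle z -> nondegenerate_on (fibre K theta z) (extd a0).
Local Notation dliouville := (dliouville Vm h a0).
Local Notation invh := (fun p => (cmod (h p))^-1).
Implicit Types (a b : form1 V) (f : V -> R).

Definition good_equation a := equation xi a /\
  forall z, circle z -> ideal_liouville n (page K theta z) K (extd (scalef invh a)).

Definition good_factor f := [/\ forall p, 0 < f p, smooth_on_charts f &
  forall p, ~ K p -> 0 < f p * invh p + dliouville (fun q => f q * invh q) p].

(** The reduction of the problem to a condition on the factor [f], linear in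
    [f] apart from the inequalities. *)
Theorem good_equationP a :
  good_equation a <-> exists2 f, good_factor f & same_form a (scalef f a0).
Proof.
split=> [[ea La]|[f [f0 sf sg] af]].
  have [f [f0 af sf]] := equation_ratio Vm ea ea0 nz0.
  exists f => //; split=> // p Kp; have zc := circle_theta DM Kp.
  have [_ nda _] := La _ zc; move: nda; rewrite page_minus_K => nda.
  exact: (good_stretch Vm Vc DM OB ea0 nd0 af f0 sf zc nda (fibre_theta theta Kp)).
split; first exact: (equation_scalef Vm ea0 af f0 sf).
move=> z zc; apply: (ideal_liouville_of Vm Vc DM OB ea0 ct0 af f0 sf zc).
apply/(nondegenerate_stretch Vm DM OB ea0 nd0 af f0 sf zc) => p [Kp _].
by rewrite gt_eqF// sg.
Qed.

(** [f |-> f / |h| + Y (f / |h|)] is linear. *)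
Lemma good_factor_lin (s t : R) f g : 0 <= s -> 0 <= t -> 0 < s + t ->
  good_factor f -> good_factor g -> good_factor (fun p => s * f p + t * g p).
Proof.
move=> s0 t0 st [f0 sf f1] [g0 sg g1].
have pos (x y : R) : 0 < x -> 0 < y -> 0 < s * x + t * y.
  move=> x0 y0; have [s_gt0|] := ltP 0 s; first by rewrite ltr_wpDr ?mulr_ge0 ?mulr_gt0// ltW.
  move=> s_le0; have se : s = 0 by apply/eqP; rewrite eq_le s_le0.
  by move: st; rewrite se !add0r mul0r add0r => t_gt0; exact: mulr_gt0.
split=> [p||p Kp]; first exact: pos.
  move=> c ac k; have oc := open_cimg (atlas_chart Vm ac).
  apply: (CkD oc).
    exact: (CkM oc (Ck_cst k _ (s : R^o)) (sf c ac k)).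
  exact: (CkM oc (Ck_cst k _ (t : R^o)) (sg c ac k)).
have sfh : smooth_offK K (fun q => f q * invh q).
  by apply: (smooth_offKM Vm DM); [exact: smooth_on_charts_offK|exact: (invh_smooth Vm DM)].
have sgh : smooth_offK K (fun q => g q * invh q).
  by apply: (smooth_offKM Vm DM); [exact: smooth_on_charts_offK|exact: (invh_smooth Vm DM)].
have FE : (fun q => (s * f q + t * g q) * invh q) =
    (fun q => s * (f q * invh q) + t * (g q * invh q)).
  by apply/funext => q; rewrite mulrDl !mulrA.
have LE := dliouville_lin Vm DM OB (proj1 ea0) nd0 s t sfh sgh Kp.
rewrite FE LE mulrDl -!mulrA addrACA -!mulrDr.
by apply: pos; [exact: f1|exact: g1].
Qed.

End Characterization.

Theorem proposition19 (R : realType) (n : nat)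
    (V : @atlased R 'rV[R]_(n.*2.+1)) (xi : cohyp V)
    (K : set V) (theta h : V -> cplane R) :
  closed_manifold V -> contact_structure n xi ->
  open_book K theta -> supports n xi K theta -> defining_map K theta h ->
  let good : set (form1 V) :=
    [set a | equation xi a /\
       forall z, circle z ->
         ideal_liouville n (page K theta z) K
           (extd (scalef (fun p => (cmod (h p))^-1) a))] in
  good !=set0 /\ convex_cone good.

Proof.
move=> [Vm Vc] [b [eb cb]] OB [a0 [ea0 ctK orK orF]] DM good.
have nzb c x := contact_neq0 (c := c) (x := x) Vm cb.
have [g [g0 ag sg]] := equation_ratio Vm ea0 eb nzb.
have ct0 : contact_on setT n a0.
  apply: (contact_near Vm ag); apply: contact_scalef; [exact: proj1 eb| | |exact: cb].
    by move=> c x ac cx; have [gd _] := sg c ac 1; exact: gd.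
  by move=> p; rewrite gt_eqF.
have nz0 c x := contact_neq0 (c := c) (x := x) Vm ct0.
have nd0 z (zc : circle z) := proj1 (orF z zc).
have sa0 := proj1 ea0.
have goodE := good_equationP Vm Vc DM OB ea0 nz0 ctK nd0.
have lin a a' s t : 0 <= s -> 0 <= t -> 0 < s + t -> good a -> good a' ->
    good (fun c x v => s * a c x v + t * a' c x v).
  move=> s0 t0 st /goodE[f gf af] /goodE[f' gf' af']; apply/goodE.
  exists (fun p => s * f p + t * f' p).
    exact: (good_factor_lin DM OB ea0 nd0 s0 t0 st gf gf').
  move=> c x v ac cx; rewrite af// af'// /scalef; ring.
split.
  have LYK p (Kp : K p) : \forall q \near p, ~ K q -> dliouville Vm h a0 (rho h) q < 0.
    exact: (dliouville_rho_lt0 Vm DM OB sa0 nd0 ct0 (orK h DM) (fun z zc => proj2 (orF z zc)) Kp).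
  have [f [f0 sf] f1] := exists_stretch Vc DM OB sa0 nd0 LYK.
  by exists (scalef f a0); apply/goodE; exists f.
split=> [t a t0 ga|t a a' /andP[t0 t1] ga ga'].
  (* the multiple t a is the combination t a + 0 a *)
  have -> : (fun c x v => t * a c x v) = (fun c x v => t * a c x v + 0 * a c x v).
    by apply/funext => c; apply/funext => x; apply/funext => v; rewrite mul0r addr0.
  by apply: lin => //; [exact: ltW|rewrite addr0].
by apply: lin => //; [rewrite subr_ge0|rewrite addrC subrK ltr01].
Qed.
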